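(* Let $r\ge 4$ be an integer and let $f$ be a $C^r$ diffeomorphism of $\mathbb R^2$ for which $0$ is a hyperbolic fixed point whose eigenvalues $\lambda,\sigma$ are real with $|\lambda|<1<|\sigma|$ and satisfy $|\lambda|\,|\sigma|^{r-2}<1$. Then $f$ is $C^{r-2}$-linearizable at $0$: there exist a neighborhood $U$ of $0$ and a $C^{r-2}$ diffeomorphism $\phi$ from $U$ onto a neighborhood of $0$, with $\phi(0)=0$, such that $f\circ\phi=\phi\circ D_0f$ wherever both sides are defined in $U$. *)

(* Defs.v *)
From Stdlib Require Import Reals.
From Coquelicot Require Import Coquelicot.
Open Scope R_scope.

Definition partial1 (g : R * R -> R) (p : R * R) : R :=
  Derive (fun t => g (t, snd p)) (fst p).
Definition partial2 (g : R * R -> R) (p : R * R) : R :=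
  Derive (fun t => g (fst p, t)) (snd p).

(* g is C^k on U: all partial derivatives of order <= k exist and are
   continuous at every point of U (U will always be open). *)
Fixpoint Ck (k : nat) (U : R * R -> Prop) (g : R * R -> R) : Prop :=
  match k with
  | O => forall p, U p -> continuous g p
  | S k' =>
      (forall p, U p -> continuous g p) /\
      (forall p, U p -> ex_derive (fun t => g (t, snd p)) (fst p)
                     /\ ex_derive (fun t => g (fst p, t)) (snd p)) /\
      Ck k' U (partial1 g) /\ Ck k' U (partial2 g)
  end.

Definition CkMap (k : nat) (U : R * R -> Prop) (F : R * R -> R * R) : Prop :=
  Ck k U (fun p => fst (F p)) /\ Ck k U (fun p => snd (F p)).

Definition Ck_diffeo_R2 (k : nat) (f : R * R -> R * R) : Prop :=
  exists g : R * R -> R * R,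
    (forall p, g (f p) = p) /\ (forall p, f (g p) = p) /\
    CkMap k (fun _ => True) f /\ CkMap k (fun _ => True) g.

Definition origin : R * R := (0, 0).

Definition Dmap (f : R * R -> R * R) (p : R * R) (v : R * R) : R * R :=
  (partial1 (fun q => fst (f q)) p * fst v + partial2 (fun q => fst (f q)) p * snd v,
   partial1 (fun q => snd (f q)) p * fst v + partial2 (fun q => snd (f q)) p * snd v).

Definition eigenvalue (L : R * R -> R * R) (t : R) : Prop :=
  exists v : R * R, v <> origin /\ L v = (t * fst v, t * snd v).

Definition Ck_linearizable_at0 (k : nat) (f : R * R -> R * R) : Prop :=
  exists (U V : R * R -> Prop) (phi psi : R * R -> R * R),
    open U /\ U origin /\ open V /\ V origin /\
    (forall x, U x -> V (phi x) /\ psi (phi x) = x) /\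
    (forall y, V y -> U (psi y) /\ phi (psi y) = y) /\
    CkMap k U phi /\ CkMap k V psi /\
    phi origin = origin /\
    (forall x, U x -> U (Dmap f origin x) -> f (phi x) = phi (Dmap f origin x)).

(* Main.v *)
Require Import Defs.
From Stdlib Require Import Reals.
From Coquelicot Require Import Coquelicot.
From Stdlib Require Import Lra Lia List Ranalysis5.
Open Scope R_scope.

(** After straightening, [f] preserves the axis [x = 0] (the unstable manifold), on which it
    is [y |-> sig y]; it then has the form [(x F(x,y), sig y + O(x))].  The linearization is
    the inverse of [(u, v)], where [u o f = lam u] and [v o f = sig v].  Writing
    [v = y + w] and [u = x exp E] turns these into the linear cohomological equations
    [w - w o f / sig = m] and [E - E o f = ln (F / lam)].  Along the axis, the second one
    is solved by summing over backward orbits, which leaves right-hand sides vanishing on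
    [x = 0].  These are summed over forward orbits: a function which is [O(x)] decays like
    [lam ^ k], its derivatives of order [n] in [y] grow at most like [sig ^ (n k)], and
    [|lam| |sig| ^ n < 1] for [n = r - 2].  One derivative is lost in dividing by [x] to
    form [F], another one in turning vanishing on [x = 0] into the bound [O(x)].
    The unstable manifold is found as a curve [K] with [K(sig t) = f(K(t))]. *)

(** The logarithm is what makes the equation for [u] solvable: iterating [u = (u o f) / lam]
    forwards would multiply by [1 / |lam|] at each step and use up the decay that the factor [x]
    supplies, whereas the additive equation for [E] has multiplier 1. The stable manifold is never
    straightened; it comes out as the zero set of [v]. No formula for higher derivatives is needed:
    the partial derivatives of the unknowns up to order [n] are treated as independent unknowns of a
    single contraction, on families whose members are derivatives of one another, a condition that
    survives uniform limits. Each derivative in [x] brings a factor [lam] through the chain rule, so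
    only the pure [y]-derivatives must be measured against [|x|]. The equations live on the strip
    [|x| < 1], which must be forward invariant with uniform bounds; hence the nonlinearities are
    first rescaled and cut off so as to be small in [C^2] on the whole plane. The equation of [K] is
    nonlinear, so a contraction gives [K] in [C^1] only, and linear theory then makes it as smooth
    as [f]: straightening costs no derivative. *)

(** * Partial derivatives *)

(* The Boolean selects a variable: [false] is the first one, [true] the second. *)
Definition slice (b : bool) (p : R * R) (t : R) : R * R :=
  if b then (fst p, t) else (t, snd p).
Definition coord (b : bool) (p : R * R) : R := if b then snd p else fst p.
Definition pd (b : bool) (g : R * R -> R) : R * R -> R :=
  if b then partial2 g else partial1 g.
Definition is_pd (b : bool) (g : R * R -> R) (p : R * R) (l : R) : Prop :=
  is_derive (fun t => g (slice b p t)) (coord b p) l.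
Definition ex_pd (b : bool) (g : R * R -> R) (p : R * R) : Prop :=
  ex_derive (fun t => g (slice b p t)) (coord b p).

Lemma slice_coord b p : slice b p (coord b p) = p.
Proof. destruct b, p; reflexivity. Qed.

Lemma slice_slice b p s t : slice b (slice b p s) t = slice b p t.
Proof. destruct b; reflexivity. Qed.

Lemma coord_slice b p t : coord b (slice b p t) = t.
Proof. destruct b; reflexivity. Qed.

Lemma is_pd_unique {b g p l} : is_pd b g p l -> pd b g p = l.
Proof. intros H; destruct b; apply is_derive_unique, H. Qed.

Lemma ex_pd_correct {b g p} : ex_pd b g p -> is_pd b g p (pd b g p).
Proof. intros H; destruct b; apply Derive_correct, H. Qed.

Lemma is_pd_ex b g p l : is_pd b g p l -> ex_pd b g p.
Proof. intros H; exists l; exact H. Qed.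

Lemma ball_pair (p q : R * R) (d : R) :
  Rabs (fst q - fst p) < d -> Rabs (snd q - snd p) < d -> ball p d q.
Proof. intros H1 H2; split; assumption. Qed.

Lemma ball_pair_inv {p q : R * R} {d : R} :
  ball p d q -> Rabs (fst q - fst p) < d /\ Rabs (snd q - snd p) < d.
Proof. intros [H1 H2]; split; assumption. Qed.

Lemma slice_ball b p t d :
  Rabs (t - coord b p) < d -> ball p d (slice b p t).
Proof.
intros H.
assert (Hd : 0 < d) by (pose proof (Rabs_pos (t - coord b p)); lra).
apply ball_pair; destruct b; simpl in *; try exact H;
  rewrite Rminus_diag; rewrite Rabs_R0; exact Hd.
Qed.

Lemma locally_slice b p (P : R * R -> Prop) :
  locally p P -> locally (coord b p) (fun t => P (slice b p t)).
Proof.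
intros [d Hd]; exists d; intros t Ht.
apply Hd, slice_ball, Ht.
Qed.

Lemma is_pd_ext_loc b g h p l :
  locally p (fun q => g q = h q) -> is_pd b g p l -> is_pd b h p l.
Proof.
intros H; apply is_derive_ext_loc.
exact (locally_slice b p _ H).
Qed.

Lemma open_locally (U : R * R -> Prop) (P : R * R -> Prop) p :
  open U -> (forall q : R * R, U q -> P q) -> U p -> locally p P.
Proof. intros HU H Hp; exact (filter_imp _ _ H (HU p Hp)). Qed.

(** Total differentiability at [p] with gradient [(a, b)], which the two-variable chain rule
    requires of the outer function. *)
Definition dif (g : R * R -> R) (p : R * R) (a b : R) : Prop :=
  differentiable_pt_lim (fun x y => g (x, y)) (fst p) (snd p) a b.

(** The two variables play different roles: the mean value theorem near [p] and the continuity of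
    [g1] handle the first, the derivative at the single point [p] handles the second. *)
Lemma dif_of_C1 (U : R * R -> Prop) (g g1 g2 : R * R -> R) p :
  open U -> U p ->
  (forall q, U q -> is_pd false g q (g1 q)) -> is_pd true g p (g2 p) ->
  continuous g1 p -> dif g p (g1 p) (g2 p).
Proof.
intros HU Hp H1 H2 Hc.
apply filterdiff_differentiable_pt_lim.
destruct p as [x y]; simpl.
apply (is_derive_filterdiff (fun x y => g (x, y)) x y (fun x y => g1 (x, y)) (g2 (x, y))).
- apply (open_locally U); try assumption.
  intros [u v] Hq; apply (H1 _ Hq).
- exact H2.
- apply continuous_ext with (2 := Hc); intros [u v]; reflexivity.
Qed.

Lemma is_pd_comp b g (F1 F2 : R * R -> R) p l1 l2 a1 a2 :
  dif g (F1 p, F2 p) l1 l2 -> is_pd b F1 p a1 -> is_pd b F2 p a2 ->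
  is_pd b (fun q => g (F1 q, F2 q)) p (l1 * a1 + l2 * a2).
Proof.
intros Hg H1 H2.
apply is_derive_Reals.
apply (derivable_pt_lim_comp_2d (fun x y => g (x, y))
  (fun t => F1 (slice b p t)) (fun t => F2 (slice b p t))).
- rewrite slice_coord; exact Hg.
- apply is_derive_Reals, H1.
- apply is_derive_Reals, H2.
Qed.

Lemma is_pd_plus {b g h p l m} :
  is_pd b g p l -> is_pd b h p m -> is_pd b (fun q => g q + h q) p (l + m).
Proof. intros H1 H2; exact (is_derive_plus _ _ _ _ _ H1 H2). Qed.

Lemma is_pd_mult {b g h p l m} :
  is_pd b g p l -> is_pd b h p m -> is_pd b (fun q => g q * h q) p (l * h p + g p * m).
Proof.
intros H1 H2.
pose proof (is_derive_mult _ _ _ _ _ H1 H2 Rmult_comm) as H.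
cbv beta in H; rewrite !slice_coord in H; exact H.
Qed.

Lemma is_pd_const b c p : is_pd b (fun _ => c) p 0.
Proof. exact (is_derive_const c _). Qed.

Lemma is_pd_fst b p : is_pd b fst p (if b then 0 else 1).
Proof. destruct b; [exact (is_derive_const _ _) | exact (is_derive_id _)]. Qed.

Lemma is_pd_snd b p : is_pd b snd p (if b then 1 else 0).
Proof. destruct b; [exact (is_derive_id _) | exact (is_derive_const _ _)]. Qed.

Definition delta (i j : bool) : R := if Bool.eqb i j then 1 else 0.

Lemma coord_is_pd b j p : is_pd b (coord j) p (delta b j).
Proof.
destruct b, j; [exact (is_pd_snd true p)|exact (is_pd_fst true p)
  |exact (is_pd_snd false p)|exact (is_pd_fst false p)].
Qed.

Lemma is_pd_scal b c g p l : is_pd b g p l -> is_pd b (fun q => c * g q) p (c * l).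
Proof. exact (is_derive_scal _ _ _ _). Qed.

Lemma is_pd_comp1 b (h : R -> R) g p l m :
  is_derive h (g p) m -> is_pd b g p l -> is_pd b (fun q => h (g q)) p (m * l).
Proof.
intros Hh Hg.
assert (H : is_derive h (g (slice b p (coord b p))) m) by (rewrite slice_coord; exact Hh).
pose proof (is_derive_comp h (fun t => g (slice b p t)) _ _ _ H Hg) as H'.
unfold scal in H'; simpl in H'; unfold mult in H'; simpl in H'.
rewrite Rmult_comm; exact H'.
Qed.

Lemma continuous_pair (F1 F2 : R * R -> R) p :
  continuous F1 p -> continuous F2 p -> continuous (fun q => (F1 q, F2 q)) p.
Proof.
intros H1 H2 P [d Hd].
specialize (H1 _ (locally_ball (F1 p) d)); specialize (H2 _ (locally_ball (F2 p) d)).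
unfold filtermap; generalize (filter_and (fun q => ball (F1 p) d (F1 q)) (fun q => ball (F2 p) d (F2 q)) H1 H2).
apply filter_imp.
intros q [K1 K2]; apply Hd; split; assumption.
Qed.

Lemma continuous_comp_pair (g F1 F2 : R * R -> R) p :
  continuous g (F1 p, F2 p) -> continuous F1 p -> continuous F2 p ->
  continuous (fun q => g (F1 q, F2 q)) p.
Proof.
intros Hg H1 H2.
apply (continuous_comp (fun q => (F1 q, F2 q)) g p); [|exact Hg].
apply continuous_pair; assumption.
Qed.

Lemma continuous_slice b p t : continuous (slice b p) t.
Proof.
intros P [d Hd]; exists d; intros s Hs; apply Hd.
destruct b; apply ball_pair; simpl; try exact Hs;
  rewrite Rminus_diag, Rabs_R0; apply cond_pos.
Qed.

Lemma continuous_Rplus (g h : R * R -> R) p :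
  continuous g p -> continuous h p -> continuous (fun q => g q + h q) p.
Proof. intros; apply (continuous_plus g h); assumption. Qed.

Lemma continuous_Rmult (g h : R * R -> R) p :
  continuous g p -> continuous h p -> continuous (fun q => g q * h q) p.
Proof. intros; apply (continuous_mult g h); assumption. Qed.

Lemma pd_mean_value b g (p : R * R) s t B :
  (forall c, Rmin s t <= c <= Rmax s t ->
    exists l, is_pd b g (slice b p c) l /\ Rabs l <= B) ->
  Rabs (g (slice b p t) - g (slice b p s)) <= B * Rabs (t - s).
Proof.
intros H.
assert (H' : forall c, Rmin s t <= c <= Rmax s t ->
  is_derive (fun u => g (slice b p u)) c (pd b g (slice b p c)) /\
  Rabs (pd b g (slice b p c)) <= B).
{ intros c Hc; destruct (H c Hc) as [l [H1 H2]].
  rewrite (is_pd_unique H1); split; [|exact H2].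
  unfold is_pd in H1; rewrite coord_slice in H1.
  apply is_derive_ext with (2 := H1); intros u; rewrite slice_slice; reflexivity. }
destruct (MVT_gen (fun u => g (slice b p u)) s t (fun c => pd b g (slice b p c)))
  as [c [Hc Heq]].
- intros c Hc; apply H'; lra.
- intros c Hc; apply continuity_pt_filterlim, @ex_derive_continuous.
  eexists; apply H', Hc.
- rewrite Heq, Rabs_mult; apply Rmult_le_compat_r; [apply Rabs_pos|apply H', Hc].
Qed.

Lemma pd_lipschitz (g : R * R -> R) B p q :
  (forall b c, ex_pd b g c) -> (forall b c, Rabs (pd b g c) <= B) ->
  Rabs (g q - g p) <= B * (Rabs (fst q - fst p) + Rabs (snd q - snd p)).
Proof.
intros He HB.
assert (H : forall b p s t, Rabs (g (slice b p t) - g (slice b p s)) <= B * Rabs (t - s)).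
{ intros b p' s t; apply pd_mean_value; intros c _; exists (pd b g (slice b p' c)).
  split; [apply ex_pd_correct, He|apply HB]. }
destruct p as [x y], q as [u v].
pose proof (H false (x, y) x u) as H1; pose proof (H true (u, y) y v) as H2.
simpl in *.
replace (g (u, v) - g (x, y)) with ((g (u, v) - g (u, y)) + (g (u, y) - g (x, y))) by ring.
eapply Rle_trans; [apply Rabs_triang|]; lra.
Qed.

(** * Weighted classes of smooth functions *)

(* The weight [true] forces a function to be [O(x)] at the axis [x = 0]. *)
Definition wt (b : bool) (p : R * R) : R := if b then Rmin 1 (Rabs (fst p)) else 1.

Lemma wt_pos b p : 0 <= wt b p.
Proof. destruct b; simpl; [|lra]; apply Rmin_glb; [lra|apply Rabs_pos]. Qed.

Lemma wt_le1 b p : wt b p <= 1.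
Proof. destruct b; simpl; [apply Rmin_l|lra]. Qed.

Definition wbound (w : option bool) (U : R * R -> Prop) (g : R * R -> R) : Prop :=
  match w with
  | None => True
  | Some b => exists C, forall p, U p -> Rabs (g p) <= C * wt b p
  end.

(** The weight left after a derivative in [x]: such a derivative of a function vanishing on the axis
    need not vanish there, but stays bounded. *)
Definition wflat (w : option bool) : option bool := option_map (fun _ => false) w.

(* [CW k U None] is [Ck k U]; [CW k U (Some b)] moreover bounds all partial
   derivatives of order at most [k], those in the second variable alone with the
   weight [b]. *)
Fixpoint CW (k : nat) (U : R * R -> Prop) (w : option bool) (g : R * R -> R) : Prop :=
  (forall p, U p -> continuous g p) /\ wbound w U g /\
  match k with
  | O => True
  | S k' =>
      (forall b p, U p -> ex_pd b g p) /\
      CW k' U (wflat w) (pd false g) /\ CW k' U w (pd true g)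
  end.

Lemma CW_Ck k U g : CW k U None g <-> Ck k U g.
Proof.
revert g; induction k as [|k IH]; intros g; simpl; [tauto|].
rewrite <- (IH (partial1 g)), <- (IH (partial2 g)); simpl; split.
- intros [H1 [_ [H2 [H3 H4]]]]; repeat split; try assumption;
    [exact (H2 false p H)|exact (H2 true p H)].
- intros [H1 [H2 [H3 H4]]]; split; [exact H1|]; split; [exact I|].
  split; [|tauto]; intros [|] p Hp; destruct (H2 p Hp); assumption.
Qed.

Lemma CW_cont {k U w g} p : CW k U w g -> U p -> continuous g p.
Proof. destruct k; intros H; apply H. Qed.

Lemma CW_wbound {k U w g} : CW k U w g -> wbound w U g.
Proof. destruct k; intros H; apply H. Qed.

Lemma CW_bound {k U b g} : CW k U (Some b) g ->
  exists C, 0 <= C /\ forall p, U p -> Rabs (g p) <= C * wt b p.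
Proof.
intros H; destruct (CW_wbound H) as [C HC].
exists (Rabs C); split; [apply Rabs_pos|]; intros p Hp.
eapply Rle_trans; [apply (HC p Hp)|].
apply Rmult_le_compat_r; [apply wt_pos|apply Rle_abs].
Qed.

Lemma CW_ex_pd {k U w g} b p : CW (S k) U w g -> U p -> ex_pd b g p.
Proof. intros H; apply H. Qed.

Lemma CW_is_pd {k U w g} b p : CW (S k) U w g -> U p -> is_pd b g p (pd b g p).
Proof. intros H Hp; apply ex_pd_correct; exact (CW_ex_pd _ _ H Hp). Qed.

Lemma wflat_flat w : wflat (wflat w) = wflat w.
Proof. destruct w; reflexivity. Qed.

Lemma wbound_flat w U g : wbound w U g -> wbound (wflat w) U g.
Proof.
destruct w as [b|]; simpl; [|tauto]; intros [C HC]; exists (Rabs C); intros p Hp.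
eapply Rle_trans; [apply (HC p Hp)|].
apply Rle_trans with (Rabs C * wt b p).
- apply Rmult_le_compat_r; [apply wt_pos|apply Rle_abs].
- apply Rmult_le_compat_l; [apply Rabs_pos|apply wt_le1].
Qed.

Lemma CW_flat {k U w g} : CW k U w g -> CW k U (wflat w) g.
Proof.
revert w g; induction k as [|k IH]; intros w g H; simpl in *;
  destruct H as [H1 [H2 H3]]; (split; [exact H1|]); (split; [apply wbound_flat, H2|]).
- exact I.
- destruct H3 as [H3 [H4 H5]]; split; [exact H3|]; split; [|apply IH, H5].
  apply IH, H4.
Qed.

Lemma CW_pd {k U w g} (b : bool) : CW (S k) U w g -> CW k U (if b then w else wflat w) (pd b g).
Proof. intros H; destruct b; apply H. Qed.

Lemma CW_pd_flat {k U w g} b : CW (S k) U w g -> CW k U (wflat w) (pd b g).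
Proof.
intros H; pose proof (CW_pd b H); destruct b; [apply CW_flat|]; assumption.
Qed.

Lemma CW_flat_pd {k U w g} b : CW (S k) U (wflat w) g -> CW k U (wflat w) (pd b g).
Proof. intros H; rewrite <- (wflat_flat w); apply CW_pd_flat, H. Qed.

Lemma CW_None {k U w g} : CW k U w g -> CW k U None g.
Proof.
revert w g; induction k as [|k IH]; intros w g H; simpl in *;
  destruct H as [H1 [H2 H3]]; (split; [exact H1|]); (split; [exact I|]).
- exact I.
- destruct H3 as [H3 [H4 H5]]; split; [exact H3|]; split; [|exact (IH _ _ H5)].
  exact (IH _ _ H4).
Qed.

Lemma CW_sub k U V w g : (forall p, V p -> U p) -> CW k U w g -> CW k V w g.
Proof.
intros HV; revert w g; induction k as [|k IH]; intros w g H; simpl in *;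
  destruct H as [H1 [H2 H3]]; (split; [intros; apply H1, HV; assumption|]);
  (split; [destruct w; simpl in *; [destruct H2 as [C HC]; exists C; intros; apply HC, HV; assumption|exact I]|]).
- exact I.
- destruct H3 as [H3 [H4 H5]]; split; [intros; apply H3, HV; assumption|].
  split; apply IH; assumption.
Qed.

Lemma CW_S {k U w g} : CW (S k) U w g -> CW k U w g.
Proof.
revert w g; induction k as [|k IH]; intros w g H.
- destruct H as [H1 [H2 _]]; repeat split; assumption.
- destruct H as [H1 [H2 [H3 [H4 H5]]]]; split; [exact H1|]; split; [exact H2|].
  split; [exact H3|]; split; apply IH; assumption.
Qed.

Lemma CW_le k l U w g : (k <= l)%nat -> CW l U w g -> CW k U w g.
Proof. intros H; induction H; [tauto|]; intros H'; apply IHle, CW_S, H'. Qed.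

Lemma pd_ext_on b (U : R * R -> Prop) g h p :
  open U -> (forall q, U q -> g q = h q) -> U p -> ex_pd b g p -> pd b h p = pd b g p.
Proof.
intros HU H Hp He; apply is_pd_unique.
apply is_pd_ext_loc with (2 := ex_pd_correct He).
exact (open_locally U _ p HU H Hp).
Qed.

Lemma CW_ext k (U : R * R -> Prop) w (g h : R * R -> R) :
  open U -> (forall p : R * R, U p -> g p = h p) -> CW k U w g -> CW k U w h.
Proof.
intros HU; revert w g h; induction k as [|k IH]; intros w g h E H; simpl in *;
  destruct H as [H1 [H2 H3]].
all: split; [intros p Hp; apply continuous_ext_loc with (2 := H1 p Hp);
  apply (open_locally U); assumption|].
all: split; [destruct w; simpl in *; [destruct H2 as [C HC]; exists C; intros p Hp;
  rewrite <- (E p Hp); apply HC, Hp|exact I]|].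
- exact I.
- destruct H3 as [H3 [H4 H5]].
  assert (E' : forall b p, U p -> pd b g p = pd b h p)
    by (intros b p Hp; symmetry; apply (pd_ext_on b U); auto).
  split.
  + intros b p Hp; exists (pd b g p).
    apply is_pd_ext_loc with (2 := ex_pd_correct (H3 b p Hp)).
    exact (open_locally U _ p HU E Hp).
  + split; [apply (IH _ _ _ (E' false) H4)|apply (IH _ _ _ (E' true) H5)].
Qed.

Lemma CW_intro k U w g (d : bool -> R * R -> R) :
  open U -> (forall p, U p -> continuous g p) -> wbound w U g ->
  (forall b p, U p -> is_pd b g p (d b p)) ->
  CW k U (wflat w) (d false) -> CW k U w (d true) -> CW (S k) U w g.
Proof.
intros HU H1 H2 H3 H4 H5; split; [exact H1|]; split; [exact H2|]; split.
- intros b p Hp; exact (is_pd_ex _ _ _ _ (H3 b p Hp)).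
- split; [apply CW_ext with (3 := H4)|apply CW_ext with (3 := H5)]; try exact HU;
    intros p Hp; symmetry; apply is_pd_unique, H3, Hp.
Qed.

Lemma wbound_0 w U : wbound w U (fun _ => 0).
Proof.
destruct w; simpl; [|exact I]; exists 0; intros; rewrite Rabs_R0; lra.
Qed.

Lemma wbound_plus w U g h : wbound w U g -> wbound w U h -> wbound w U (fun p => g p + h p).
Proof.
destruct w; simpl; [|tauto]; intros [C HC] [D HD]; exists (C + D); intros p Hp.
eapply Rle_trans; [apply Rabs_triang|].
specialize (HC p Hp); specialize (HD p Hp); lra.
Qed.

Lemma wbound_mult w U g h :
  wbound (wflat w) U g -> wbound w U h -> wbound w U (fun p => g p * h p).
Proof.
destruct w as [b|]; simpl; [|tauto]; intros [C HC] [D HD]; exists (C * D); intros p Hp.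
rewrite Rabs_mult, Rmult_assoc.
specialize (HC p Hp); specialize (HD p Hp).
apply Rmult_le_compat; try apply Rabs_pos; try assumption; lra.
Qed.

Lemma CW_0 k U w : CW k U w (fun _ => 0).
Proof.
revert U w; induction k as [|k IH]; intros U w.
- split; [intros; apply continuous_const|]; split; [apply wbound_0|exact I].
- apply CW_sub with (U := fun _ => True); [tauto|].
  apply CW_intro with (d := fun _ _ => 0); try apply IH; try apply open_true.
  + intros; apply continuous_const.
  + apply wbound_0.
  + intros; apply is_pd_const.
Qed.

Lemma CW_const k U w c : CW k U (wflat w) (fun _ => c).
Proof.
assert (Hb : forall V : R * R -> Prop, wbound (wflat w) V (fun _ => c))
  by (intros V; destruct w; simpl; [exists (Rabs c); intros; lra|exact I]).
destruct k as [|k].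
- split; [intros; apply continuous_const|]; split; [apply Hb|exact I].
- apply CW_sub with (U := fun _ => True); [tauto|].
  apply CW_intro with (d := fun _ _ => 0); try apply CW_0; try apply open_true.
  + intros; apply continuous_const.
  + apply Hb.
  + intros; apply is_pd_const.
Qed.

Lemma CW_plus k U w g h : open U ->
  CW k U w g -> CW k U w h -> CW k U w (fun p => g p + h p).
Proof.
intros HU; revert w g h; induction k as [|k IH]; intros w g h Hg Hh.
- destruct Hg as [H1 [H2 _]], Hh as [H3 [H4 _]]; split; [|split; [|exact I]].
  + intros; apply continuous_Rplus; auto.
  + apply wbound_plus; assumption.
- apply CW_intro with (d := fun b p => pd b g p + pd b h p); try assumption.
  + intros; apply continuous_Rplus; [apply Hg|apply Hh]; assumption.
  + apply wbound_plus; [apply Hg|apply Hh].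
  + intros b p Hp; apply is_pd_plus;
      [exact (CW_is_pd _ _ Hg Hp)|exact (CW_is_pd _ _ Hh Hp)].
  + apply IH; [apply Hg|apply Hh].
  + apply IH; [apply Hg|apply Hh].
Qed.

(** By Leibniz, a pure [y]-derivative of the product is a sum of terms with one bounded and one
    weighted factor, so a single weighted factor suffices. *)
Lemma CW_mult k U w g h : open U ->
  CW k U (wflat w) g -> CW k U w h -> CW k U w (fun p => g p * h p).
Proof.
intros HU; revert w g h; induction k as [|k IH]; intros w g h Hg Hh.
- destruct Hg as [H1 [H2 _]], Hh as [H3 [H4 _]]; split; [|split; [|exact I]].
  + intros; apply continuous_Rmult; auto.
  + apply wbound_mult; assumption.
- apply CW_intro with (d := fun b p => pd b g p * h p + g p * pd b h p); try assumption.
  + intros; apply continuous_Rmult; [apply Hg|apply Hh]; assumption.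
  + apply wbound_mult; [apply Hg|apply Hh].
  + intros b p Hp; apply is_pd_mult;
      [exact (CW_is_pd _ _ Hg Hp)|exact (CW_is_pd _ _ Hh Hp)].
  + apply CW_plus; [exact HU| |].
    * apply IH; [rewrite wflat_flat; exact (CW_flat_pd false Hg) |apply CW_flat, CW_S, Hh].
    * apply IH; [rewrite wflat_flat; apply CW_S, Hg|exact (CW_pd false Hh)].
  + apply CW_plus; [exact HU| |].
    * apply IH; [exact (CW_flat_pd true Hg)|apply CW_S, Hh].
    * apply IH; [apply CW_S, Hg|exact (CW_pd true Hh)].
Qed.

Lemma CW_scal k U w c g : open U -> CW k U w g -> CW k U w (fun p => c * g p).
Proof. intros HU Hg; apply CW_mult; [exact HU|apply CW_const|exact Hg]. Qed.

Lemma CW_opp k U w g : open U -> CW k U w g -> CW k U w (fun p => - g p).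
Proof.
intros HU Hg; apply CW_ext with (g := fun p => (-1) * g p); [exact HU|intros; ring|].
apply CW_scal; assumption.
Qed.

Lemma CW_minus k U w g h : open U ->
  CW k U w g -> CW k U w h -> CW k U w (fun p => g p - h p).
Proof. intros HU Hg Hh; apply CW_plus; [exact HU|exact Hg|apply CW_opp; assumption]. Qed.

Lemma CW_coord k U b : CW k U None (coord b).
Proof.
assert (Hc : forall p, U p -> continuous (coord b) p)
  by (intros p _; destruct b; [apply continuous_snd|apply continuous_fst]).
destruct k as [|k]; [repeat split; assumption|].
apply CW_sub with (U := fun _ => True); [tauto|].
apply CW_intro with (d := fun b' _ => delta b' b).
- apply open_true.
- intros p _; destruct b; [apply continuous_snd|apply continuous_fst].
- exact I.
- intros b' p _; apply coord_is_pd.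
- exact (CW_const k _ None _).
- exact (CW_const k _ None _).
Qed.

Lemma CW_fst k U : CW k U None fst.
Proof. exact (CW_coord k U false). Qed.
Lemma CW_snd k U : CW k U None snd.
Proof. exact (CW_coord k U true). Qed.

Lemma CW_dif k U w g p : open U -> CW (S k) U w g -> U p ->
  dif g p (pd false g p) (pd true g p).
Proof.
intros HU Hg Hp; apply (dif_of_C1 U g (pd false g) (pd true g)); try assumption.
- intros q Hq; exact (CW_is_pd _ _ Hg Hq).
- exact (CW_is_pd _ _ Hg Hp).
- exact (CW_cont _ (CW_pd false Hg) Hp).
Qed.

(** [wflat w] is [None] or [Some false], so one induction on the chain rule serves for plain
    smoothness and for bounded derivatives. The weight [true] is left out because composition need
    not preserve vanishing on the axis. *)
Lemma CW_comp k U V w g F1 F2 : open U -> open V ->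
  (forall p, U p -> V (F1 p, F2 p)) ->
  CW k V (wflat w) g -> CW k U (wflat w) F1 -> CW k U (wflat w) F2 ->
  CW k U (wflat w) (fun p => g (F1 p, F2 p)).
Proof.
intros HU HV HF; revert w g; induction k as [|k IH]; intros w g Hg H1 H2.
all: assert (Hb : wbound (wflat w) U (fun p => g (F1 p, F2 p)))
  by (pose proof (CW_wbound Hg) as Hb; destruct w; simpl in *; [|exact I];
      destruct Hb as [C HC]; exists C; intros p Hp; apply (HC _ (HF p Hp))).
all: assert (Hc : forall p, U p -> continuous (fun p => g (F1 p, F2 p)) p)
  by (intros p Hp; apply continuous_comp_pair;
      [exact (CW_cont _ Hg (HF p Hp))|exact (CW_cont _ H1 Hp)
      |exact (CW_cont _ H2 Hp)]).
- split; [exact Hc|]; split; [exact Hb|exact I].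
- assert (Hd : forall b, CW k U (wflat w) (fun p => pd false g (F1 p, F2 p) * pd b F1 p
                                 + pd true g (F1 p, F2 p) * pd b F2 p)).
  { intros b; pose proof (CW_flat_pd b H1) as K1.
    pose proof (CW_flat_pd b H2) as K2.
    pose proof (CW_flat_pd false Hg) as K3; pose proof (CW_flat_pd true Hg) as K4.
    apply CW_plus; [exact HU| |]; (apply CW_mult; [exact HU| |assumption]);
      rewrite wflat_flat; apply (IH w); try assumption; apply CW_S; assumption. }
  apply CW_intro with (d := fun b p => pd false g (F1 p, F2 p) * pd b F1 p
                                 + pd true g (F1 p, F2 p) * pd b F2 p); try assumption.
  + intros b p Hp; apply is_pd_comp.
    * exact (CW_dif _ _ _ _ _ HV Hg (HF p Hp)).
    * exact (CW_is_pd _ _ H1 Hp).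
    * exact (CW_is_pd _ _ H2 Hp).
  + rewrite wflat_flat; apply Hd.
  + apply Hd.
Qed.

Lemma CW_comp_None k U V g F1 F2 : open U -> open V ->
  (forall p, U p -> V (F1 p, F2 p)) ->
  CW k V None g -> CW k U None F1 -> CW k U None F2 ->
  CW k U None (fun p => g (F1 p, F2 p)).
Proof. exact (CW_comp k U V None g F1 F2). Qed.

(** * Contractions and uniform limits *)

(** Convergence in the sup norm with weight [om]; where [om] vanishes, it forces equality with the
    limit. *)
Definition unif (X : Type) (D : X -> Prop) (om : X -> R) (un : nat -> X -> R) (u : X -> R) : Prop :=
  forall eps, 0 < eps -> exists N, forall n x, (N <= n)%nat -> D x ->
    Rabs (un n x - u x) <= eps * om x.

Lemma pow_small rho eps : 0 <= rho < 1 -> 0 < eps -> exists N, forall n, (N <= n)%nat -> rho ^ n <= eps.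
Proof.
intros Hr He.
destruct (pow_lt_1_zero rho) with (y := eps) as [N HN].
- rewrite Rabs_pos_eq; lra.
- exact He.
- exists N; intros n Hn; specialize (HN n Hn).
  eapply Rle_trans; [apply Rle_abs|lra].
Qed.

(** Banach's theorem for the distance given by the smallest [K] with [|u - v| <= K om] on [D]. Only
    the first displacement [T u0 - u0] has to be at finite distance, so the functions themselves may
    be unbounded. [P] is a closed invariant set of functions. *)
Lemma fixed_point (X : Type) (D : X -> Prop) (om : X -> R) (P : (X -> R) -> Prop)
  (T : (X -> R) -> X -> R) (rho C : R) (u0 : X -> R) :
  0 <= rho < 1 -> 0 <= C -> (forall x, D x -> 0 <= om x) ->
  P u0 -> (forall u, P u -> P (T u)) ->
  (forall u v K, 0 <= K -> P u -> P v ->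
    (forall x, D x -> Rabs (u x - v x) <= K * om x) ->
    forall x, D x -> Rabs (T u x - T v x) <= rho * K * om x) ->
  (forall x, D x -> Rabs (T u0 x - u0 x) <= C * om x) ->
  (forall un u, (forall n, P (un n)) -> unif X D om un u -> P u) ->
  exists u, P u /\ (forall x, D x -> T u x = u x) /\
    (forall x, D x -> Rabs (u x - u0 x) <= C / (1 - rho) * om x).
Proof.
intros Hrho HC Hom HP0 HPT HT H0 Hcl.
set (un := fun n => Nat.iter n T u0).
assert (HPn : forall n, P (un n)) by (induction n; [exact HP0|apply HPT, IHn]).
assert (Hn : forall n x, D x -> Rabs (un (S n) x - un n x) <= C * rho ^ n * om x).
{ induction n as [|n IH]; intros x Hx.
  - rewrite pow_O, Rmult_1_r; exact (H0 x Hx).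
  - replace (C * rho ^ S n) with (rho * (C * rho ^ n)) by (simpl; ring).
    refine (HT (un (S n)) (un n) _ _ (HPn _) (HPn _) IH x Hx).
    apply Rmult_le_pos; [exact HC|apply pow_le; lra]. }
(* The partial sum of the geometric series is kept exactly, so that the induction on [k] closes with
   an equality. *)
assert (Hd : forall k n x, D x ->
  Rabs (un (n + k)%nat x - un n x) <= C / (1 - rho) * (rho ^ n - rho ^ (n + k)) * om x).
{ induction k as [|k IH]; intros n x Hx.
  - rewrite Nat.add_0_r, !Rminus_diag, Rabs_R0; specialize (Hom x Hx); lra.
  - rewrite Nat.add_succ_r.
    replace (un (S (n + k)) x - un n x)
      with ((un (S (n + k)) x - un (n + k)%nat x) + (un (n + k)%nat x - un n x)) by ring.
    eapply Rle_trans; [apply Rabs_triang|].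
    eapply Rle_trans; [apply Rplus_le_compat; [apply Hn, Hx|apply IH, Hx]|].
    apply Req_le; simpl; field; lra. }
assert (Hd' : forall n m x, (n <= m)%nat -> D x ->
  Rabs (un m x - un n x) <= C / (1 - rho) * rho ^ n * om x).
{ intros n m x Hnm Hx; replace m with (n + (m - n))%nat by lia.
  eapply Rle_trans; [apply Hd, Hx|].
  apply Rmult_le_compat_r; [apply Hom, Hx|].
  apply Rmult_le_compat_l.
  - apply Rdiv_le_0_compat; lra.
  - pose proof (pow_le rho (n + (m - n)) (proj1 Hrho)); lra. }
assert (Hex : forall x, D x -> ex_finite_lim_seq (fun n => un n x)).
{ intros x Hx; apply ex_lim_seq_cauchy_corr; intros eps.
  set (A := C / (1 - rho) * om x).
  assert (HA : 0 <= A) by (apply Rmult_le_pos; [apply Rdiv_le_0_compat; lra|apply Hom, Hx]).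
  destruct (pow_small rho (eps / (3 * (A + 1)))) as [N HN]; [exact Hrho|
    apply Rdiv_lt_0_compat; [apply cond_pos|lra]|].
  exists N; intros n m Hn1 Hm1.
  replace (un n x - un m x) with ((un n x - un N x) - (un m x - un N x)) by ring.
  pose proof (Hd' N n x Hn1 Hx) as H1; pose proof (Hd' N m x Hm1 Hx) as H2.
  pose proof (Rabs_triang (un n x - un N x) (- (un m x - un N x))) as H3.
  rewrite Rabs_Ropp in H3.
  replace (C / (1 - rho) * rho ^ N * om x) with (A * rho ^ N) in * by (unfold A; ring).
  assert (H4 : A * rho ^ N <= eps / 3).
  { apply Rle_trans with (A * (eps / (3 * (A + 1)))).
    - apply Rmult_le_compat_l; [exact HA|apply HN; lia].
    - apply Rle_trans with ((A + 1) * (eps / (3 * (A + 1)))).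
      + apply Rmult_le_compat_r; [|lra].
        apply Rdiv_le_0_compat; [apply Rlt_le, cond_pos|lra].
      + apply Req_le; field; lra. }
  pose proof (cond_pos eps).
  eapply Rle_lt_trans; [exact H3|]; lra. }
(* Outside [D] this is whatever [Lim_seq] returns; nothing is claimed there. *)
set (u := fun x => real (Lim_seq (fun n => un n x))).
assert (Hlim : forall x, D x -> is_lim_seq (fun n => un n x) (u x))
  by (intros x Hx; apply Lim_seq_correct', Hex, Hx).
assert (Hu : forall n x, D x -> Rabs (u x - un n x) <= C / (1 - rho) * rho ^ n * om x).
{ intros n x Hx.
  assert (Hl : is_lim_seq (fun m => Rabs (un m x - un n x)) (Rabs (u x - un n x))).
  { apply (is_lim_seq_abs _ (u x - un n x)).
    apply is_lim_seq_minus'; [apply Hlim, Hx|apply is_lim_seq_const]. }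
  apply (is_lim_seq_le_loc _ _ (Finite _) (Finite (C / (1 - rho) * rho ^ n * om x))
    (ex_intro _ n (fun m Hm => Hd' n m x Hm Hx)) Hl).
  apply is_lim_seq_const. }
assert (Hunif : unif X D om un u).
{ intros eps He.
  set (A := C / (1 - rho)).
  assert (HA : 0 <= A) by (apply Rdiv_le_0_compat; lra).
  destruct (pow_small rho (eps / (A + 1))) as [N HN]; [exact Hrho|
    apply Rdiv_lt_0_compat; lra|].
  exists N; intros n x Hn1 Hx.
  rewrite Rabs_minus_sym; eapply Rle_trans; [apply Hu, Hx|].
  apply Rmult_le_compat_r; [apply Hom, Hx|].
  fold A; apply Rle_trans with ((A + 1) * (eps / (A + 1))).
  - apply Rmult_le_compat; [exact HA|apply pow_le; lra|lra|apply HN, Hn1].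
  - apply Req_le; field; lra. }
assert (HPu : P u) by exact (Hcl un u HPn Hunif).
exists u; split; [exact HPu|]; split.
- intros x Hx.
  (* The contraction property itself supplies the continuity of [T]. The [+ 1] in the denominator
     allows [om x = 0], which happens on the axis. *)
  assert (Hl : is_lim_seq (fun n => un (S n) x) (T u x)).
  { apply is_lim_seq_spec; intros eps.
    destruct (Hunif (eps / (2 * (om x + 1)))) as [N HN].
    { apply Rdiv_lt_0_compat; [apply cond_pos|specialize (Hom x Hx); lra]. }
    exists N; intros n Hn1.
    assert (Hk : Rabs (T (un n) x - T u x) <= rho * (eps / (2 * (om x + 1))) * om x).
    { apply HT; try assumption; [|apply HPn|intros y Hy; apply HN; assumption].
      apply Rdiv_le_0_compat; [apply Rlt_le, cond_pos|specialize (Hom x Hx); lra]. }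
    eapply Rle_lt_trans; [exact Hk|].
    pose proof (cond_pos eps); specialize (Hom x Hx).
    apply Rle_lt_trans with (1 * (eps / (2 * (om x + 1))) * (om x + 1)).
    - apply Rmult_le_compat; try lra.
      + apply Rmult_le_pos; [lra|apply Rdiv_le_0_compat; lra].
      + apply Rmult_le_compat_r; [apply Rdiv_le_0_compat|]; lra.
    - replace (1 * (eps / (2 * (om x + 1))) * (om x + 1)) with (eps / 2) by (field; lra).
      lra. }
  pose proof (is_lim_seq_unique _ _ Hl) as E1.
  pose proof (is_lim_seq_unique _ _ (proj1 (is_lim_seq_incr_1 _ _) (Hlim x Hx))) as E2.
  cbv beta in E2; rewrite E1 in E2; injection E2; tauto.
- intros x Hx; pose proof (Hu 0%nat x Hx) as H; rewrite pow_O, Rmult_1_r in H; exact H.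
Qed.

Lemma continuous_unif (U : R * R -> Prop) (gn : nat -> R * R -> R) g :
  open U -> unif _ U (fun _ => 1) gn g -> (forall n p, U p -> continuous (gn n) p) ->
  forall p, U p -> continuous g p.
Proof.
intros HU Hu Hc p Hp P [d Hd].
assert (Hd3 : 0 < d / 3) by (pose proof (cond_pos d); lra).
destruct (Hu (d / 3) Hd3) as [N HN].
assert (Hl := filter_and _ _ (HU p Hp) (Hc N p Hp _ (locally_ball _ (mkposreal _ Hd3)))).
unfold filtermap; revert Hl; apply filter_imp; intros q [Hq1 Hq2]; apply Hd.
assert (K1 := HN N p (le_n _) Hp); assert (K2 := HN N q (le_n _) Hq1).
change (Rabs (gn N q - gn N p) < d / 3) in Hq2.
change (Rabs (g q - g p) < d).
replace (g q - g p) with (- (gn N q - g q) + ((gn N q - gn N p) + (gn N p - g p))) by ring.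
eapply Rle_lt_trans; [apply Rabs_triang|]; rewrite Rabs_Ropp.
pose proof (Rabs_triang (gn N q - gn N p) (gn N p - g p)); lra.
Qed.

Lemma is_pd_unif (U : R * R -> Prop) b (gn dn : nat -> R * R -> R) g d :
  open U -> unif _ U (fun _ => 1) gn g -> unif _ U (fun _ => 1) dn d ->
  (forall n p, U p -> is_pd b (gn n) p (dn n p)) ->
  (forall n p, U p -> continuous (dn n) p) ->
  forall p, U p -> is_pd b g p (d p).
Proof.
intros HU Hg Hd Hpd Hc p Hp.
assert (Hcd := continuous_unif U dn d HU Hd Hc).
destruct (locally_slice b p U (HU p Hp)) as [r Hr].
assert (HB : forall y, Boule (coord b p) r y -> U (slice b p y)) by (intros y Hy; apply Hr, Hy).
apply is_derive_Reals.
replace (d p) with (d (slice b p (coord b p))) by (rewrite slice_coord; reflexivity).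
apply (derivable_pt_lim_CVU (fun n t => gn n (slice b p t)) (fun n t => dn n (slice b p t))
  (fun t => g (slice b p t)) (fun t => d (slice b p t)) (coord b p) (coord b p) r).
- unfold Boule; rewrite Rminus_diag, Rabs_R0; apply cond_pos.
- intros y n Hy; apply is_derive_Reals.
  assert (K := Hpd n _ (HB y Hy)); unfold is_pd in K; rewrite coord_slice in K.
  apply is_derive_ext with (2 := K); intros t; rewrite slice_slice; reflexivity.
- intros y Hy eps He; destruct (Hg (eps / 2)) as [N HN]; [lra|].
  exists N; intros n Hn; unfold Rdist.
  specialize (HN n _ Hn (HB y Hy)); lra.
- intros eps He; destruct (Hd (eps / 2)) as [N HN]; [lra|].
  exists N; intros n y Hn Hy; rewrite Rabs_minus_sym.
  specialize (HN n _ Hn (HB y Hy)); lra.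
- intros y Hy; apply continuity_pt_filterlim.
  apply (continuous_comp (slice b p) d y); [apply continuous_slice|apply Hcd, HB, Hy].
Qed.

(** * Smooth solutions of linear functional equations *)

(** The second coordinate is unrestricted because forward orbits expand it; the first is contracted,
    so the strip is forward invariant. *)
Definition strip (p : R * R) : Prop := Rabs (fst p) < 1.

Lemma open_strip : open strip.
Proof.
intros [x y] Hp; unfold strip in *; simpl in Hp.
assert (Hd : 0 < 1 - Rabs x) by lra.
exists (mkposreal _ Hd); intros [u v] Hq.
destruct (ball_pair_inv Hq) as [H _]; simpl in *.
pose proof (Rabs_triang_inv u x); lra.
Qed.

Lemma wt_strip p : strip p -> wt true p = Rabs (fst p).
Proof. intros Hp; apply Rmin_right, Rlt_le, Hp. Qed.

Lemma CW_weaken k U (b b' : bool) g :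
  implb b' b = true -> CW k U (Some b) g -> CW k U (Some b') g.
Proof.
intros Hb Hg; destruct b, b'; try discriminate; try assumption.
exact (CW_flat Hg).
Qed.

Section FunctionalEquation.

Variables (f1 f2 : R * R -> R) (q : bool -> bool -> R * R -> R) (m : bool -> R * R -> R).
Variables (n : nat) (lam s eps theta : R).

Let f (p : R * R) : R * R := (f1 p, f2 p).

Hypothesis lam_pos : 0 <= lam <= 1.
Hypothesis s_ge1 : 1 <= s.
Hypothesis eps_pos : 0 <= eps.
Hypothesis theta_pos : 0 <= theta.
(* [n] derivatives in the second variable cost [s ^ n]; the weight [|x|], which every
   such derivative carries, gains the factor [lam]. *)
Hypothesis rate : theta * ((lam + INR n * eps) * s ^ n) < 1.
Hypothesis q_smooth : forall j i, CW n strip (Some false) (q j i).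
Hypothesis q_bound : forall j p, strip p -> Rabs (q j false p) + Rabs (q j true p) <= theta.
Hypothesis m_smooth : forall j, CW n strip (Some true) (m j).
Hypothesis f1_pd : forall b p, strip p -> ex_pd b f1 p.
Hypothesis f2_pd : forall b p, strip p -> ex_pd b f2 p.
Hypothesis f1_cont : forall p, strip p -> continuous f1 p.
Hypothesis f2_cont : forall p, strip p -> continuous f2 p.
Hypothesis f1_smooth : forall b, CW n strip (Some b) (pd b f1).
Hypothesis f2_smooth : forall b, CW n strip (Some false) (pd b f2).
Hypothesis f1_small : forall p, strip p -> Rabs (f1 p) <= lam * Rabs (fst p).
Hypothesis pd_x : forall p, strip p -> Rabs (pd false f1 p) + Rabs (pd false f2 p) <= lam.
Hypothesis pd_y : forall p, strip p -> Rabs (pd true f1 p) + Rabs (pd true f2 p) <= s.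
Hypothesis pd_y1 : forall p, strip p -> Rabs (pd true f1 p) <= eps * Rabs (fst p).

(* A term [c * W_(j,w) o f], where [W_(j,w)] stands for the iterated partial
   derivative of the [j]-th unknown along the word [w]. *)
Record term := Term { coef : R * R -> R; comp : bool; word : list bool }.

Definition eval (l : list term) (W : bool -> list bool -> R * R -> R) (p : R * R) : R :=
  fold_right (fun t acc => coef t p * W (comp t) (word t) (f p) + acc) 0 l.

(** The chain rule for the factors [W o f]; [dcoef] is the other half of the product rule, where the
    derivative falls on the coefficient. *)
Definition lift (b : bool) (l : list term) : list term :=
  flat_map (fun t =>
    Term (fun p => coef t p * pd b f1 p) (comp t) (false :: word t) ::
    Term (fun p => coef t p * pd b f2 p) (comp t) (true :: word t) :: nil) l.

Definition dcoef (b : bool) (l : list term) : list term :=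
  map (fun t => Term (pd b (coef t)) (comp t) (word t)) l.

(* Differentiating the right-hand side of the equation along a word [a] yields terms
   with derivatives of the same order, [top], and of lower order, [low]. *)
Fixpoint top (j : bool) (a : list bool) : list term :=
  match a with
  | nil => Term (q j false) false nil :: Term (q j true) true nil :: nil
  | b :: a' => lift b (top j a')
  end.

Fixpoint low (j : bool) (a : list bool) : list term :=
  match a with
  | nil => nil
  | b :: a' => dcoef b (top j a') ++ dcoef b (low j a') ++ lift b (low j a')
  end.

Fixpoint pdw (a : list bool) (g : R * R -> R) : R * R -> R :=
  match a with nil => g | b :: a' => pd b (pdw a' g) end.

(** No letter is an [x]-derivative. Exactly the derivatives along such words carry the weight
    [|x|]. *)
Definition nox (a : list bool) : bool := forallb (fun b => b) a.

(** The equation differentiated along [a], read as a formula in independent unknowns [W]; it is the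
    derivative of the equation only when the [W] are derivatives of one another. *)
Definition step (W : bool -> list bool -> R * R -> R) j a p : R :=
  eval (top j a) W p + eval (low j a) W p + pdw a (m j) p.

Lemma eval_app l l' W p : eval (l ++ l') W p = eval l W p + eval l' W p.
Proof. induction l as [|t l IH]; simpl; [ring|rewrite IH; ring]. Qed.

Lemma f_strip p : strip p -> strip (f p).
Proof.
intros Hp; unfold strip, f; simpl; specialize (f1_small p Hp); unfold strip in Hp.
pose proof (Rabs_pos (fst p)).
assert (lam * Rabs (fst p) <= 1 * Rabs (fst p)) by (apply Rmult_le_compat_r; lra); lra.
Qed.

Lemma pdw_smooth g k a : CW (k + length a) strip (Some true) g ->
  CW k strip (Some (nox a)) (pdw a g).
Proof.
revert k; induction a as [|b a IH]; intros k Hg; simpl in *.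
- rewrite Nat.add_0_r in Hg; exact Hg.
- rewrite Nat.add_succ_r in Hg; pose proof (CW_pd b (IH (S k) Hg)) as H.
  destruct b; exact H.
Qed.

(** If [a] is a pure [y]-word, the result must be [O(x)]. When the word of the term contains an
    [x]-derivative, its factor [W] is merely bounded, so the coefficient has to supply the
    weight. *)
Definition admissible (k : nat) (a : list bool) (t : term) : Prop :=
  CW k strip (Some (andb (nox a) (negb (nox (word t))))) (coef t).

(** The delicate case is a [y]-derivative that turns a pure [y]-word into one with an [x]-letter:
    its new factor is [pd true f1], which is [O(x)] because [f] preserves the axis. *)
Lemma admissible_lift b k a l :
  (k <= n)%nat -> (forall t, In t l -> admissible (S k) a t) ->
  forall t, In t (lift b l) -> admissible k (b :: a) t.
Proof.
intros Hk Hl t Ht; apply in_flat_map in Ht; destruct Ht as [t0 [Ht0 Ht]].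
specialize (Hl t0 Ht0); unfold admissible in Hl; apply CW_S in Hl.
pose proof (CW_flat Hl : CW k strip (Some false) _) as Hl'.
destruct Ht as [<-|[<-|[]]]; unfold admissible; simpl.
- destruct b; simpl.
  + rewrite Bool.andb_true_r; apply (CW_weaken _ _ true); [destruct (nox a); reflexivity|].
    apply CW_mult; [apply open_strip|exact Hl'|].
    apply CW_le with n; [exact Hk|apply (f1_smooth true)].
  + apply CW_mult; [apply open_strip|exact Hl'|].
    apply CW_le with n; [exact Hk|apply (f1_smooth false)].
- destruct b; simpl.
  + apply CW_ext with (g := fun p => pd true f2 p * coef t0 p);
      [apply open_strip|intros p _; apply Rmult_comm|].
    apply CW_mult; [apply open_strip| |exact Hl].
    apply CW_le with n; [exact Hk|apply (f2_smooth true)].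
  + apply CW_mult; [apply open_strip|exact Hl'|].
    apply CW_le with n; [exact Hk|apply (f2_smooth false)].
Qed.

Lemma admissible_dcoef b k a l :
  (forall t, In t l -> admissible (S k) a t) ->
  forall t, In t (dcoef b l) -> admissible k (b :: a) t.
Proof.
intros Hl t Ht; apply in_map_iff in Ht; destruct Ht as [t0 [<- Ht0]].
specialize (Hl t0 Ht0); unfold admissible in *; simpl.
pose proof (CW_pd b Hl) as H; destruct b; exact H.
Qed.

Lemma word_lift b d l : (forall t, In t l -> length (word t) = d) ->
  forall t, In t (lift b l) -> length (word t) = S d.
Proof.
intros Hl t Ht; apply in_flat_map in Ht; destruct Ht as [t0 [Ht0 Ht]].
rewrite <- (Hl t0 Ht0); destruct Ht as [<-|[<-|[]]]; reflexivity.
Qed.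

Lemma word_top j a t : In t (top j a) -> length (word t) = length a.
Proof.
revert t; induction a as [|b a IH]; intros t Ht.
- destruct Ht as [<-|[<-|[]]]; reflexivity.
- exact (word_lift b (length a) _ IH t Ht).
Qed.

Lemma word_low j a t : In t (low j a) -> (length (word t) < length a)%nat.
Proof.
revert t; induction a as [|b a IH]; intros t Ht; [destruct Ht|].
simpl in Ht; apply in_app_or in Ht; destruct Ht as [Ht|Ht];
  [|apply in_app_or in Ht; destruct Ht as [Ht|Ht]].
- apply in_map_iff in Ht; destruct Ht as [t0 [<- Ht0]]; simpl.
  rewrite (word_top j a t0 Ht0); lia.
- apply in_map_iff in Ht; destruct Ht as [t0 [<- Ht0]]; simpl.
  specialize (IH t0 Ht0); lia.
- apply in_flat_map in Ht; destruct Ht as [t0 [Ht0 Ht]]; specialize (IH t0 Ht0).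
  destruct Ht as [<-|[<-|[]]]; simpl; lia.
Qed.

Lemma admissible_top j a k : (k + length a = n)%nat ->
  forall t, In t (top j a) -> admissible k a t.
Proof.
revert k; induction a as [|b a IH]; intros k Hk.
- intros t [<-|[<-|[]]]; unfold admissible; simpl;
    (apply CW_le with n; [simpl in Hk; lia|apply q_smooth]).
- apply admissible_lift; [simpl in Hk; lia|apply IH; simpl in Hk; lia].
Qed.

Lemma admissible_low j a k : (k + length a = n)%nat ->
  forall t, In t (low j a) -> admissible k a t.
Proof.
revert k; induction a as [|b a IH]; intros k Hk; [intros t []|].
assert (Hk' : (S k + length a = n)%nat) by (simpl in Hk; lia).
intros t Ht; simpl in Ht; apply in_app_or in Ht; destruct Ht as [Ht|Ht];
  [|apply in_app_or in Ht; destruct Ht as [Ht|Ht]].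
- exact (admissible_dcoef b k a _ (admissible_top j a _ Hk') t Ht).
- exact (admissible_dcoef b k a _ (IH _ Hk') t Ht).
- refine (admissible_lift b k a _ _ (IH _ Hk') t Ht); lia.
Qed.

Lemma eval_continuous l W p : strip p ->
  (forall t, In t l -> continuous (coef t) p /\ continuous (W (comp t) (word t)) (f p)) ->
  continuous (eval l W) p.
Proof.
intros Hp Hl; induction l as [|t l IH].
- apply continuous_const.
- apply (continuous_Rplus (fun p => coef t p * W (comp t) (word t) (f p)) (eval l W)).
  + apply continuous_Rmult; [apply Hl; left; reflexivity|].
    apply (continuous_comp_pair (W (comp t) (word t)) f1 f2); auto.
    apply Hl; left; reflexivity.
  + apply IH; intros t' Ht'; apply Hl; right; exact Ht'.
Qed.

Lemma eval_is_pd l W b p : strip p ->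
  (forall t, In t l -> ex_pd b (coef t) p /\
    dif (W (comp t) (word t)) (f p)
      (W (comp t) (false :: word t) (f p)) (W (comp t) (true :: word t) (f p))) ->
  is_pd b (eval l W) p (eval (dcoef b l) W p + eval (lift b l) W p).
Proof.
intros Hp Hl; induction l as [|t l IH].
- simpl; rewrite Rplus_0_r; apply is_pd_const.
- assert (H1 : is_pd b (eval l W) p (eval (dcoef b l) W p + eval (lift b l) W p))
    by (apply IH; intros t' Ht'; apply Hl; right; exact Ht').
  destruct (Hl t (or_introl eq_refl)) as [H2 H3].
  pose proof (is_pd_comp b _ f1 f2 p _ _ _ _ H3 (ex_pd_correct (f1_pd b p Hp))
    (ex_pd_correct (f2_pd b p Hp))) as H4.
  pose proof (is_pd_plus (is_pd_mult (ex_pd_correct H2) H4) H1)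
    as H5.
  change (is_pd b (eval (t :: l) W) p (eval (dcoef b (t :: l)) W p
    + eval (lift b (t :: l)) W p)).
  refine (eq_ind _ (fun l => is_pd b (eval (t :: _) W) p l) H5 _ _).
  change (dcoef b (t :: l)) with (Term (pd b (coef t)) (comp t) (word t) :: dcoef b l).
  change (lift b (t :: l)) with
    (Term (fun p => coef t p * pd b f1 p) (comp t) (false :: word t) ::
     Term (fun p => coef t p * pd b f2 p) (comp t) (true :: word t) :: lift b l).
  simpl; unfold f; ring.
Qed.

(* The operator norm attached to a list of terms, with the size of the derivative
   along the word [w] measured by [h w]. *)
Definition size (l : list term) (h : list bool -> R) (p : R * R) : R :=
  fold_right (fun t acc => Rabs (coef t p) * h (word t) + acc) 0 l.

Lemma size_lift b l h p :
  size (lift b l) h p = size l (fun w => Rabs (pd b f1 p) * h (false :: w)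
                                       + Rabs (pd b f2 p) * h (true :: w)) p.
Proof.
induction l as [|t l IH]; [reflexivity|].
change (lift b (t :: l)) with
    (Term (fun p => coef t p * pd b f1 p) (comp t) (false :: word t) ::
     Term (fun p => coef t p * pd b f2 p) (comp t) (true :: word t) :: lift b l).
simpl; rewrite IH, !Rabs_mult; ring.
Qed.

Lemma size_le l h h' p : (forall t, In t l -> h (word t) <= h' (word t)) ->
  size l h p <= size l h' p.
Proof.
intros H; induction l as [|t l IH]; simpl; [lra|].
apply Rplus_le_compat.
- apply Rmult_le_compat_l; [apply Rabs_pos|apply H; left; reflexivity].
- apply IH; intros; apply H; right; assumption.
Qed.

Lemma size_scal l c h p : size l (fun w => c * h w) p = c * size l h p.
Proof. induction l as [|t l IH]; simpl; [ring|rewrite IH; ring]. Qed.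

Lemma size_plus l h h' p : size l (fun w => h w + h' w) p = size l h p + size l h' p.
Proof. induction l as [|t l IH]; simpl; [ring|rewrite IH; ring]. Qed.

Lemma size_pos l h p : (forall w, 0 <= h w) -> 0 <= size l h p.
Proof.
intros H; induction l as [|t l IH]; simpl; [lra|].
apply Rplus_le_le_0_compat; [apply Rmult_le_pos; [apply Rabs_pos|apply H]|exact IH].
Qed.

Lemma eval_lipschitz l W W' h p :
  (forall t, In t l ->
    Rabs (W (comp t) (word t) (f p) - W' (comp t) (word t) (f p)) <= h (word t)) ->
  Rabs (eval l W p - eval l W' p) <= size l h p.
Proof.
intros H; induction l as [|t l IH]; simpl.
- rewrite Rminus_diag, Rabs_R0; lra.
- set (A := W (comp t) (word t) (f p)); set (A' := W' (comp t) (word t) (f p)).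
  replace (coef t p * A + eval l W p - (coef t p * A' + eval l W' p))
    with (coef t p * (A - A') + (eval l W p - eval l W' p)) by ring.
  eapply Rle_trans; [apply Rabs_triang|]; apply Rplus_le_compat.
  + rewrite Rabs_mult; apply Rmult_le_compat_l; [apply Rabs_pos|].
    apply H; left; reflexivity.
  + apply IH; intros; apply H; right; assumption.
Qed.

(** Each letter of [a] multiplies the size by a row sum of the Jacobian matrix, at most [s] for [y]
    and at most [lam] for [x]. A single [x]-letter thus yields the factor [lam] that other words
    must draw from their weight. *)
Lemma size_top_1 j a p : strip p ->
  size (top j a) (fun _ => 1) p <= theta * s ^ length a /\
  (nox a = false -> size (top j a) (fun _ => 1) p <= theta * (lam * s ^ length a)).
Proof.
intros Hp; induction a as [|b a [IH1 IH2]]; simpl.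
- split; [specialize (q_bound j p Hp); lra|discriminate].
- rewrite size_lift.
  rewrite (size_plus (top j a) (fun _ => Rabs (pd b f1 p) * 1) (fun _ => Rabs (pd b f2 p) * 1)).
  rewrite (size_scal _ _ (fun _ => 1)), (size_scal _ _ (fun _ => 1)).
  rewrite <- Rmult_plus_distr_r.
  set (A := size (top j a) (fun _ => 1) p) in *.
  assert (HA : 0 <= A) by (apply size_pos; intros; lra).
  assert (Hs : 1 <= s ^ length a) by (apply pow_R1_Rle, s_ge1).
  set (S := s ^ length a) in *.
  assert (Hrow : Rabs (pd b f1 p) + Rabs (pd b f2 p) <= if b then s else lam)
    by (destruct b; [apply pd_y|apply pd_x]; exact Hp).
  assert (H1 : (Rabs (pd b f1 p) + Rabs (pd b f2 p)) * A <= (if b then s else lam) * A)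
    by (apply Rmult_le_compat_r; assumption).
  assert (H2 : s * A <= theta * (s * S)) by nra.
  split; [|intros Hn].
  + destruct b; nra.
  + apply Rle_trans with (1 := H1); destruct b; simpl in Hn.
    * apply Rle_trans with (s * (theta * (lam * S))); [|apply Req_le; ring].
      apply Rmult_le_compat_l; [lra|exact (IH2 Hn)].
    * apply Rle_trans with (lam * (theta * (s * S))); [|apply Req_le; ring].
      apply Rmult_le_compat_l; nra.
Qed.

(** A further [y]-derivative either keeps a pure [y]-word, at the cost [s], or creates an
    [x]-letter; the latter loses the weight, but its coefficient [pd true f1] is at most [eps |x|].
    Each letter therefore adds one [eps] to [lam]. *)
Lemma size_top_nox j a p : strip p -> nox a = true ->
  size (top j a) (fun w => wt (nox w) (f p)) p
    <= theta * ((lam + INR (length a) * eps) * s ^ length a * Rabs (fst p)).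
Proof.
intros Hp; pose proof (Rabs_pos (fst p)) as Hx.
induction a as [|b a IH]; intros Hn.
- assert (Hw : wt true (f p) <= lam * Rabs (fst p))
    by (eapply Rle_trans; [apply Rmin_r|apply f1_small, Hp]).
  pose proof (wt_pos true (f p)).
  specialize (q_bound j p Hp); unfold size, top, nox, forallb, fold_right, word, coef, length.
  simpl INR; rewrite pow_O.
  replace (Rabs (q j false p) * wt true (f p) + (Rabs (q j true p) * wt true (f p) + 0))
    with ((Rabs (q j false p) + Rabs (q j true p)) * wt true (f p)) by ring.
  replace (theta * ((lam + 0 * eps) * 1 * Rabs (fst p))) with (theta * (lam * Rabs (fst p))) by ring.
  apply Rmult_le_compat; try assumption.
  pose proof (Rabs_pos (q j false p)); pose proof (Rabs_pos (q j true p)); lra.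
- destruct b; [|discriminate]; simpl in Hn; specialize (IH Hn).
  change (top j (true :: a)) with (lift true (top j a)); rewrite size_lift.
  change (length (true :: a)) with (S (length a)).
  rewrite (size_le _ _ (fun w => Rabs (pd true f1 p) * 1 + Rabs (pd true f2 p) * wt (nox w) (f p)))
    by (intros; simpl; lra).
  rewrite (size_plus _ (fun _ => Rabs (pd true f1 p) * 1)
    (fun w => Rabs (pd true f2 p) * wt (nox w) (f p))).
  rewrite (size_scal _ _ (fun _ => 1)), (size_scal _ _ (fun w => wt (nox w) (f p))).
  destruct (size_top_1 j a p Hp) as [H1 _].
  pose proof (pd_y p Hp) as H2; pose proof (pd_y1 p Hp) as H3.
  assert (HA : 0 <= size (top j a) (fun _ => 1) p) by (apply size_pos; intros; lra).
  assert (HB : 0 <= size (top j a) (fun w => wt (nox w) (f p)) p)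
    by (apply size_pos; intros; apply wt_pos).
  assert (Hs : 1 <= s ^ length a) by (apply pow_R1_Rle, s_ge1).
  rewrite S_INR; simpl (s ^ S (length a)).
  pose proof (pos_INR (length a)).
  set (A := size (top j a) (fun _ => 1) p) in *.
  set (B := size (top j a) (fun w => wt (nox w) (f p)) p) in *.
  set (S := s ^ length a) in *; set (N := INR (length a)) in *.
  pose proof (Rabs_pos (pd true f1 p)); pose proof (Rabs_pos (pd true f2 p)).
  assert (K1 : Rabs (pd true f1 p) * A <= eps * Rabs (fst p) * (theta * (s * S))).
  { apply Rmult_le_compat; try assumption.
    apply Rle_trans with (1 := H1); apply Rmult_le_compat_l; [assumption|].
    rewrite <- (Rmult_1_l S) at 1; apply Rmult_le_compat_r; lra. }
  assert (K2 : Rabs (pd true f2 p) * B <= s * (theta * ((lam + N * eps) * S * Rabs (fst p))))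
    by (apply Rmult_le_compat; try assumption; lra).
  eapply Rle_trans; [apply Rplus_le_compat; [exact K1|exact K2]|].
  apply Req_le; ring.
Qed.

Let Z := (lam + INR n * eps) * s ^ n.

Lemma size_top j a p : strip p -> (length a <= n)%nat ->
  size (top j a) (fun w => wt (nox w) (f p)) p <= theta * Z * wt (nox a) p.
Proof.
intros Hp Hn.
assert (Hs : s ^ length a <= s ^ n) by (apply Rle_pow; assumption).
assert (Hs1 : 1 <= s ^ length a) by (apply pow_R1_Rle, s_ge1).
assert (HN : INR (length a) <= INR n) by (apply le_INR, Hn).
pose proof (pos_INR (length a)).
assert (HZ : (lam + INR (length a) * eps) * s ^ length a <= Z).
{ apply Rmult_le_compat; try assumption; try lra.
  - apply Rplus_le_le_0_compat; [lra|apply Rmult_le_pos; lra].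
  - apply Rplus_le_compat_l, Rmult_le_compat_r; assumption. }
destruct (nox a) eqn:Ha.
- rewrite (wt_strip p Hp).
  eapply Rle_trans; [apply size_top_nox; assumption|].
  rewrite (Rmult_assoc theta Z); apply Rmult_le_compat_l; [assumption|].
  apply Rmult_le_compat_r; [apply Rabs_pos|exact HZ].
- simpl; rewrite Rmult_1_r.
  eapply Rle_trans; [apply (size_le _ _ (fun _ => 1)); intros; apply wt_le1|].
  eapply Rle_trans; [exact (proj2 (size_top_1 j a p Hp) Ha)|].
  apply Rmult_le_compat_l; [assumption|].
  apply Rle_trans with (2 := HZ), Rmult_le_compat_r; [lra|].
  assert (0 <= INR (length a) * eps) by (apply Rmult_le_pos; lra); lra.
Qed.

(** For the lower order terms a finite bound with the right weight is enough; their size is absorbed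
    later by the powers of [M]. *)
Lemma size_admissible k a l : (forall t, In t l -> admissible k a t) ->
  exists C, 0 <= C /\ forall p, strip p ->
    size l (fun w => wt (nox w) (f p)) p <= C * wt (nox a) p.
Proof.
induction l as [|t l IH]; intros Hl.
- exists 0; split; [lra|intros; simpl; lra].
- destruct IH as [C [HC IH]]; [intros; apply Hl; right; assumption|].
  destruct (CW_bound (Hl t (or_introl eq_refl))) as [D [HD Ht]].
  exists (D + C); split; [lra|]; intros p Hp; simpl.
  rewrite Rmult_plus_distr_r; apply Rplus_le_compat; [|apply IH, Hp].
  specialize (Ht p Hp); pose proof (wt_le1 (nox (word t)) (f p)).
  pose proof (wt_pos (nox (word t)) (f p)); pose proof (Rabs_pos (coef t p)).
  destruct (nox a); simpl in Ht |- *; [|simpl in *; nra].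
  destruct (nox (word t)); [|simpl in *; nra].
  assert (wt true (f p) <= wt true p).
  { rewrite (wt_strip p Hp), (wt_strip _ (f_strip p Hp)).
    eapply Rle_trans; [apply f1_small, Hp|]; pose proof (Rabs_pos (fst p)); nra. }
  simpl in Ht; rewrite Rmult_1_r in Ht.
  apply Rmult_le_compat; assumption.
Qed.

(** There are finitely many words of length at most [N]. The induction splits off the first letter,
    which is why [Q] varies in it. *)
Lemma uniform_constant (Q : R -> bool -> list bool -> Prop) (N : nat) :
  (forall C C' j a, C <= C' -> Q C j a -> Q C' j a) ->
  (forall j a, (length a <= N)%nat -> exists C, Q C j a) ->
  exists C, forall j a, (length a <= N)%nat -> Q C j a.
Proof.
intros Hmon; induction N as [|N IH] in Q, Hmon |- *; intros Hex.
- destruct (Hex false nil) as [C1 H1]; [simpl; lia|].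
  destruct (Hex true nil) as [C2 H2]; [simpl; lia|].
  exists (Rmax C1 C2); intros j [|b a] Ha; [|simpl in Ha; lia].
  destruct j; [apply (Hmon C2)|apply (Hmon C1)]; try assumption; [apply Rmax_r|apply Rmax_l].
- assert (Hb : forall b, exists C, forall j a, (length a <= N)%nat -> Q C j (b :: a)).
  { intros b; apply (IH (fun C j a => Q C j (b :: a))).
    - intros; eapply Hmon; eassumption.
    - intros j a Ha; apply Hex; simpl; lia. }
  destruct (Hb false) as [C1 H1], (Hb true) as [C2 H2].
  destruct (Hex false nil) as [C3 H3]; [simpl; lia|].
  destruct (Hex true nil) as [C4 H4]; [simpl; lia|].
  pose proof (Rmax_l C1 C2); pose proof (Rmax_r C1 C2).
  pose proof (Rmax_l C3 C4); pose proof (Rmax_r C3 C4).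
  pose proof (Rmax_l (Rmax C1 C2) (Rmax C3 C4)); pose proof (Rmax_r (Rmax C1 C2) (Rmax C3 C4)).
  exists (Rmax (Rmax C1 C2) (Rmax C3 C4)); intros j [|b a] Ha.
  + destruct j; [apply (Hmon C4)|apply (Hmon C3)]; try assumption; lra.
  + simpl in Ha; destruct b; [apply (Hmon C2)|apply (Hmon C1)]; try lra;
      [apply H2|apply H1]; lia.
Qed.

(** [rate] makes the terms of top order contract, uniformly over all words of length at most [n],
    once the pure [y]-derivatives are measured by [|x|]. Lower order terms form a triangular
    perturbation. A system of two unknowns is allowed for the sake of the tangent vector of the
    unstable curve. *)
Theorem functional_equation :
  exists w : bool -> R * R -> R,
    (forall j, CW n strip (Some true) (w j)) /\
    (forall j p, strip p ->
      w j p = q j false p * w false (f1 p, f2 p) + q j true p * w true (f1 p, f2 p) + m j p).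
Proof.
assert (HZ : 0 <= theta * Z).
{ apply Rmult_le_pos; [assumption|]; apply Rmult_le_pos; [|apply pow_le; lra].
  apply Rplus_le_le_0_compat; [lra|apply Rmult_le_pos; [apply pos_INR|assumption]]. }
destruct (uniform_constant (fun C j a => forall p, strip p ->
    size (low j a) (fun w => wt (nox w) (f p)) p <= C * wt (nox a) p) n) as [C0 HC0].
{ intros C C' j a HC H p Hp; eapply Rle_trans; [apply H, Hp|].
  apply Rmult_le_compat_r; [apply wt_pos|exact HC]. }
{ intros j a Ha; destruct (size_admissible (n - length a) a (low j a)) as [C [_ H]].
  - apply admissible_low; lia.
  - exists C; exact H. }
destruct (uniform_constant (fun C j a => forall p, strip p ->
    Rabs (pdw a (m j) p) <= C * wt (nox a) p) n) as [C1 HC1].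
{ intros C C' j a HC H p Hp; eapply Rle_trans; [apply H, Hp|].
  apply Rmult_le_compat_r; [apply wt_pos|exact HC]. }
{ intros j a Ha; assert (Hj : CW (n - length a) strip (Some (nox a)) (pdw a (m j))).
  { apply pdw_smooth; replace (n - length a + length a)%nat with n by lia; apply m_smooth. }
  destruct (CW_bound Hj) as [C [_ H]]; exists C; exact H. }
pose proof (Rle_abs C0) as HC0'; set (D := Rabs C0) in *.
assert (HD : 0 <= D) by apply Rabs_pos.
(* A large [M] makes the lower order terms negligible for the weights [om] below. *)
set (M := 1 + 2 * D / (1 - theta * Z)).
assert (HM : 1 <= M).
{ unfold M; assert (0 <= 2 * D / (1 - theta * Z)); [|lra].
  apply Rdiv_le_0_compat; unfold Z in *; lra. }
assert (HDM : D <= (1 - theta * Z) / 2 * M).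
{ unfold M.
  replace ((1 - theta * Z) / 2 * (1 + 2 * D / (1 - theta * Z))) with ((1 - theta * Z) / 2 + D)
    by (field; unfold Z in *; lra).
  unfold Z in *; lra. }
(* The top order contributes [theta * Z] and the lower orders at most half of the remaining gap. *)
set (rho := (1 + theta * Z) / 2).
assert (Hrho : 0 <= rho < 1) by (unfold rho, Z in *; lra).
set (X := ((bool * list bool) * (R * R))%type).
set (dom := fun x : X => (length (snd (fst x)) <= n)%nat /\ strip (snd x)).
set (om := fun x : X => M ^ length (snd (fst x)) * wt (nox (snd (fst x))) (snd x)).
set (cur := fun (u : X -> R) j a p => u ((j, a), p)).
set (T := fun (u : X -> R) (x : X) => step (cur u) (fst (fst x)) (snd (fst x)) (snd x)).
(* The family is a jet: its entries are continuous and are derivatives of one another. Only then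
   does [step] commute with differentiation, and uniform limits keep the property. *)
set (P := fun u : X -> R =>
  (forall j a p, (length a <= n)%nat -> strip p -> continuous (cur u j a) p) /\
  (forall j a b p, (length a < n)%nat -> strip p -> is_pd b (cur u j a) p (cur u j (b :: a) p))).
assert (Hdif : forall u j a p, P u -> (length a < n)%nat -> strip p ->
  dif (cur u j a) p (cur u j (false :: a) p) (cur u j (true :: a) p)).
{ intros u j a p [Hc Hp] Ha Hs.
  apply (dif_of_C1 strip (cur u j a) (cur u j (false :: a)) (cur u j (true :: a)));
    auto using open_strip. }
assert (Hcoef : forall j a t p, (length a <= n)%nat -> strip p -> In t (top j a ++ low j a) ->
  continuous (coef t) p /\ (length (word t) <= length a)%nat /\
  (forall b, (length a < n)%nat -> ex_pd b (coef t) p)).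
{ intros j a t p Ha Hp Ht.
  assert (Ht' : forall k, (k + length a = n)%nat -> admissible k a t).
  { intros k Hk; apply in_app_or in Ht; destruct Ht as [Ht|Ht];
      [exact (admissible_top j a k Hk t Ht)|exact (admissible_low j a k Hk t Ht)]. }
  split; [|split].
  - refine (CW_cont p (Ht' (n - length a)%nat _) Hp); lia.
  - apply in_app_or in Ht; destruct Ht as [Ht|Ht];
      [rewrite (word_top _ _ _ Ht); lia|pose proof (word_low _ _ _ Ht); lia].
  - intros b Hb; refine (CW_ex_pd b p (Ht' (S (n - length a - 1)) _) Hp); lia. }
destruct (fixed_point X dom om P T rho (Rabs C1) (fun _ => 0)) as [u [HPu [Hfix Hbd]]].
- exact Hrho.
- apply Rabs_pos.
- intros x _; apply Rmult_le_pos; [apply pow_le; lra|apply wt_pos].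
- split; intros; [apply continuous_const|apply is_pd_const].
- intros u Hu; split.
  + intros j a p Ha Hp; unfold cur, T, step; simpl.
    apply (continuous_Rplus (fun p => eval (top j a) (cur u) p + eval (low j a) (cur u) p)).
    * apply (continuous_Rplus (eval (top j a) (cur u)) (eval (low j a) (cur u)));
        apply eval_continuous; try exact Hp; intros t Ht;
        (destruct (Hcoef j a t p Ha Hp) as [K1 [K2 _]]; [apply in_or_app; tauto|]);
        (split; [exact K1|]); (apply (proj1 Hu); [lia|apply f_strip, Hp]).
    * refine (CW_cont p (pdw_smooth _ (n - length a) a _) Hp).
      replace (n - length a + length a)%nat with n by lia; apply m_smooth.
  + intros j a b p Ha Hp; unfold cur at 2, T, step; simpl.
    rewrite !eval_app.
    assert (H1 : forall l, (forall t, In t l -> In t (top j a ++ low j a)) ->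
      is_pd b (eval l (cur u)) p (eval (dcoef b l) (cur u) p + eval (lift b l) (cur u) p)).
    { intros l Hl; apply eval_is_pd; [exact Hp|]; intros t Ht.
      destruct (Hcoef j a t p) as [K1 [K2 K3]]; [lia|exact Hp|apply Hl, Ht|].
      split; [apply K3, Ha|]; apply Hdif; [exact Hu|lia|apply f_strip, Hp]. }
    assert (H2 : is_pd b (pdw a (m j)) p (pd b (pdw a (m j)) p)).
    { refine (CW_is_pd b p (pdw_smooth (m j) (S (n - length a - 1)) a _) Hp).
      replace (S (n - length a - 1) + length a)%nat with n by lia; apply m_smooth. }
    pose proof (is_pd_plus
      (is_pd_plus (H1 (top j a) (fun t Ht => in_or_app _ _ _ (or_introl Ht)))
         (H1 (low j a) (fun t Ht => in_or_app _ _ _ (or_intror Ht)))) H2) as H3.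
    refine (eq_ind _ (fun l => is_pd b _ p l) H3 _ _); ring.
- intros u v K HK Hu Hv Huv [[j a] p] [Ha Hp]; simpl in Ha, Hp.
  unfold T, step; simpl fst; simpl snd.
  set (h := fun w => K * (M ^ length w * wt (nox w) (f p))).
  assert (Hh : forall t, In t (top j a ++ low j a) ->
    Rabs (cur u (comp t) (word t) (f p) - cur v (comp t) (word t) (f p)) <= h (word t)).
  { intros t Ht; destruct (Hcoef j a t p Ha Hp Ht) as [_ [K2 _]].
    apply (Huv ((comp t, word t), f p)); split; simpl; [lia|apply f_strip, Hp]. }
  replace (eval (top j a) (cur u) p + eval (low j a) (cur u) p + pdw a (m j) p -
    (eval (top j a) (cur v) p + eval (low j a) (cur v) p + pdw a (m j) p))
    with ((eval (top j a) (cur u) p - eval (top j a) (cur v) p)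
      + (eval (low j a) (cur u) p - eval (low j a) (cur v) p)) by ring.
  eapply Rle_trans; [apply Rabs_triang|].
  assert (Ht : Rabs (eval (top j a) (cur u) p - eval (top j a) (cur v) p)
    <= K * M ^ length a * (theta * Z * wt (nox a) p)).
  { eapply Rle_trans; [apply (eval_lipschitz _ _ _ h); intros; apply Hh, in_or_app; tauto|].
    eapply Rle_trans; [apply (size_le _ _ (fun w => K * M ^ length a * wt (nox w) (f p)))|].
    - intros t Ht; unfold h; rewrite (word_top _ _ _ Ht); lra.
    - rewrite (size_scal _ _ (fun w => wt (nox w) (f p))).
      apply Rmult_le_compat_l; [|apply size_top; assumption].
      apply Rmult_le_pos; [exact HK|apply pow_le; lra]. }
  assert (Hl : Rabs (eval (low j a) (cur u) p - eval (low j a) (cur v) p)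
    <= K * M ^ length a * ((1 - theta * Z) / 2 * wt (nox a) p)).
  { eapply Rle_trans; [apply (eval_lipschitz _ _ _ h); intros; apply Hh, in_or_app; tauto|].
    (* The words in [low] are at least one letter shorter, so their weights are smaller by a factor
       [M], which outweighs the constant [D]. The empty word has no lower terms. *)
    destruct a as [|b a].
    { change (size (low j nil) h p) with 0; pose proof (wt_pos (nox nil) p).
      repeat apply Rmult_le_pos; try assumption; [apply pow_le|unfold Z in *|]; lra. }
    eapply Rle_trans; [apply (size_le _ _ (fun w => K * M ^ length a * wt (nox w) (f p)))|].
    - intros t Ht'; unfold h; pose proof (word_low _ _ _ Ht') as Hw; simpl in Hw.
      rewrite <- Rmult_assoc; apply Rmult_le_compat_r; [apply wt_pos|].
      apply Rmult_le_compat_l; [exact HK|apply Rle_pow; [exact HM|lia]].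
    - rewrite (size_scal _ _ (fun w => wt (nox w) (f p))).
      assert (HK' : 0 <= K * M ^ length a)
        by (apply Rmult_le_pos; [exact HK|apply pow_le; lra]).
      eapply Rle_trans; [apply Rmult_le_compat_l; [exact HK'|apply HC0; assumption]|].
      set (W := wt (nox (b :: a)) p); assert (HW : 0 <= W) by apply wt_pos.
      apply Rle_trans with (K * M ^ length a * ((1 - theta * Z) / 2 * M * W)).
      + apply Rmult_le_compat_l; [exact HK'|]; apply Rmult_le_compat_r; [exact HW|lra].
      + apply Req_le; simpl; ring. }
  apply Rle_trans with (1 := Rplus_le_compat _ _ _ _ Ht Hl).
  apply Req_le; unfold om, rho; simpl; field.
- intros [[j a] p] [Ha Hp]; simpl in Ha, Hp; unfold T, step; simpl fst; simpl snd.
  assert (H0 : forall l, eval l (cur (fun _ => 0)) p = 0)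
    by (induction l as [|t l IH]; simpl; [reflexivity|rewrite IH; unfold cur; ring]).
  rewrite !H0, Rplus_0_l, Rplus_0_l, Rminus_0_r.
  eapply Rle_trans; [apply HC1; assumption|]; unfold om; simpl.
  pose proof (wt_pos (nox a) p) as HW; pose proof (Rle_abs C1); pose proof (Rabs_pos C1).
  pose proof (pow_R1_Rle M (length a) HM).
  apply Rle_trans with (Rabs C1 * (1 * wt (nox a) p)).
  + rewrite Rmult_1_l; apply Rmult_le_compat_r; assumption.
  + apply Rmult_le_compat_l; [assumption|apply Rmult_le_compat_r; assumption].
- intros un u Hun Hu.
  assert (Hu' : forall j a, (length a <= n)%nat ->
    unif _ strip (fun _ => 1) (fun k => cur (un k) j a) (cur u j a)).
  { intros j a Ha e He.
    assert (HMa : 0 < M ^ length a) by (apply pow_lt; lra).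
    destruct (Hu (e / M ^ length a)) as [N HN]; [apply Rdiv_lt_0_compat; lra|].
    exists N; intros k p Hk Hp.
    eapply Rle_trans; [apply (HN k ((j, a), p) Hk); split; assumption|].
    unfold om; simpl.
    replace (e / M ^ length a * (M ^ length a * wt (nox a) p)) with (e * wt (nox a) p)
      by (field; lra).
    apply Rmult_le_compat_l; [lra|apply wt_le1]. }
  split.
  + intros j a p Ha Hp; apply (continuous_unif strip (fun k => cur (un k) j a)).
    * apply open_strip.
    * apply Hu', Ha.
    * intros k p' Hp'; apply (proj1 (Hun k)); assumption.
    * exact Hp.
  + intros j a b p Ha Hp.
    apply (is_pd_unif strip b (fun k => cur (un k) j a) (fun k => cur (un k) j (b :: a))
      (cur u j a) (cur u j (b :: a))).
    * apply open_strip.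
    * apply Hu'; lia.
    * apply Hu'; simpl; lia.
    * intros k p' Hp'; apply (proj2 (Hun k)); assumption.
    * intros k p' Hp'; apply (proj1 (Hun k)); [simpl; lia|assumption].
    * exact Hp.
- exists (fun j => cur u j nil); split.
  + assert (HW : forall k j a, (k + length a = n)%nat ->
      CW k strip (Some (nox a)) (cur u j a)).
    { induction k as [|k IH]; intros j a Ha.
      all: assert (Hb : wbound (Some (nox a)) strip (cur u j a))
        by (exists (Rabs C1 / (1 - rho) * M ^ length a); intros p Hp;
            assert (Hx : dom ((j, a), p)) by (split; simpl; [lia|exact Hp]);
            assert (K := Hbd ((j, a), p) Hx);
            rewrite Rminus_0_r in K; unfold om in K; simpl in K;
            rewrite Rmult_assoc; exact K).
      - split; [|split; [exact Hb|exact I]].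
        intros p Hp; apply (proj1 HPu); [lia|exact Hp].
      - apply CW_intro with (d := fun b => cur u j (b :: a)).
        + apply open_strip.
        + intros p Hp; apply (proj1 HPu); [lia|exact Hp].
        + exact Hb.
        + intros b p Hp; apply (proj2 HPu); [lia|exact Hp].
        + apply (IH j (false :: a)); simpl; lia.
        + apply (IH j (true :: a)); simpl; lia. }
    intros j; apply (HW n j nil); simpl; lia.
  + intros j p Hp; unfold cur at 1; rewrite <- Hfix.
    * unfold T, step; simpl; unfold f; ring.
    * split; [simpl; lia|exact Hp].
Qed.

End FunctionalEquation.

(** * Domains in the plane, and functions vanishing on the axis *)

Lemma is_derive_cst (c x : R) : is_derive (fun _ : R => c) x 0.
Proof. exact (is_derive_const c x). Qed.

Lemma is_derive_eq (f : R -> R) (x l l' : R) : is_derive f x l -> l = l' -> is_derive f x l'.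
Proof. intros H <-; exact H. Qed.

Definition plane (_ : R * R) : Prop := True.
Definition box (c : R) (p : R * R) : Prop := Rabs (fst p) < c /\ Rabs (snd p) < c.
Definition far (c : R) (p : R * R) : Prop := c < Rabs (fst p) \/ c < Rabs (snd p).

Lemma open_plane : open plane.
Proof. apply open_true. Qed.

Lemma open_coord_lt b c : open (fun p : R * R => Rabs (coord b p) < c).
Proof.
intros [x y] Hp; set (t := coord b (x, y)) in *.
assert (Hd : 0 < c - Rabs t) by lra.
exists (mkposreal _ Hd); intros [u v] Hq.
destruct (ball_pair_inv Hq) as [H1 H2]; unfold t in *; destruct b; simpl in *.
- pose proof (Rabs_triang_inv v y); lra.
- pose proof (Rabs_triang_inv u x); lra.
Qed.

Lemma open_coord_gt b c : open (fun p : R * R => c < Rabs (coord b p)).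
Proof.
intros [x y] Hp; set (t := coord b (x, y)) in *.
assert (Hd : 0 < Rabs t - c) by lra.
exists (mkposreal _ Hd); intros [u v] Hq.
destruct (ball_pair_inv Hq) as [H1 H2]; unfold t in *; destruct b; simpl in *.
- pose proof (Rabs_triang_inv y v) as H; rewrite Rabs_minus_sym in H; lra.
- pose proof (Rabs_triang_inv x u) as H; rewrite Rabs_minus_sym in H; lra.
Qed.

Lemma open_box c : open (box c).
Proof. apply open_and; [apply (open_coord_lt false)|apply (open_coord_lt true)]. Qed.

#[local] Hint Resolve open_plane open_strip open_box : core.

Lemma open_far c : open (far c).
Proof. apply open_or; [apply (open_coord_gt false)|apply (open_coord_gt true)]. Qed.

Lemma box_or_far c d p : c < d -> box d p \/ far c p.
Proof.
intros H; unfold box, far.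
destruct (Rlt_dec c (Rabs (fst p))), (Rlt_dec c (Rabs (snd p))); try tauto.
left; split; lra.
Qed.

Lemma CW_union k U V g :
  CW k U None g -> CW k V None g -> CW k (fun p => U p \/ V p) None g.
Proof.
revert g; induction k as [|k IH]; intros g HU HV; simpl in *;
  destruct HU as [H1 [_ H2]], HV as [H3 [_ H4]].
all: split; [intros p [Hp|Hp]; auto|]; split; [exact I|].
- exact I.
- destruct H2 as [H5 [H6 H7]], H4 as [H8 [H9 H10]].
  split; [intros b p [Hp|Hp]; auto|]; split; apply IH; assumption.
Qed.

(** All [y]-derivatives are zero, so the weight is checked on [g] alone, and, unlike in [CW_vanish],
    no derivative is lost. *)
Lemma CW_slice_dep k w g : wbound (Some w) strip g -> CW k strip (Some false) g ->
  (forall p, strip p -> g p = g (fst p, 0)) -> CW k strip (Some w) g.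
Proof.
intros Hb Hg Hdep; destruct k as [|k].
- split; [apply Hg|]; split; [exact Hb|exact I].
- apply CW_intro with (d := fun b => pd b g).
  + auto.
  + apply Hg.
  + exact Hb.
  + intros b p Hp; apply (CW_is_pd _ _ Hg Hp).
  + exact (CW_pd false Hg).
  + apply CW_ext with (g := fun _ => 0); [auto| |apply CW_0].
    intros p Hp; symmetry; apply is_pd_unique.
    apply is_pd_ext_loc with (fun q => g (fst q, 0)).
    * apply (open_locally strip); [auto| |exact Hp].
      intros q Hq; symmetry; apply Hdep, Hq.
    * exact (is_derive_cst (g (fst p, 0)) (snd p)).
Qed.

Lemma vanish_bound g C : (forall p, strip p -> ex_pd false g p) ->
  (forall p, strip p -> Rabs (pd false g p) <= C) -> (forall y, g (0, y) = 0) ->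
  forall p, strip p -> Rabs (g p) <= C * Rabs (fst p).
Proof.
intros He HC H0 [x y] Hp.
pose proof (pd_mean_value false g (x, y) 0 x C) as H.
simpl in H; rewrite H0, !Rminus_0_r in H; apply H; intros c Hc.
assert (Hs : strip (c, y)).
{ unfold strip in *; simpl in *; unfold Rmin, Rmax in Hc.
  apply Rabs_def2 in Hp; destruct (Rle_dec 0 x); apply Rabs_def1; lra. }
exists (pd false g (c, y)); split; [apply ex_pd_correct, He, Hs|apply HC, Hs].
Qed.

(** The [y]-derivatives vanish on the axis together with [g], and the mean value theorem in [x]
    bounds each of them by [|x|]. This uses one more [x]-derivative, hence the loss of one order. *)
Lemma CW_vanish k g : CW (S k) strip (Some false) g -> (forall y, g (0, y) = 0) ->
  CW k strip (Some true) g.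
Proof.
revert g; induction k as [|k IH]; intros g Hg H0.
all: assert (Hb : wbound (Some true) strip g)
 by (destruct (CW_bound (CW_pd false Hg)) as [C [HC Hpd]];
  exists C; intros p Hp; rewrite (wt_strip p Hp); apply vanish_bound;
  [intros q Hq; apply (CW_ex_pd _ _ Hg Hq)
  |intros q Hq; specialize (Hpd q Hq); simpl wt in Hpd; lra|exact H0|exact Hp]).
- split; [apply Hg|]; split; [exact Hb|exact I].
- apply CW_intro with (d := fun b => pd b g).
  + auto.
  + apply Hg.
  + exact Hb.
  + intros b p Hp; apply (CW_is_pd _ _ Hg Hp).
  + apply CW_S; exact (CW_pd false Hg).
  + apply IH; [exact (CW_pd true Hg)|].
    intros y; apply is_pd_unique; unfold is_pd; simpl.
    apply is_derive_ext with (fun _ => 0); [intros; symmetry; apply H0|apply is_derive_cst].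
Qed.

(** * Cutting off *)

(** By uniform continuity, [g] changes by less than 1 over steps shorter than some [d]; the segment
    from the origin to [p] is cut into [N] such steps. *)
Lemma bounded_on_box (g : R * R -> R) : (forall p, continuous g p) ->
  exists C, forall p, Rabs (fst p) <= 1 -> Rabs (snd p) <= 1 -> Rabs (g p) <= C.
Proof.
intros Hg.
destruct (uniform_continuity_2d (fun x y => g (x, y)) (-1) 1 (-1) 1) with (eps := mkposreal 1 Rlt_0_1)
  as [d Hd].
{ intros x y _ _; apply continuity_2d_pt_filterlim.
  change (continuous (fun z : R * R => g (fst z, snd z)) (x, y)).
  apply continuous_ext with (2 := Hg (x, y)); intros [u v]; reflexivity. }
destruct (nfloor_ex (/ d)) as [n Hn]; [left; apply Rinv_0_lt_compat, cond_pos|].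
set (N := INR (S n)).
assert (HN : 0 < N) by (apply lt_0_INR; lia).
assert (HNd : / N < d).
{ rewrite <- (Rinv_inv d); apply Rinv_lt_contravar; [|unfold N; rewrite S_INR; lra].
  apply Rmult_lt_0_compat; [apply Rinv_0_lt_compat, cond_pos|exact HN]. }
exists (Rabs (g (0, 0)) + N); intros [x y] Hx Hy; simpl in Hx, Hy.
assert (Hk : forall k, (k <= S n)%nat ->
  Rabs (g (INR k / N * x, INR k / N * y)) <= Rabs (g (0, 0)) + INR k).
{ induction k as [|k IH]; intros Hk.
  - simpl; unfold Rdiv; rewrite !Rmult_0_l; lra.
  - specialize (IH ltac:(lia)); rewrite S_INR.
    assert (Hr : forall j z, (j <= S n)%nat -> Rabs z <= 1 -> -1 <= INR j / N * z <= 1).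
    { intros j z Hj Hz; apply le_INR in Hj; fold N in Hj; pose proof (pos_INR j).
      assert (Hq : 0 <= INR j / N <= 1).
      { split; [apply Rdiv_le_0_compat; assumption|].
        apply Rmult_le_reg_r with N; [exact HN|]; unfold Rdiv.
        rewrite Rmult_assoc, Rinv_l by lra; lra. }
      apply Rabs_le_between; rewrite Rabs_mult, (Rabs_pos_eq (INR j / N)) by apply Hq.
      pose proof (Rabs_pos z); nra. }
    assert (Hs : forall z, Rabs z <= 1 -> Rabs ((INR k + 1) / N * z - INR k / N * z) < d).
    { intros z Hz.
      replace ((INR k + 1) / N * z - INR k / N * z) with (/ N * z) by (field; lra).
      rewrite Rabs_mult, Rabs_pos_eq by (left; apply Rinv_0_lt_compat, HN).
      pose proof (Rinv_0_lt_compat _ HN); pose proof (Rabs_pos z); nra. }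
    pose proof (Hd (INR k / N * x) (INR k / N * y) ((INR k + 1) / N * x) ((INR k + 1) / N * y)) as H.
    simpl in H; rewrite <- S_INR in *.
    specialize (H (Hr k x ltac:(lia) Hx) (Hr k y ltac:(lia) Hy) (Hr (S k) x Hk Hx)
      (Hr (S k) y Hk Hy) (Hs x Hx) (Hs y Hy)).
    pose proof (Rabs_triang_inv (g (INR (S k) / N * x, INR (S k) / N * y))
      (g (INR k / N * x, INR k / N * y))).
    rewrite S_INR in *; lra. }
specialize (Hk (S n) (le_n _)); fold N in Hk.
replace (N / N) with 1 in Hk by (field; lra); rewrite !Rmult_1_l in Hk; exact Hk.
Qed.

Lemma pd_far c g b p : (forall q, far c q -> g q = 0) -> far c p -> is_pd b g p 0.
Proof.
intros H Hp; apply is_pd_ext_loc with (fun _ => 0); [|apply is_pd_const].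
apply (open_locally (far c)); [apply open_far| |exact Hp].
intros q Hq; symmetry; apply H, Hq.
Qed.

Lemma CW_compact k g : CW k plane None g -> (forall p, far 1 p -> g p = 0) ->
  CW k plane (Some false) g.
Proof.
revert g; induction k as [|k IH]; intros g Hg H0.
all: assert (Hb : wbound (Some false) plane g)
  by (destruct (bounded_on_box g (fun p => CW_cont p Hg I)) as [C HC];
      exists (Rmax C 0); intros p _; simpl; rewrite Rmult_1_r;
      destruct (Rle_dec (Rabs (fst p)) 1) as [Hx|Hx];
      [destruct (Rle_dec (Rabs (snd p)) 1) as [Hy|Hy];
        [eapply Rle_trans; [apply HC; assumption|apply Rmax_l]|]|];
      (rewrite H0 by (unfold far; lra)); rewrite Rabs_R0; apply Rmax_r).
- split; [apply Hg|]; split; [exact Hb|exact I].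
- apply CW_intro with (d := fun b => pd b g).
  + auto.
  + apply Hg.
  + exact Hb.
  + intros b p Hp; apply (CW_is_pd _ _ Hg Hp).
  + apply IH; [exact (CW_pd false Hg)|].
    intros p Hp; apply is_pd_unique, (pd_far 1); assumption.
  + apply IH; [exact (CW_pd true Hg)|].
    intros p Hp; apply is_pd_unique, (pd_far 1); assumption.
Qed.

(** The truncated power, of class [C^(k-1)]. Finite smoothness is all that is required of a bump
    function here, and these powers are closed under differentiation up to constants. *)
Definition pospow (k : nat) (t : R) : R := Rmax 0 t ^ k.

(** The square is treated by hand, the difference quotient at 0 being [h] or 0; higher powers follow
    from [u * pospow (S (S k)) u]. *)
Lemma pospow_derive k t :
  is_derive (pospow (S (S k))) t (INR (S (S k)) * pospow (S k) t).
Proof.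
revert t; induction k as [|k IH]; intros t.
- destruct (Rtotal_order t 0) as [Ht|[->|Ht]].
  + apply is_derive_ext_loc with (fun _ => 0).
    * exists (mkposreal (- t) ltac:(lra)); intros u Hu.
      apply Rabs_def2 in Hu; simpl in Hu; unfold minus, plus, opp in Hu; simpl in Hu.
      unfold pospow; rewrite Rmax_left by lra; simpl; ring.
    * unfold pospow; rewrite Rmax_left by lra; simpl.
      apply (is_derive_eq _ _ 0); [apply is_derive_cst|ring].
  + apply (is_derive_eq _ _ 0);
      [|unfold pospow; rewrite (Rmax_left 0 0) by lra; simpl; ring].
    apply is_derive_Reals; intros eps He; exists (mkposreal eps He); intros h Hh Hlt.
    simpl in Hlt; rewrite Rplus_0_l, Rminus_0_r; unfold pospow.
    rewrite (Rmax_left 0 0) by lra; replace (0 ^ 2) with 0 by ring; rewrite Rminus_0_r.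
    destruct (Rle_dec h 0) as [Hn|Hn].
    * rewrite Rmax_left by lra; replace (0 ^ 2 / h) with 0 by (field; lra).
      rewrite Rabs_R0; exact He.
    * rewrite Rmax_right by lra; replace (h ^ 2 / h) with h by (field; lra); exact Hlt.
  + apply is_derive_ext_loc with (fun u => u ^ 2).
    * exists (mkposreal t Ht); intros u Hu.
      apply Rabs_def2 in Hu; simpl in Hu; unfold minus, plus, opp in Hu; simpl in Hu.
      unfold pospow; rewrite Rmax_right by lra; reflexivity.
    * apply (is_derive_eq _ _ (2 * t)); [auto_derive; [exact I|ring]|].
      unfold pospow; rewrite Rmax_right by lra; simpl; ring.
- apply is_derive_ext with (fun u => u * pospow (S (S k)) u).
  + intros u; unfold pospow, Rmax; destruct (Rle_dec 0 u); simpl; ring.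
  + pose proof (is_derive_mult (fun u => u) (pospow (S (S k))) t 1 _ (is_derive_id t) (IH t)
      Rmult_comm) as H.
    apply (is_derive_eq _ _ _ _ H).
    unfold plus, mult; simpl plus; simpl mult; rewrite (S_INR (S (S k))).
    unfold pospow, Rmax; destruct (Rle_dec 0 t); simpl; ring.
Qed.

Lemma CW_pospow k : CW k plane None (fun p => pospow (S k) (fst p)).
Proof.
induction k as [|k IH].
- split; [|split; exact I]; intros p _.
  apply continuous_ext with (fun p : R * R => (fst p + Rabs (fst p)) * / 2).
  + intros [x y]; unfold pospow, Rmax; simpl; destruct (Rle_dec 0 x);
      [rewrite Rabs_pos_eq by lra|rewrite Rabs_left by lra]; field.
  + apply continuous_Rmult; [|apply continuous_const].
    apply continuous_Rplus; [apply continuous_fst|].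
    apply (continuous_comp fst Rabs); [apply continuous_fst|apply continuous_Rabs].
- assert (H : forall b p, plane p -> is_pd b (fun p => pospow (S (S k)) (fst p)) p
     (if b then 0 else INR (S (S k)) * pospow (S k) (fst p))).
  { intros [|] p _; [exact (is_derive_cst (pospow (S (S k)) (fst p)) (snd p))
      |exact (pospow_derive k (fst p))]. }
  apply CW_intro with (d := fun (b : bool) p => if b then 0 else INR (S (S k)) * pospow (S k) (fst p)).
  + auto.
  + intros p _; apply (continuous_comp fst (pospow (S (S k)))); [apply continuous_fst|].
    apply (ex_derive_continuous (V := R_NormedModule)); eexists; apply pospow_derive.
  + exact I.
  + exact H.
  + apply CW_scal; [auto|exact IH].
  + apply CW_0.
Qed.

(** The quantity [3 (4/9 - x^2)] is at most 0 for [|x| >= 2/3] and at least 1 for [|x| <= 1/3]. The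
    inner truncation flattens the function on the first range, the outer one on the second. *)
Definition bump1 (k : nat) (x : R) : R :=
  1 - pospow (S k) (1 - pospow (S k) (3 * (4 / 9 - x * x))).

Definition bump (k : nat) (p : R * R) : R := bump1 k (fst p) * bump1 k (snd p).

Lemma pospow_0 k t : t <= 0 -> pospow (S k) t = 0.
Proof. intros H; unfold pospow; rewrite Rmax_left by lra; simpl; ring. Qed.

Lemma pospow_1 k t : 1 <= t -> 1 <= pospow k t.
Proof. intros H; unfold pospow; rewrite Rmax_right by lra; apply pow_R1_Rle, H. Qed.

Lemma bump1_far k x : 2 / 3 < Rabs x -> bump1 k x = 0.
Proof.
intros H; unfold bump1; rewrite (pospow_0 k (3 * _)).
- unfold pospow; rewrite Rmax_right, Rminus_0_r, pow1 by lra; ring.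
- assert (2/3 * (2/3) <= Rabs x * Rabs x) by (apply Rmult_le_compat; lra).
  rewrite <- Rabs_mult, Rabs_pos_eq in H0 by nra; lra.
Qed.

Lemma bump1_near k x : Rabs x <= 1 / 3 -> bump1 k x = 1.
Proof.
intros H; unfold bump1; rewrite (pospow_0 k (1 - _)); [ring|].
assert (Hx : Rabs x * Rabs x <= 1/3 * (1/3)) by (apply Rmult_le_compat; try apply Rabs_pos; lra).
rewrite <- Rabs_mult, Rabs_pos_eq in Hx by nra.
pose proof (pospow_1 (S k) (3 * (4 / 9 - x * x))); lra.
Qed.

Lemma bump_far k p : far (2 / 3) p -> bump k p = 0.
Proof.
intros [H|H]; unfold bump; rewrite (bump1_far _ _ H); ring.
Qed.

Lemma bump_near k p : Rabs (fst p) <= 1 / 3 -> Rabs (snd p) <= 1 / 3 -> bump k p = 1.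
Proof. intros H1 H2; unfold bump; rewrite !bump1_near by assumption; ring. Qed.

Lemma CW_bump k : CW k plane (Some false) (bump k).
Proof.
apply CW_compact; [|intros p Hp; apply bump_far; destruct Hp; [left|right]; lra].
assert (Hcomp : forall h, CW k plane None h ->
  CW k plane None (fun p => pospow (S k) (h p))).
{ intros h Hh.
  apply (CW_comp_None k plane plane (fun p => pospow (S k) (fst p)) h (fun _ => 0));
    auto; try exact Hh; [apply CW_pospow|apply CW_0]. }
assert (H1 : forall b, CW k plane None (fun p => bump1 k (coord b p))).
{ intros b; unfold bump1.
  apply CW_minus; [auto|exact (CW_const _ _ None _)|].
  apply Hcomp, CW_minus; [auto|exact (CW_const _ _ None _)|].
  apply Hcomp, CW_scal; [auto|].
  apply CW_minus; [auto|exact (CW_const _ _ None _)|].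
  apply CW_mult; [auto| |]; apply CW_coord. }
apply (CW_mult k plane None (fun p => bump1 k (fst p)) (fun p => bump1 k (snd p)));
  [auto|apply (H1 false)|apply (H1 true)].
Qed.

(** The product is smooth on [box 1], where [g] is known, and zero on [far (2 / 3)]; these two open
    sets cover the plane. *)
Lemma CW_cut k g : CW k (box 1) None g ->
  CW k plane (Some false) (fun p => bump k p * g p).
Proof.
intros Hg.
assert (H0 : forall p, far (2 / 3) p -> bump k p * g p = 0)
  by (intros p Hp; rewrite (bump_far _ _ Hp); ring).
apply CW_compact; [|intros p Hp; apply H0; destruct Hp; [left|right]; lra].
apply CW_sub with (U := fun p => box 1 p \/ far (2 / 3) p).
- intros p _; apply box_or_far; lra.
- apply CW_union.
  + apply CW_mult; [auto| |exact Hg].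
    apply CW_sub with plane; [intros; exact I|].
    exact (CW_None (CW_bump k)).
  + apply CW_ext with (fun _ => 0); [apply open_far| |apply CW_0].
    intros p Hp; symmetry; apply H0, Hp.
Qed.

(** * Rescaling: cut-off nonlinearities that are small in [C^2] *)

Lemma is_pd_eq {b g p} l {l'} : is_pd b g p l -> l = l' -> is_pd b g p l'.
Proof. intros H <-; exact H. Qed.

Lemma continuous_near (g : R * R -> R) p eps : continuous g p -> 0 < eps ->
  exists d, 0 < d /\ forall q, Rabs (fst q - fst p) < d -> Rabs (snd q - snd p) < d ->
    Rabs (g q - g p) < eps.
Proof.
intros Hg He; destruct (Hg _ (locally_ball (g p) (mkposreal eps He))) as [d Hd].
exists d; split; [apply cond_pos|]; intros q H1 H2.
exact (Hd q (ball_pair p q d H1 H2)).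
Qed.

Lemma box_mean_value c g B p : box c p ->
  (forall b q, box c q -> ex_pd b g q) -> (forall b q, box c q -> Rabs (pd b g q) <= B) ->
  g (0, 0) = 0 -> Rabs (g p) <= B * (Rabs (fst p) + Rabs (snd p)).
Proof.
destruct p as [x y]; intros [Hx Hy] He HB H0; simpl in *.
assert (Hseg : forall t u, Rabs t < c -> Rmin 0 t <= u <= Rmax 0 t -> Rabs u < c).
{ intros t u Ht Hu; unfold Rmin, Rmax in Hu; apply Rabs_def2 in Ht.
  destruct (Rle_dec 0 t); apply Rabs_def1; lra. }
assert (Hc : Rabs 0 < c) by (rewrite Rabs_R0; pose proof (Rabs_pos x); lra).
assert (H1 := pd_mean_value false g (x, y) 0 x B).
assert (H2 := pd_mean_value true g (0, y) 0 y B).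
simpl in H1, H2; rewrite Rminus_0_r in H1, H2; rewrite H0, Rminus_0_r in H2.
assert (K1 : Rabs (g (x, y) - g (0, y)) <= B * Rabs x).
{ apply H1; intros u Hu; assert (Hb : box c (u, y)) by (split; [exact (Hseg x u Hx Hu)|exact Hy]).
  exists (pd false g (u, y)); split; [apply ex_pd_correct, He, Hb|apply (HB false), Hb]. }
assert (K2 : Rabs (g (0, y)) <= B * Rabs y).
{ apply H2; intros u Hu; assert (Hb : box c (0, u)) by (split; [exact Hc|exact (Hseg y u Hy Hu)]).
  exists (pd true g (0, u)); split; [apply ex_pd_correct, He, Hb|apply (HB true), Hb]. }
replace (g (x, y)) with ((g (x, y) - g (0, y)) + g (0, y)) by ring.
eapply Rle_trans; [apply Rabs_triang|]; lra.
Qed.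

Lemma uniform_bool (P : bool -> R -> Prop) :
  (forall b c c', 0 < c' <= c -> P b c -> P b c') -> (forall b, exists c, 0 < c /\ P b c) ->
  exists c, 0 < c /\ forall b, P b c.
Proof.
intros Hmon H; destruct (H false) as [c1 [H1 P1]], (H true) as [c2 [H2 P2]].
exists (Rmin c1 c2); split; [apply Rmin_glb_lt; assumption|].
assert (0 < Rmin c1 c2) by (apply Rmin_glb_lt; assumption).
intros [|]; [apply (Hmon _ c2)|apply (Hmon _ c1)]; try assumption;
  (split; [assumption|]); [apply Rmin_r|apply Rmin_l].
Qed.

(** The map [g] conjugated by the dilation of ratio [d], then cut off. *)
Definition rescale (k : nat) (g : R * R -> R) (d : R) (p : R * R) : R :=
  bump k p * (g (d * fst p, d * snd p) / d).

Lemma CW_dilate k U g d : open U -> CW k U None g ->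
  CW k (fun p => U (d * fst p, d * snd p)) None (fun p => g (d * fst p, d * snd p)).
Proof.
intros HU Hg.
assert (HU' : open (fun p => U (d * fst p, d * snd p))).
{ apply (open_comp (fun p : R * R => (d * fst p, d * snd p)) U); [|exact HU].
  intros p _; apply continuous_pair; apply continuous_Rmult;
    try apply continuous_const; [apply continuous_fst|apply continuous_snd]. }
apply (CW_comp_None k _ U g (fun p => d * fst p) (fun p => d * snd p)); try assumption.
- intros p Hp; exact Hp.
- apply CW_scal; [exact HU'|apply CW_fst].
- apply CW_scal; [exact HU'|apply CW_snd].
Qed.

Lemma is_pd_dilate b g d p l : d <> 0 -> is_pd b g (d * fst p, d * snd p) l ->
  is_pd b (fun q => g (d * fst q, d * snd q) / d) p l.
Proof.
intros Hd H; destruct p as [x y]; unfold is_pd in *.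
assert (K : is_derive (fun t => g (slice b (d * x, d * y) (d * t))) (coord b (x, y)) (d * l)).
{ pose proof (is_derive_comp (fun t => g (slice b (d * x, d * y) t)) (fun t => d * t)
    (coord b (x, y)) l d) as K; cbv beta in K.
  apply K.
  - destruct b; exact H.
  - apply (is_derive_eq _ _ (d * 1)); [|ring].
    exact (is_derive_scal _ _ _ _ (is_derive_id _)). }
apply (is_derive_eq _ _ (/ d * (d * l))); [|field; exact Hd].
apply is_derive_ext with (fun t => / d * g (slice b (d * x, d * y) (d * t)));
  [|exact (is_derive_scal _ _ _ _ K)].
intros t; destruct b; simpl; unfold Rdiv; ring.
Qed.

Lemma CW_bound_2 k g : CW (S (S k)) plane (Some false) g ->
  exists B, 0 < B /\ (forall p, Rabs (g p) <= B) /\ (forall b p, Rabs (pd b g p) <= B) /\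
    (forall a b p, Rabs (pd a (pd b g) p) <= B).
Proof.
intros Hg.
assert (H0 : forall h, CW k plane (Some false) h -> exists B, 0 <= B /\ forall p, Rabs (h p) <= B).
{ intros h Hh; destruct (CW_bound Hh) as [B [HB H]]; exists B; split; [exact HB|].
  intros p; specialize (H p I); simpl wt in H; lra. }
assert (H1 : forall h, CW (S k) plane (Some false) h ->
  exists B, 0 <= B /\ (forall p, Rabs (h p) <= B) /\ forall b p, Rabs (pd b h p) <= B).
{ intros h Hh; destruct (H0 h (CW_S Hh)) as [B [HB K]].
  destruct (H0 _ (CW_pd false Hh)) as [B1 [HB1 K1]], (H0 _ (CW_pd true Hh)) as [B2 [HB2 K2]].
  exists (B + B1 + B2); split; [lra|]; split; [intros p; specialize (K p); lra|].
  intros [|] p; [specialize (K2 p)|specialize (K1 p)]; lra. }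
destruct (H1 g (CW_S Hg)) as [B [HB [K K']]].
destruct (H1 _ (CW_pd false Hg)) as [B1 [HB1 [_ K1]]], (H1 _ (CW_pd true Hg)) as [B2 [HB2 [_ K2]]].
exists (1 + B + B1 + B2); split; [lra|]; split; [|split].
- intros p; specialize (K p); lra.
- intros b p; specialize (K' b p); lra.
- intros a [|] p; [specialize (K2 a p)|specialize (K1 a p)]; lra.
Qed.

(** Let [G(p) = g(d p) / d]. Its first derivatives are those of [g] at [d p], small by continuity
    since they vanish at 0; its second derivatives gain a factor [d]; [G] itself is small by the
    mean value theorem. Multiplying by the bump costs only the fixed bound [B]. Derivatives of order
    above two are merely bounded. *)
Lemma rescale_small k c g eps : 0 < c -> 0 < eps -> CW (S (S k)) (box c) None g ->
  g (0, 0) = 0 -> (forall b, pd b g (0, 0) = 0) ->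
  exists d0, 0 < d0 /\ forall d, 0 < d <= d0 ->
    let h := rescale (S (S k)) g d in
    CW (S (S k)) plane (Some false) h /\
    (forall p, Rabs (h p) <= eps) /\ (forall b p, Rabs (pd b h p) <= eps) /\
    (forall a b p, Rabs (pd a (pd b h) p) <= eps) /\
    (forall p, Rabs (fst p) <= 1 / 3 -> Rabs (snd p) <= 1 / 3 ->
      h p = g (d * fst p, d * snd p) / d).
Proof.
intros Hc He Hg H0 Hd0.
set (n := S (S k)) in *.
assert (Ho : box c (0, 0)) by (split; simpl; rewrite Rabs_R0; exact Hc).
destruct (CW_bound_2 k _ (CW_bump n)) as [B [HB0 [HB [HB1 HB2]]]].
(* The worst case is a second derivative of [bump * G]: its four Leibniz terms add up to at most
   [5 * B * eta], one of them containing [|G| <= 2 * eta]. *)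
set (eta := eps / (6 * B)).
assert (Heta : 0 < eta) by (apply Rdiv_lt_0_compat; lra).
assert (HBeta : B * (6 * eta) = eps) by (unfold eta; field; lra).
assert (Hn1 : exists d1, 0 < d1 /\ forall b q, box d1 q -> Rabs (pd b g q) <= eta).
{ apply (uniform_bool (fun b d1 => forall q, box d1 q -> Rabs (pd b g q) <= eta)).
  - intros b d1 d2 Hd H q [K1 K2]; apply H; split; lra.
  - intros b.
    destruct (continuous_near (pd b g) (0, 0) eta) as [d1 [Hd1 K]].
    + exact (CW_cont _ (CW_pd_flat b Hg) Ho).
    + exact Heta.
    + exists d1; split; [exact Hd1|]; intros q [K1 K2].
      specialize (K q); simpl in K; rewrite !Rminus_0_r, Hd0, Rminus_0_r in K.
      apply Rlt_le, K; assumption. }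
assert (Hn2 : forall b, exists d2, 0 < d2 /\ forall a q d, box d2 q -> 0 < d <= d2 ->
  d * Rabs (pd a (pd b g) q) <= eta).
{ intros b; apply (uniform_bool (fun a d2 => forall q d, box d2 q -> 0 < d <= d2 ->
    d * Rabs (pd a (pd b g) q) <= eta)).
  - intros a d1 d2 Hd H q d [K1 K2] K3; apply H; [split|]; lra.
  - intros a.
    destruct (continuous_near (pd a (pd b g)) (0, 0) 1) as [d1 [Hd1 K]].
    + exact (CW_cont _ (CW_pd_flat a (CW_pd_flat b Hg)) Ho).
    + lra.
    + set (A := Rabs (pd a (pd b g) (0, 0))) in *.
      assert (HA : 0 <= A) by apply Rabs_pos.
      assert (HA1 : 0 < eta / (1 + A)) by (apply Rdiv_lt_0_compat; lra).
      exists (Rmin d1 (eta / (1 + A))); split; [apply Rmin_glb_lt; assumption|].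
      intros q d [K1 K2] [Hp Hd].
      pose proof (Rmin_l d1 (eta / (1 + A))); pose proof (Rmin_r d1 (eta / (1 + A))).
      specialize (K q); simpl in K; rewrite !Rminus_0_r in K.
      assert (Hq : Rabs (pd a (pd b g) q - pd a (pd b g) (0, 0)) < 1) by (apply K; lra).
      pose proof (Rabs_triang_inv (pd a (pd b g) q) (pd a (pd b g) (0, 0))) as Ht.
      fold A in Ht.
      apply Rle_trans with (eta / (1 + A) * (1 + A)); [|apply Req_le; field; lra].
      apply Rmult_le_compat; try lra; apply Rabs_pos. }
destruct Hn1 as [d1 [Hd1 Hn1]].
destruct (Hn2 false) as [d2 [Hd2 Hn2f]], (Hn2 true) as [d3 [Hd3 Hn2t]]; clear Hn2.
set (d0 := Rmin (Rmin (c / 2) d1) (Rmin d2 d3) / 2).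
assert (Hmin : 0 < Rmin (Rmin (c / 2) d1) (Rmin d2 d3))
  by (repeat apply Rmin_glb_lt; lra).
assert (Hle : d0 < c /\ d0 < d1 /\ d0 < d2 /\ d0 < d3).
{ pose proof (Rmin_l (Rmin (c / 2) d1) (Rmin d2 d3)).
  pose proof (Rmin_r (Rmin (c / 2) d1) (Rmin d2 d3)).
  pose proof (Rmin_l (c / 2) d1); pose proof (Rmin_r (c / 2) d1).
  pose proof (Rmin_l d2 d3); pose proof (Rmin_r d2 d3); unfold d0; lra. }
exists d0; split; [unfold d0; lra|].
intros d [Hd Hdd]; intros h.
assert (Hbox : forall e p, d < e -> box 1 p -> box e (d * fst p, d * snd p)).
{ intros e [x y] Hde [Hx Hy]; split; simpl in *; rewrite Rabs_mult, (Rabs_pos_eq d) by lra;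
    [pose proof (Rabs_pos x)|pose proof (Rabs_pos y)]; nra. }
set (G := fun p : R * R => g (d * fst p, d * snd p) / d).
assert (HG : CW n (box 1) None G).
{ unfold G; apply CW_ext with (fun p => / d * g (d * fst p, d * snd p));
    [auto|intros; unfold Rdiv; ring|].
  apply CW_scal; [auto|].
  apply CW_sub with (fun p => box c (d * fst p, d * snd p)); [intros; apply Hbox; [lra|assumption]|].
  apply CW_dilate; [auto|exact Hg]. }
assert (HG1 : forall b p, box 1 p -> pd b G p = pd b g (d * fst p, d * snd p)).
{ intros b p Hp; apply is_pd_unique, is_pd_dilate; [lra|].
  apply (CW_is_pd _ _ Hg), Hbox; [lra|exact Hp]. }
assert (HG2 : forall a b p, box 1 p -> pd a (pd b G) p = d * pd a (pd b g) (d * fst p, d * snd p)).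
{ intros a b p Hp; apply is_pd_unique.
  apply is_pd_ext_loc with (fun q => d * (pd b g (d * fst q, d * snd q) / d)).
  - apply (open_locally (box 1)); [auto| |exact Hp].
    intros q Hq; rewrite (HG1 b q Hq); field; lra.
  - apply is_pd_scal, is_pd_dilate; [lra|].
    apply (CW_is_pd a _ (CW_pd_flat b Hg)), Hbox; [lra|exact Hp]. }
assert (Hg0 : forall p, box 1 p -> Rabs (G p) <= 2 * eta).
{ intros p Hp; unfold G, Rdiv; rewrite Rabs_mult, (Rabs_pos_eq (/ d))
    by (left; apply Rinv_0_lt_compat; lra).
  apply Rmult_le_reg_r with d; [lra|]; rewrite Rmult_assoc, Rinv_l, Rmult_1_r by lra.
  set (e := Rmin c d1).
  assert (He1 : d < e) by (apply Rmin_glb_lt; lra).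
  pose proof (Rmin_l c d1) as Hm1; pose proof (Rmin_r c d1) as Hm2; fold e in Hm1, Hm2.
  eapply Rle_trans; [apply (box_mean_value e g eta)|].
  - apply Hbox; assumption.
  - intros b q [Hq1 Hq2]; apply (CW_ex_pd _ _ Hg); split; lra.
  - intros b q [Hq1 Hq2]; apply Hn1; split; lra.
  - exact H0.
  - destruct p as [x y], Hp as [Hx Hy]; simpl in *.
    rewrite !Rabs_mult, (Rabs_pos_eq d) by lra.
    replace (eta * (d * Rabs x + d * Rabs y)) with (eta * d * (Rabs x + Rabs y)) by ring.
    replace (2 * eta * d) with (eta * d * 2) by ring.
    apply Rmult_le_compat_l; [apply Rmult_le_pos|]; lra. }
assert (Hg1 : forall b p, box 1 p -> Rabs (pd b G p) <= eta).
{ intros b p Hp; rewrite (HG1 b p Hp); apply Hn1, Hbox; [lra|exact Hp]. }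
assert (Hg2 : forall a b p, box 1 p -> Rabs (pd a (pd b G) p) <= eta).
{ intros a b p Hp; rewrite (HG2 a b p Hp), Rabs_mult, (Rabs_pos_eq d) by lra.
  destruct b; [apply Hn2t|apply Hn2f]; try (apply Hbox; [lra|exact Hp]); lra. }
assert (Hh : CW n plane (Some false) h) by exact (CW_cut n G HG).
assert (Hfar : forall p, far (2 / 3) p -> h p = 0)
  by (intros p Hp; unfold h, rescale; rewrite (bump_far _ _ Hp); ring).
assert (Hh1 : forall b p, box 1 p -> pd b h p = pd b (bump n) p * G p + bump n p * pd b G p).
{ intros b p Hp; apply is_pd_unique; apply (is_pd_mult (g := bump n) (h := G)).
  - exact (CW_is_pd b p (CW_bump n) I).
  - exact (CW_is_pd b p HG Hp). }
assert (Hh1far : forall b p, far (2 / 3) p -> pd b h p = 0)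
  by (intros b p Hp; apply is_pd_unique, (pd_far (2 / 3)); assumption).
assert (Hprod : forall u v U V, Rabs u <= U -> Rabs v <= V -> Rabs (u * v) <= U * V)
  by (intros u v U V Hu Hv; rewrite Rabs_mult; apply Rmult_le_compat; try apply Rabs_pos; assumption).
split; [exact Hh|]; split; [|split; [|split]].
- intros p; destruct (box_or_far (2 / 3) 1 p) as [Hp|Hp]; [lra| |].
  + change (h p) with (bump n p * G p).
    eapply Rle_trans; [apply (Hprod _ _ B (2 * eta)); [apply HB|apply Hg0, Hp]|]; nra.
  + rewrite (Hfar p Hp), Rabs_R0; lra.
- intros b p; destruct (box_or_far (2 / 3) 1 p) as [Hp|Hp]; [lra| |].
  + rewrite (Hh1 b p Hp); eapply Rle_trans; [apply Rabs_triang|].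
    pose proof (Hprod _ _ _ _ (HB1 b p) (Hg0 p Hp)).
    pose proof (Hprod _ _ _ _ (HB p) (Hg1 b p Hp)); nra.
  + rewrite (Hh1far b p Hp), Rabs_R0; lra.
- intros a b p; destruct (box_or_far (2 / 3) 1 p) as [Hp|Hp]; [lra| |].
  + assert (K : is_pd a (pd b h) p
      ((pd a (pd b (bump n)) p * G p + pd b (bump n) p * pd a G p)
        + (pd a (bump n) p * pd b G p + bump n p * pd a (pd b G) p))).
    { apply is_pd_ext_loc with (fun q => pd b (bump n) q * G q + bump n q * pd b G q).
      - apply (open_locally (box 1)); [auto| |exact Hp].
        intros q Hq; symmetry; apply Hh1, Hq.
      - apply is_pd_plus; apply is_pd_mult.
        + exact (CW_is_pd a p (CW_pd_flat b (CW_bump n)) I).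
        + exact (CW_is_pd a p HG Hp).
        + exact (CW_is_pd a p (CW_bump n) I).
        + exact (CW_is_pd a p (CW_pd_flat b HG) Hp). }
    rewrite (is_pd_unique K).
    pose proof (Hprod _ _ _ _ (HB2 a b p) (Hg0 p Hp)) as K1.
    pose proof (Hprod _ _ _ _ (HB1 b p) (Hg1 a p Hp)) as K2.
    pose proof (Hprod _ _ _ _ (HB1 a p) (Hg1 b p Hp)) as K3.
    pose proof (Hprod _ _ _ _ (HB p) (Hg2 a b p Hp)) as K4.
    eapply Rle_trans; [apply Rabs_triang|].
    pose proof (Rabs_triang (pd a (pd b (bump n)) p * G p) (pd b (bump n) p * pd a G p)).
    pose proof (Rabs_triang (pd a (bump n) p * pd b G p) (bump n p * pd a (pd b G) p)).
    nra.
  + rewrite (is_pd_unique (pd_far (2 / 3) (pd b h) a p (fun q Hq => Hh1far b q Hq) Hp)).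
    rewrite Rabs_R0; lra.
- intros p Hx Hy; unfold h, rescale; rewrite bump_near by assumption; ring.
Qed.

(** * Composition with elementary functions *)

Lemma CW_exp k U g : open U -> CW k U None g -> CW k U None (fun p => exp (g p)).
Proof.
intros HU; revert g; induction k as [|k IH]; intros g Hg.
all: assert (Hc : forall p, U p -> continuous (fun p => exp (g p)) p)
  by (intros p Hp; apply (continuous_comp g exp); [exact (CW_cont _ Hg Hp)|];
      apply (ex_derive_continuous (V := R_NormedModule)); eexists; apply is_derive_exp).
- split; [exact Hc|]; split; exact I.
- assert (Hd : forall b, CW k U None (fun p => exp (g p) * pd b g p)).
  { intros b; apply CW_mult; [exact HU|apply IH, CW_S, Hg|exact (CW_pd_flat b Hg)]. }
  apply CW_intro with (d := fun b p => exp (g p) * pd b g p); try assumption; try exact I;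
    try apply Hd.
  intros b p Hp; apply (is_pd_comp1 b exp); [apply is_derive_exp|].
  exact (CW_is_pd b p Hg Hp).
Qed.

Lemma CW_inv k U g : open U -> (forall p, U p -> g p <> 0) -> CW k U None g ->
  CW k U None (fun p => / g p).
Proof.
intros HU H0; induction k as [|k IH]; intros Hg.
all: assert (Hc : forall p, U p -> continuous (fun p => / g p) p)
  by (intros p Hp; apply (continuous_comp g Rinv); [exact (CW_cont _ Hg Hp)|];
      apply continuous_Rinv, H0, Hp).
- split; [exact Hc|]; split; exact I.
- assert (Hd : forall b, CW k U None (fun p => - (/ g p * / g p) * pd b g p)).
  { intros b; apply CW_mult; [exact HU| |exact (CW_pd_flat b Hg)].
    apply CW_opp; [exact HU|]; apply CW_mult; try exact HU; apply IH, CW_S, Hg. }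
  apply CW_intro with (d := fun b p => - (/ g p * / g p) * pd b g p); try assumption; try exact I;
    try apply Hd.
  intros b p Hp; apply (is_pd_comp1 b Rinv); [|exact (CW_is_pd b p Hg Hp)].
  apply (is_derive_eq _ _ (- 1 / g p ^ 2)); [|field; apply H0, Hp].
  apply (is_derive_inv (fun t => t)); [exact (is_derive_id _)|apply H0, Hp].
Qed.

Lemma CW_ln k U g : open U -> (forall p, U p -> 0 < g p) -> CW k U None g ->
  CW k U None (fun p => ln (g p)).
Proof.
intros HU H0 Hg.
assert (Hl : forall p, U p -> is_derive ln (g p) (/ g p))
  by (intros p Hp; apply is_derive_ln, H0, Hp).
assert (Hc : forall p, U p -> continuous (fun p => ln (g p)) p).
{ intros p Hp; apply (continuous_comp g ln); [exact (CW_cont _ Hg Hp)|].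
  apply (ex_derive_continuous (V := R_NormedModule)); eexists; apply Hl, Hp. }
destruct k as [|k]; [split; [exact Hc|]; split; exact I|].
assert (Hd : forall b, CW k U None (fun p => / g p * pd b g p)).
{ intros b; apply CW_mult; [exact HU| |exact (CW_pd_flat b Hg)].
  apply CW_inv; [exact HU|intros p Hp; specialize (H0 p Hp); lra|apply CW_S, Hg]. }
apply CW_intro with (d := fun b p => / g p * pd b g p); try assumption; try exact I;
  try apply Hd.
intros b p Hp; apply (is_pd_comp1 b ln); [apply Hl, Hp|exact (CW_is_pd b p Hg Hp)].
Qed.

(** * Local diffeomorphisms *)

Lemma CW_comp_map k U V g (F : R * R -> R * R) : open U -> open V ->
  (forall p, U p -> V (F p)) -> CW k V None g ->
  (forall b, CW k U None (fun p => coord b (F p))) -> CW k U None (fun p => g (F p)).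
Proof.
intros HU HV HF Hg Hc.
apply CW_ext with (fun p => g (coord false (F p), coord true (F p))); [exact HU| |].
- intros p _; simpl; destruct (F p); reflexivity.
- apply (CW_comp_None k U V g (fun p => coord false (F p)) (fun p => coord true (F p)));
    try assumption; [|apply Hc|apply Hc].
  intros p Hp; specialize (HF p Hp); simpl; destruct (F p); exact HF.
Qed.

Definition diffeo (k : nat) (F G : R * R -> R * R) : Prop :=
  (forall p, G (F p) = p) /\ (forall p, F (G p) = p) /\
  forall b, CW k plane None (fun p => coord b (F p)) /\
            CW k plane None (fun p => coord b (G p)).

Lemma diffeo_sym {k F G} : diffeo k F G -> diffeo k G F.
Proof. intros [H1 [H2 H3]]; split; [exact H2|]; split; [exact H1|]; intros b; split; apply H3. Qed.

Lemma diffeo_comp k F G F' G' : diffeo k F G -> diffeo k F' G' ->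
  diffeo k (fun p => F (F' p)) (fun p => G' (G p)).
Proof.
intros [H1 [H2 H3]] [H1' [H2' H3']]; split; [|split].
- intros p; rewrite H1, H1'; reflexivity.
- intros p; rewrite H2', H2; reflexivity.
- intros b; split.
  + apply (CW_comp_map k plane plane (fun p => coord b (F p)));
      auto; [apply H3|intros b'; apply H3'].
  + apply (CW_comp_map k plane plane (fun p => coord b (G' p)));
      auto; [apply H3'|intros b'; apply H3].
Qed.

Lemma diffeo_le k l F G : (k <= l)%nat -> diffeo l F G -> diffeo k F G.
Proof.
intros Hkl [H1 [H2 H3]]; split; [exact H1|]; split; [exact H2|].
intros b; split; apply CW_le with l; try exact Hkl; apply H3.
Qed.

Section NearIdentity.

Variables (N : bool -> R * R -> R) (k : nat).
Hypothesis N_smooth : forall i, CW (S k) plane (Some false) (N i).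
Hypothesis N_small : forall i b p, Rabs (pd b (N i) p) <= 1 / 8.

Let psi (p : R * R) : R * R := (fst p + N false p, snd p + N true p).

Lemma N_lipschitz i p p' :
  Rabs (N i p' - N i p) <= 1 / 8 * (Rabs (fst p' - fst p) + Rabs (snd p' - snd p)).
Proof.
apply pd_lipschitz; [|intros; apply N_small].
intros b c; exact (CW_ex_pd b c (N_smooth i) I).
Qed.

(** The inverse is the fixed point of [theta = id - N o theta]; each component of [N] has sup-norm
    Lipschitz constant [2 / 8]. Maps of the plane are encoded as functions of a component and a
    point. The identity is an unbounded starting point, but the first displacement is [-N]. *)
Lemma near_id_right_inverse : exists theta : R * R -> R * R, forall p, psi (theta p) = p.
Proof.
destruct (CW_bound (N_smooth false)) as [C1 [HC1 H1]].
destruct (CW_bound (N_smooth true)) as [C2 [HC2 H2]].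
set (cur := fun (u : bool * (R * R) -> R) p => (u (false, p), u (true, p))).
destruct (fixed_point (bool * (R * R)) (fun _ => True) (fun _ => 1) (fun _ => True)
  (fun u x => coord (fst x) (snd x) - N (fst x) (cur u (snd x))) (1 / 4) (C1 + C2)
  (fun x => coord (fst x) (snd x))) as [u [_ [Hu _]]]; try (intros; exact I); try (intros; lra).
- intros u v K HK _ _ Huv [i p] _; simpl.
  replace (coord i p - N i (cur u p) - (coord i p - N i (cur v p)))
    with (N i (cur v p) - N i (cur u p)) by ring.
  eapply Rle_trans; [apply N_lipschitz|]; unfold cur; simpl.
  pose proof (Huv (false, p) I) as K1; pose proof (Huv (true, p) I) as K2.
  rewrite Rabs_minus_sym in K1, K2; lra.
- intros [i p] _; simpl.
  replace (coord i p - N i (cur _ p) - coord i p) with (- N i p)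
    by (unfold cur; simpl; destruct p; simpl; ring).
  rewrite Rabs_Ropp; specialize (H1 p I); specialize (H2 p I); simpl wt in H1, H2.
  destruct i; lra.
- exists (cur u); intros [x y]; unfold psi.
  pose proof (Hu (false, (x, y)) I) as E1; pose proof (Hu (true, (x, y)) I) as E2.
  simpl in E1, E2; unfold cur at 1 3; simpl; f_equal; lra.
Qed.

(** [N] changes distances by at most a quarter. This yields both the injectivity of [psi] and the
    Lipschitz continuity of its inverse. *)
Lemma near_id_expand p p' :
  Rabs (fst p' - fst p) + Rabs (snd p' - snd p)
    <= 2 * (Rabs (fst (psi p') - fst (psi p)) + Rabs (snd (psi p') - snd (psi p))).
Proof.
pose proof (N_lipschitz false p p') as H1; pose proof (N_lipschitz true p p') as H2.
assert (K : forall u a, Rabs u <= Rabs (u + a) + Rabs a).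
{ intros u a; replace u with ((u + a) - a) at 1 by ring; unfold Rminus.
  eapply Rle_trans; [apply Rabs_triang|]; rewrite Rabs_Ropp; lra. }
pose proof (K (fst p' - fst p) (N false p' - N false p)) as K1.
pose proof (K (snd p' - snd p) (N true p' - N true p)) as K2.
unfold psi; simpl.
replace (fst p' + N false p' - (fst p + N false p))
  with (fst p' - fst p + (N false p' - N false p)) by ring.
replace (snd p' + N true p' - (snd p + N true p))
  with (snd p' - snd p + (N true p' - N true p)) by ring.
pose proof (Rabs_pos (fst p' - fst p + (N false p' - N false p))).
pose proof (Rabs_pos (snd p' - snd p + (N true p' - N true p))).
lra.
Qed.

Let jac p := (1 + pd false (N false) p) * (1 + pd true (N true) p)
              - pd true (N false) p * pd false (N true) p.

(* Cramer's rule: the entries of the inverse Jacobian matrix. *)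
Let inv_pd (b i : bool) (p : R * R) : R :=
  / jac p * match b, i with
  | false, false => 1 + pd true (N true) p
  | true, false => - pd true (N false) p
  | false, true => - pd false (N true) p
  | true, true => 1 + pd false (N false) p
  end.

Lemma jac_pos p : 1 / 2 < jac p.
Proof.
unfold jac.
pose proof (N_small false false p) as H1; pose proof (N_small false true p) as H2.
pose proof (N_small true false p) as H3; pose proof (N_small true true p) as H4.
apply Rabs_le_between in H1, H2, H3, H4; nra.
Qed.

(** Expanding [N] to first order at [q = theta p], the increment of [theta] solves a linear system
    with the Jacobian matrix of [psi], up to a remainder that is [o(|h|)] because [theta] is
    Lipschitz. Cramer's rule solves it. *)
Lemma inverse_is_pd (theta : R * R -> R * R) : (forall p, psi (theta p) = p) ->
  forall b i p, is_pd b (fun p => coord i (theta p)) p (inv_pd b i (theta p)).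
Proof.
intros Hth b i p; apply is_derive_Reals; intros eps He.
set (q := theta p); pose proof (jac_pos q) as Hj.
(* The increments of [theta] are at most [2 |h|], so the remainders [R1], [R2] are at most
   [eps / 8 * |h|]; Cramer's rule multiplies this by at most [5 / 4], and dividing by [jac > 1 / 2]
   leaves less than [eps]. *)
assert (He' : 0 < eps / 16) by lra.
assert (Hdif : forall i, dif (N i) q (pd false (N i) q) (pd true (N i) q))
  by (intros i'; apply (CW_dif k plane (Some false)); [auto|apply N_smooth|exact I]).
destruct (Hdif false (mkposreal _ He')) as [d1 Hd1], (Hdif true (mkposreal _ He')) as [d2 Hd2].
pose proof (cond_pos d1) as Hp1; pose proof (cond_pos d2) as Hp2.
simpl in Hd1, Hd2.
assert (Hdm : 0 < Rmin d1 d2 / 2) by (assert (0 < Rmin d1 d2) by (apply Rmin_glb_lt; assumption); lra).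
exists (mkposreal _ Hdm); intros h Hh Hlt; simpl in Hlt.
set (p' := slice b p (coord b p + h)); set (q' := theta p').
rewrite slice_coord.
assert (HL := near_id_expand q q').
unfold q, q' in HL; rewrite !Hth in HL; fold q q' in HL.
assert (Hpp : Rabs (fst p' - fst p) + Rabs (snd p' - snd p) = Rabs h).
{ unfold p'; destruct b; simpl; rewrite Rminus_diag, Rabs_R0;
    [replace (snd p + h - snd p) with h by ring|replace (fst p + h - fst p) with h by ring]; ring. }
rewrite Hpp in HL.
pose proof (Rabs_pos (fst q' - fst q)); pose proof (Rabs_pos (snd q' - snd q)).
pose proof (Rmin_l d1 d2); pose proof (Rmin_r d1 d2).
specialize (Hd1 (fst q') (snd q') ltac:(lra) ltac:(lra)).
specialize (Hd2 (fst q') (snd q') ltac:(lra) ltac:(lra)).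
rewrite <- !surjective_pairing in Hd1, Hd2.
assert (Hmax : Rmax (Rabs (fst q' - fst q)) (Rabs (snd q' - snd q)) <= 2 * Rabs h)
  by (apply Rmax_lub; lra).
assert (E1 := f_equal fst (Hth p')); assert (E2 := f_equal snd (Hth p')).
assert (E3 := f_equal fst (Hth p)); assert (E4 := f_equal snd (Hth p)).
unfold psi in E1, E2, E3, E4; simpl in E1, E2, E3, E4; fold q' in E1, E2; fold q in E3, E4.
set (a1 := pd false (N false) q) in *; set (b1 := pd true (N false) q) in *.
set (a2 := pd false (N true) q) in *; set (b2 := pd true (N true) q) in *.
set (R1 := N false q' - N false q - (a1 * (fst q' - fst q) + b1 * (snd q' - snd q))) in *.
set (R2 := N true q' - N true q - (a2 * (fst q' - fst q) + b2 * (snd q' - snd q))) in *.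
assert (HR1 : Rabs R1 <= eps / 8 * Rabs h)
  by (apply Rle_trans with (1 := Hd1); nra).
assert (HR2 : Rabs R2 <= eps / 8 * Rabs h)
  by (apply Rle_trans with (1 := Hd2); nra).
set (u := fst q' - fst q) in *; set (v := snd q' - snd q) in *.
assert (F1 : (1 + a1) * u + b1 * v + R1 = if b then 0 else h)
  by (unfold R1, u, v, p' in *; destruct b; simpl in *; lra).
assert (F2 : a2 * u + (1 + b2) * v + R2 = if b then h else 0)
  by (unfold R2, u, v, p' in *; destruct b; simpl in *; lra).
assert (Hjac : jac q = (1 + a1) * (1 + b2) - b1 * a2) by reflexivity.
pose proof (N_small false false q) as B1; fold a1 in B1.
pose proof (N_small false true q) as B2; fold b1 in B2.
pose proof (N_small true false q) as B3; fold a2 in B3.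
pose proof (N_small true true q) as B4; fold b2 in B4.
(* The contribution of the remainders to component [i] in Cramer's rule, before division by the
   Jacobian determinant. *)
set (S := if i then - a2 * R1 + (1 + a1) * R2 else (1 + b2) * R1 - b1 * R2).
assert (HS : Rabs S <= 5 / 4 * (eps / 8 * Rabs h)).
{ assert (Hpr : forall c d x y X, Rabs c <= 9 / 8 -> Rabs d <= 1 / 8 -> Rabs x <= X -> Rabs y <= X ->
    Rabs (c * x + d * y) <= 5 / 4 * X).
  { intros c d x y X H3 H4 H5 H6; eapply Rle_trans; [apply Rabs_triang|]; rewrite !Rabs_mult.
    assert (Rabs c * Rabs x <= 9 / 8 * X) by (apply Rmult_le_compat; try apply Rabs_pos; assumption).
    assert (Rabs d * Rabs y <= 1 / 8 * X) by (apply Rmult_le_compat; try apply Rabs_pos; assumption).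
    lra. }
  assert (Hone : forall c, Rabs c <= 1 / 8 -> Rabs (1 + c) <= 9 / 8)
    by (intros c H3; pose proof (Rabs_triang 1 c) as H4; rewrite Rabs_R1 in H4; lra).
  unfold S; destruct i.
  - replace (- a2 * R1 + (1 + a1) * R2) with ((1 + a1) * R2 + (- a2) * R1) by ring.
    apply Hpr; try assumption; [apply Hone, B1|rewrite Rabs_Ropp; exact B3].
  - replace ((1 + b2) * R1 - b1 * R2) with ((1 + b2) * R1 + (- b1) * R2) by ring.
    apply Hpr; try assumption; [apply Hone, B4|rewrite Rabs_Ropp; exact B2]. }
assert (Hsol : coord i q' - coord i q = inv_pd b i q * h - S / jac q).
{ apply Rmult_eq_reg_l with (jac q); [|lra].
  assert (Hr : jac q * (inv_pd b i q * h - S / jac q)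
    = jac q * inv_pd b i q * h - S) by (field; lra).
  rewrite Hr.
  assert (Hi : jac q * inv_pd b i q = match b, i with
    | false, false => 1 + b2 | true, false => - b1 | false, true => - a2 | true, true => 1 + a1 end)
    by (unfold inv_pd; destruct b, i; fold a1 a2 b1 b2; field; lra).
  rewrite Hi, Hjac; unfold S; clear - F1 F2.
  assert (G1 : R1 = (if b then 0 else h) - (1 + a1) * u - b1 * v) by lra.
  assert (G2 : R2 = (if b then h else 0) - a2 * u - (1 + b2) * v) by lra.
  destruct i; simpl; [change (snd q' - snd q) with v|change (fst q' - fst q) with u];
    rewrite G1, G2; destruct b; ring. }
change (Rabs ((coord i q' - coord i q) / h - inv_pd b i q) < eps).
rewrite Hsol.
replace ((inv_pd b i q * h - S / jac q) / h - inv_pd b i q) with (- (S / (jac q * h)))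
  by (field; split; lra).
rewrite Rabs_Ropp; unfold Rdiv; rewrite Rabs_mult, Rabs_inv, Rabs_mult, (Rabs_pos_eq (jac q)) by lra.
assert (Hh0 : 0 < Rabs h) by (apply Rabs_pos_lt, Hh).
apply Rmult_lt_reg_r with (jac q * Rabs h); [apply Rmult_lt_0_compat; lra|].
rewrite Rmult_assoc, Rinv_l, Rmult_1_r by (apply Rgt_not_eq, Rmult_lt_0_compat; lra).
apply Rle_lt_trans with (1 := HS).
apply Rlt_le_trans with (eps * (1 / 2 * Rabs h)); [nra|].
apply Rmult_le_compat_l; [lra|]; apply Rmult_le_compat_r; lra.
Qed.

Lemma inv_pd_smooth b i : CW k plane None (inv_pd b i).
Proof.
assert (HN : forall a j, CW k plane None (pd a (N j)))
  by (intros a j; exact (CW_None (CW_pd_flat a (N_smooth j)))).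
assert (H1 : CW k plane None (fun _ => 1)) by exact (CW_const k _ None 1).
assert (Hp : forall a j, CW k plane None (fun p => 1 + pd a (N j) p))
  by (intros a j; apply CW_plus; [auto|exact H1|apply HN]).
assert (Hn : forall a j, CW k plane None (fun p => - pd a (N j) p))
  by (intros a j; apply CW_opp; [auto|apply HN]).
apply (CW_mult k plane None (fun p => / jac p)); [auto| |].
- apply CW_inv; [auto|intros p _; pose proof (jac_pos p); lra|].
  apply CW_minus; [auto| |];
    (apply CW_mult; [auto| |]); try apply HN; apply Hp.
- destruct b, i; [apply Hp|apply Hn|apply Hn|apply Hp].
Qed.

(** The derivative of [theta] is [inv_pd o theta]: if [theta] is [C^j], so is its derivative, as
    long as [j <= k], and [theta] is [C^(j+1)]. *)
Lemma near_id_diffeo : exists theta, diffeo (S k) psi theta.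
Proof.
destruct near_id_right_inverse as [theta Hth].
assert (Hinj : forall p, theta (psi p) = p).
{ intros p; pose proof (near_id_expand p (theta (psi p))) as H; rewrite Hth in H.
  rewrite !Rminus_diag, Rabs_R0 in H.
  pose proof (Rabs_pos (fst (theta (psi p)) - fst p)).
  pose proof (Rabs_pos (snd (theta (psi p)) - snd p)).
  assert (E1 : fst (theta (psi p)) - fst p = 0)
    by (apply Rabs_eq_0; lra).
  assert (E2 : snd (theta (psi p)) - snd p = 0)
    by (apply Rabs_eq_0; lra).
  destruct (theta (psi p)) as [u v], p as [x y]; simpl in E1, E2; f_equal; lra. }
exists theta; split; [exact Hinj|]; split; [exact Hth|]; intros i; split.
- apply CW_ext with (fun p => coord i p + N i p);
    [auto|intros p _; destruct i; reflexivity|].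
  apply CW_plus; [auto|apply CW_coord|exact (CW_None (N_smooth i))].
- assert (Hc : forall j p, continuous (fun p => coord j (theta p)) p).
  { intros j p P [d Hd]; exists (mkposreal (d / 4) ltac:(pose proof (cond_pos d); lra)).
    intros p' Hp'; apply ball_pair_inv in Hp'; simpl in Hp'; apply Hd.
    pose proof (near_id_expand (theta p) (theta p')) as H; rewrite !Hth in H.
    pose proof (Rabs_pos (fst (theta p') - fst (theta p))).
    pose proof (Rabs_pos (snd (theta p') - snd (theta p))).
    change (Rabs (coord j (theta p') - coord j (theta p)) < d); destruct j; simpl; lra. }
  assert (HJ : forall j, (j <= S k)%nat -> forall i, CW j plane None (fun p => coord i (theta p))).
  { induction j as [|j IH]; intros Hj i'.
    - split; [intros; apply Hc|]; split; exact I.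
    - assert (Hd : forall b, CW j plane None (fun p => inv_pd b i' (theta p))).
      { intros b; apply (CW_comp_map j plane plane (inv_pd b i'));
          auto; [|apply IH; lia].
        apply CW_le with k; [lia|apply inv_pd_smooth]. }
      apply CW_intro with (d := fun b p => inv_pd b i' (theta p)); try apply Hd.
      + auto.
      + intros; apply Hc.
      + exact I.
      + intros b p _; apply inverse_is_pd, Hth. }
  apply HJ; lia.
Qed.

End NearIdentity.

(** The difference between [P] and the identity is rescaled and cut off, which gives a global
    perturbation of the identity; conjugating back by the dilation recovers [P] on the box where the
    bump is 1. Working with global diffeomorphisms avoids tracking domains in compositions. *)
Lemma local_diffeo k c (P : bool -> R * R -> R) : 0 < c ->
  (forall i, CW (S (S k)) (box c) None (P i)) -> (forall i, P i (0, 0) = 0) ->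
  (forall b i, pd b (P i) (0, 0) = delta b i) ->
  exists F G d, diffeo (S (S k)) F G /\ 0 < d /\
    forall p, box d p -> F p = (P false p, P true p).
Proof.
intros Hc HP HP0 HP1.
set (N0 := fun i p => P i p - coord i p).
assert (Ho : box c (0, 0)) by (split; simpl; rewrite Rabs_R0; exact Hc).
assert (HN : forall i, CW (S (S k)) (box c) None (N0 i))
  by (intros i; apply CW_minus; [auto|apply HP|apply CW_coord]).
assert (HNpd : forall b i, pd b (N0 i) (0, 0) = 0).
{ intros b i; apply is_pd_unique.
  pose proof (is_pd_plus (CW_is_pd b _ (HP i) Ho)
    (is_pd_scal _ (-1) _ _ _ (coord_is_pd b i (0, 0)))) as K.
  rewrite HP1 in K.
  apply is_pd_ext_loc with (fun q => P i q + -1 * coord i q).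
  - apply filter_forall; intros q; unfold N0; ring.
  - apply (is_pd_eq _ K); ring. }
assert (He : 0 < 1 / 8) by lra.
destruct (rescale_small k c (N0 false) (1 / 8) Hc He (HN false)) as [d1 [Hd1 K1]];
  [unfold N0; rewrite HP0; simpl; ring|intros b; apply HNpd|].
destruct (rescale_small k c (N0 true) (1 / 8) Hc He (HN true)) as [d2 [Hd2 K2]];
  [unfold N0; rewrite HP0; simpl; ring|intros b; apply HNpd|].
set (d := Rmin d1 d2).
assert (Hd : 0 < d) by (apply Rmin_glb_lt; assumption).
specialize (K1 d (conj Hd (Rmin_l _ _))); specialize (K2 d (conj Hd (Rmin_r _ _))).
set (N := fun i => rescale (S (S k)) (N0 i) d).
destruct (near_id_diffeo N (S k)) as [theta Hth];
  [intros [|]; [apply K2|apply K1]|intros [|]; [apply K2|apply K1]|].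
assert (Hdil : diffeo (S (S k)) (fun p => (d * fst p, d * snd p)) (fun p => (/ d * fst p, / d * snd p))).
{ split; [|split].
  - intros [x y]; simpl; f_equal; field; lra.
  - intros [x y]; simpl; f_equal; field; lra.
  - intros b; split;
      [apply CW_ext with (fun p => d * coord b p)|apply CW_ext with (fun p => / d * coord b p)];
      auto; try (intros p _; destruct b; reflexivity);
      (apply CW_scal; [auto|apply CW_coord]). }
pose proof (diffeo_comp _ _ _ _ _ Hdil (diffeo_comp _ _ _ _ _ Hth (diffeo_sym Hdil))) as H.
eexists; eexists; exists (d / 3); split; [exact H|]; split; [lra|].
intros [x y] [Hx Hy]; simpl in *.
assert (Hz : forall z, Rabs z < d / 3 -> Rabs (/ d * z) <= 1 / 3).
{ intros z Hz; rewrite Rabs_mult, (Rabs_pos_eq (/ d)) by (left; apply Rinv_0_lt_compat, Hd).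
  apply Rmult_le_reg_l with d; [exact Hd|]; rewrite <- Rmult_assoc, Rinv_r by lra; lra. }
destruct K1 as [_ [_ [_ [_ K1]]]], K2 as [_ [_ [_ [_ K2]]]].
unfold N; rewrite K1, K2 by (simpl; apply Hz; assumption).
assert (Ez : forall z, d * (/ d * z) = z) by (intros z; field; lra).
simpl; rewrite !Ez; unfold N0; simpl; f_equal; field; lra.
Qed.

(** * The Hadamard quotient *)

(** The power of [t] closes the family under differentiation: each [x]-derivative of the integrand
    brings out one more factor [t]. *)
Definition avg (j : nat) (G : R * R -> R) (p : R * R) : R :=
  RInt (fun t => t ^ j * G (t * fst p, snd p)) 0 1.

Lemma continuous_pow_fst j (h : R * R -> R) p :
  continuous h p -> continuous (fun q => h q ^ j) p.
Proof.
intros Hh; induction j as [|j IH]; simpl; [apply continuous_const|].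
apply continuous_Rmult; assumption.
Qed.

Lemma avg_continuous_2d j (G F1 F2 : R * R -> R) p :
  (forall q, continuous G q) -> continuous F1 p -> continuous F2 p ->
  continuous (fun q => snd q ^ j * G (F1 q, F2 q)) p.
Proof.
intros HG H1 H2; apply continuous_Rmult.
- apply continuous_pow_fst, continuous_snd.
- apply continuous_comp_pair; try assumption; apply HG.
Qed.

Lemma avg_integrable j (G : R * R -> R) (p : R * R) : (forall q, continuous G q) ->
  ex_RInt (fun t => t ^ j * G (t * fst p, snd p)) 0 1.
Proof.
intros HG; apply (ex_RInt_continuous (V := R_CompleteNormedModule)); intros t _.
apply (continuous_comp (fun t : R => (0, t))
  (fun q : R * R => snd q ^ j * G (snd q * fst p, snd p)) t).
- exact (continuous_slice true (0, 0) t).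
- apply (avg_continuous_2d j G (fun q => snd q * fst p) (fun _ => snd p)).
  + exact HG.
  + apply continuous_Rmult; [apply continuous_snd|apply continuous_const].
  + apply continuous_const.
Qed.

Lemma avg_bound j (G : R * R -> R) p B : (forall q, continuous G q) -> (forall q, Rabs (G q) <= B) ->
  Rabs (avg j G p) <= B.
Proof.
intros HG HB; rewrite <- (Rmult_1_l B), <- (Rminus_0_r 1).
apply abs_RInt_le_const; [lra|apply avg_integrable, HG|].
intros t Ht; rewrite Rabs_mult, <- (Rmult_1_l B); apply Rmult_le_compat;
  try apply Rabs_pos; [|apply HB].
rewrite Rabs_pos_eq by (apply pow_le; lra).
rewrite <- (pow1 j); apply pow_incr; lra.
Qed.

Lemma avg_continuous j (G : R * R -> R) p : (forall q, continuous G q) -> continuous (avg j G) p.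
Proof.
intros HG P [e He]; destruct p as [x0 y0].
pose proof (cond_pos e) as Hep.
assert (He2 : 0 < e / 2) by lra.
destruct (uniform_continuity_2d (fun x y => G (x, y)) (- (Rabs x0 + 1)) (Rabs x0 + 1)
  (y0 - 1) (y0 + 1)) with (eps := mkposreal _ He2) as [d Hd].
{ intros x y _ _; apply continuity_2d_pt_filterlim.
  change (continuous (fun z : R * R => G (fst z, snd z)) (x, y)).
  apply continuous_ext with (2 := HG (x, y)); intros [u v]; reflexivity. }
pose proof (cond_pos d) as Hdp.
assert (Hr : 0 < Rmin d 1) by (apply Rmin_glb_lt; lra).
exists (mkposreal _ Hr); intros [x y] Hq; apply ball_pair_inv in Hq; simpl in Hq.
destruct Hq as [Hx Hy]; pose proof (Rmin_l d 1); pose proof (Rmin_r d 1).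
apply He; change (Rabs (avg j G (x, y) - avg j G (x0, y0)) < e); unfold avg.
pose proof (avg_integrable j G (x, y) HG) as I1.
pose proof (avg_integrable j G (x0, y0) HG) as I2; simpl in I1, I2 |- *.
pose proof (RInt_minus _ _ _ _ I1 I2) as E; unfold minus, plus, opp in E; simpl in E.
unfold Rminus; rewrite <- E.
apply Rle_lt_trans with ((1 - 0) * (e / 2)); [|lra].
apply abs_RInt_le_const; [lra|exact (ex_RInt_minus _ _ _ _ I1 I2)|].
intros t Ht.
change (Rabs (t ^ j * G (t * x, y) + - (t ^ j * G (t * x0, y0))) <= e / 2).
replace (t ^ j * G (t * x, y) + - (t ^ j * G (t * x0, y0)))
  with (t ^ j * (G (t * x, y) - G (t * x0, y0))) by ring.
rewrite Rabs_mult, <- (Rmult_1_l (e / 2)); apply Rmult_le_compat; try apply Rabs_pos.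
- rewrite Rabs_pos_eq by (apply pow_le; lra); rewrite <- (pow1 j); apply pow_incr; lra.
- assert (Hb : forall z, Rabs z < Rabs x0 + 1 -> - (Rabs x0 + 1) <= t * z <= Rabs x0 + 1).
  { intros z Hz; apply Rabs_le_between; rewrite Rabs_mult, (Rabs_pos_eq t) by lra.
    pose proof (Rabs_pos z); nra. }
  pose proof (Rabs_triang_inv x x0).
  apply Rabs_def2 in Hy as Hy'.
  left; apply (Hd (t * x0) y0 (t * x) y); try lra.
  + apply Hb; lra.
  + apply Hb; lra.
  + replace (t * x - t * x0) with (t * (x - x0)) by ring.
    rewrite Rabs_mult, (Rabs_pos_eq t) by lra; pose proof (Rabs_pos (x - x0)); nra.
Qed.

Lemma avg_is_pd k j G b p : CW (S k) plane None G ->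
  is_pd b (avg j G) p (avg (if b then j else S j) (pd b G) p).
Proof.
intros HG.
assert (HGc : forall q, continuous G q) by (intros q; exact (CW_cont q HG I)).
assert (HGd : forall q, continuous (pd b G) q)
  by (intros q; exact (CW_cont q (CW_pd_flat b HG) I)).
set (q := fun u t : R => (t * fst (slice b p u), snd (slice b p u))).
assert (Hder : forall t u, is_derive (fun u => t ^ j * G (q u t)) u
  (t ^ (if b then j else S j) * pd b G (q u t))).
{ intros t u.
  assert (K : is_derive (fun u => G (q u t)) u ((if b then 1 else t) * pd b G (q u t))).
  { pose proof (CW_is_pd b (q u t) HG I) as K; unfold is_pd in K.
    destruct b; simpl in *.
    - apply (is_derive_eq _ _ _ _ K); unfold q; simpl; ring.
    - pose proof (is_derive_comp (fun s => G (s, snd p)) (fun u => t * u) u _ t K) as K'.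
      apply K'.
      apply (is_derive_eq _ _ (t * 1)); [|ring].
      exact (is_derive_scal _ _ _ _ (is_derive_id _)). }
  apply (is_derive_eq _ _ (t ^ j * ((if b then 1 else t) * pd b G (q u t)))).
  - exact (is_derive_scal _ _ _ _ K).
  - destruct b; simpl; ring. }
assert (HR : avg (if b then j else S j) (pd b G) p =
  RInt (fun t => Derive (fun u => t ^ j * G (q u t)) (coord b p)) 0 1).
{ apply RInt_ext; intros t _.
  transitivity (t ^ (if b then j else S j) * pd b G (q (coord b p) t));
    [unfold q; rewrite slice_coord; reflexivity|symmetry; apply is_derive_unique, Hder]. }
rewrite HR.
apply (is_derive_RInt_param (fun u t => t ^ j * G (q u t))).
- apply filter_forall; intros u t _; eexists; apply Hder.
- intros t _; apply continuity_2d_pt_filterlim.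
  apply continuous_ext with (fun z : R * R =>
    snd z ^ (if b then j else S j) * pd b G (q (fst z) (snd z))).
  { intros [u v]; symmetry; apply is_derive_unique, Hder. }
  apply (avg_continuous_2d _ (pd b G) (fun z => snd z * fst (slice b p (fst z)))
    (fun z => snd (slice b p (fst z)))).
  + exact HGd.
  + apply continuous_Rmult; [apply continuous_snd|].
    destruct b; simpl; [apply continuous_const|apply continuous_fst].
  + destruct b; simpl; [apply continuous_fst|apply continuous_const].
- apply filter_forall; intros u; apply avg_integrable, HGc.
Qed.

Lemma CW_avg k j G : CW k plane None G -> CW k plane None (avg j G).
Proof.
revert j G; induction k as [|k IH]; intros j G HG.
all: assert (Hc : forall p, continuous (avg j G) p)
  by (intros p; apply avg_continuous; intros q; exact (CW_cont q HG I)).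
- split; [intros; apply Hc|]; split; exact I.
- apply CW_intro with (d := fun b : bool => avg (if b then j else S j) (pd b G)).
  + auto.
  + intros; apply Hc.
  + exact I.
  + intros b p _; exact (avg_is_pd k j G b p HG).
  + apply IH; exact (CW_pd false HG).
  + apply IH; exact (CW_pd true HG).
Qed.

(** The fundamental theorem of calculus along the segment from [(0, y)] to [(x, y)]. *)
Lemma hadamard k g p : CW (S k) plane None g -> (forall y, g (0, y) = 0) ->
  g p = fst p * avg 0 (pd false g) p.
Proof.
intros Hg H0; destruct p as [x y].
assert (Hc : forall q, continuous (pd false g) q)
  by (intros q; exact (CW_cont q (CW_pd false Hg) I)).
assert (HI : is_RInt (fun t => x * (t ^ 0 * pd false g (t * x, y))) 0 1 (g (1 * x, y) - g (0 * x, y))).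
{ apply (is_RInt_derive (V := R_CompleteNormedModule) (fun t => g (t * x, y))).
  - intros t _.
    pose proof (is_derive_comp (fun s => g (s, y)) (fun u => u * x) t (pd false g (t * x, y)) x) as K.
    apply (is_derive_eq _ _ (x * pd false g (t * x, y))); [|simpl; ring].
    apply K.
    + exact (CW_is_pd false (t * x, y) Hg I).
    + apply (is_derive_eq _ _ (1 * x)); [|ring].
      apply is_derive_Reals, derivable_pt_lim_ext with (fun u => x * u).
      * intros; ring.
      * rewrite Rmult_1_l, <- (Rmult_1_r x) at 1.
        apply derivable_pt_lim_scal, derivable_pt_lim_id.
  - intros t _; apply continuous_ext with (fun t => x * pd false g (t * x, y));
      [intros; simpl; ring|].
    apply (continuous_comp (fun t : R => (t, 0)) (fun q : R * R => x * pd false g (fst q * x, y)) t).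
    + exact (continuous_slice false (0, 0) t).
    + apply continuous_Rmult; [apply continuous_const|].
      apply (continuous_comp_pair (pd false g) (fun q => fst q * x) (fun _ => y)); [apply Hc| |].
      * apply continuous_Rmult; [apply continuous_fst|apply continuous_const].
      * apply continuous_const. }
apply (is_RInt_unique (V := R_CompleteNormedModule)) in HI.
assert (HI2 : RInt (fun t => x * (t ^ 0 * pd false g (t * x, y))) 0 1
  = x * avg 0 (pd false g) (x, y))
  by exact (RInt_scal _ _ _ x (avg_integrable 0 (pd false g) (x, y) Hc)).
rewrite HI2, Rmult_0_l, Rmult_1_l, H0, Rminus_0_r in HI; symmetry; exact HI.
Qed.

(** * Linear systems over a linear contraction *)

Lemma is_derive_div (a x : R) : is_derive (fun t => t / a) x (/ a).
Proof.
apply (is_derive_eq _ _ (1 * / a)); [|ring].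
exact (is_derive_scal_l (fun t => t) x 1 (/ a) (is_derive_id x)).
Qed.

Lemma is_pd_div b (a : R) (p : R * R) : is_pd b (fun q => fst q / a) p (if b then 0 else / a).
Proof. destruct b; [exact (is_derive_cst (fst p / a) (snd p))|exact (is_derive_div a (fst p))]. Qed.

(** [functional_equation] for the map [(x / sig, 0)], with [lam = 1 / |sig|], [s = 1] and [eps = 0].
    As [s = 1], the rate is [theta / |sig|] for every [n], so the order of smoothness is not limited
    by the rate. Functions of one variable are viewed as functions on the strip. *)
Lemma contracting_system sig theta n (q : bool -> bool -> R * R -> R) (m : bool -> R * R -> R) :
  1 < Rabs sig -> 0 <= theta < Rabs sig -> (forall j i, CW n strip (Some false) (q j i)) ->
  (forall j p, strip p -> Rabs (q j false p) + Rabs (q j true p) <= theta) ->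
  (forall j, CW n strip (Some true) (m j)) ->
  exists w : bool -> R * R -> R, (forall j, CW n strip (Some true) (w j)) /\
    forall j p, strip p ->
      w j p = q j false p * w false (fst p / sig, 0) + q j true p * w true (fst p / sig, 0) + m j p.
Proof.
intros Hsig Hth Hq Hqb Hm.
assert (Hs1 : 0 < / Rabs sig) by (apply Rinv_0_lt_compat; lra).
assert (Hs2 : / Rabs sig * Rabs sig = 1) by (apply Rinv_l; lra).
apply (functional_equation (fun p => fst p / sig) (fun _ => 0) q m n (/ Rabs sig) 1 0 theta);
  try assumption; try lra; try nra.
- rewrite pow1; nra.
- intros b p _; eexists; apply is_pd_div.
- intros b p _; exists 0; apply is_pd_const.
- intros; apply continuous_Rmult; [apply continuous_fst|apply continuous_const].
- intros; apply continuous_const.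
- intros b; apply CW_ext with (fun _ => if b then 0 else / sig); [auto| |].
  + intros p _; symmetry; apply is_pd_unique, is_pd_div.
  + destruct b; [apply CW_0|exact (CW_const _ _ (Some false) _)].
- intros b; apply CW_ext with (fun _ => 0); [auto| |apply CW_0].
  intros p _; symmetry; apply is_pd_unique, is_pd_const.
- intros p _; unfold Rdiv; rewrite Rabs_mult, Rabs_inv; lra.
- intros p _; rewrite (is_pd_unique (is_pd_div false sig p)).
  rewrite (is_pd_unique (is_pd_const false 0 p)), Rabs_R0, Rabs_inv; lra.
- intros p _; rewrite (is_pd_unique (is_pd_div true sig p)).
  rewrite (is_pd_unique (is_pd_const true 0 p)), Rabs_R0; lra.
- intros p _; rewrite (is_pd_unique (is_pd_div true sig p)), Rabs_R0; lra.
Qed.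

(** * The unstable manifold *)

Lemma CW_fst_strip k : CW k strip (Some false) fst.
Proof.
assert (Hb : wbound (Some false) strip fst)
  by (exists 1; intros p Hp; unfold strip in Hp; simpl; lra).
destruct k as [|k].
- split; [intros; apply continuous_fst|]; split; [exact Hb|exact I].
- apply CW_intro with (d := fun (b : bool) _ => if b then 0 else 1).
  + auto.
  + intros; apply continuous_fst.
  + exact Hb.
  + intros b p _; apply is_pd_fst.
  + exact (CW_const _ _ (Some false) _).
  + apply CW_0.
Qed.

Section UnstableCurve.

Variables (N : bool -> R * R -> R) (lam sig e : R) (r : nat).
Let mu (j : bool) : R := if j then sig else lam.

Hypothesis lam_small : Rabs lam <= 1.
Hypothesis sig_big : 1 < Rabs sig.
Hypothesis e_pos : 0 < e <= 1.
Hypothesis e_small1 : 1 + 16 * e <= Rabs sig.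
Hypothesis e_small2 : Rabs sig + 10 * e < Rabs sig * Rabs sig.
Hypothesis N_smooth : forall j, CW (S (S r)) plane (Some false) (N j).
Hypothesis N_0 : forall j, N j (0, 0) = 0.
Hypothesis dN_0 : forall i j, pd i (N j) (0, 0) = 0.
Hypothesis dN_small : forall i j p, Rabs (pd i (N j) p) <= e.
Hypothesis ddN_small : forall a i j p, Rabs (pd a (pd i (N j)) p) <= e.

Let f (j : bool) (p : R * R) : R := mu j * coord j p + N j p.
Let df (j i : bool) (p : R * R) : R := mu j * delta i j + pd i (N j) p.
Let c (p : R * R) : R * R := (fst p / sig, 0).

Let s := Rabs sig.

Lemma mu_le j : Rabs (mu j) <= s.
Proof. destruct j; simpl; unfold s; lra. Qed.

Lemma sig_neq0 : sig <> 0.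
Proof. intros E; rewrite E, Rabs_R0 in sig_big; lra. Qed.

Lemma c_fst p : Rabs (fst (c p)) = Rabs (fst p) / s.
Proof. unfold c, s; simpl; unfold Rdiv; rewrite Rabs_mult, Rabs_inv; reflexivity. Qed.

Lemma c_le p : Rabs (fst (c p)) <= Rabs (fst p).
Proof.
rewrite c_fst; apply Rmult_le_reg_r with s; [unfold s; lra|].
unfold Rdiv; rewrite Rmult_assoc, Rinv_l by (unfold s; lra).
pose proof (Rabs_pos (fst p)); unfold s; nra.
Qed.

Lemma c_strip p : strip p -> strip (c p).
Proof. unfold strip; intros Hp; pose proof (c_le p); lra. Qed.

Lemma N_lip j p q : Rabs (N j q - N j p) <= e * (Rabs (fst q - fst p) + Rabs (snd q - snd p)).
Proof.
apply pd_lipschitz; [|intros; apply dN_small].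
intros b z; exact (CW_ex_pd b z (N_smooth j) I).
Qed.

Lemma dN_lip i j p q :
  Rabs (pd i (N j) q - pd i (N j) p) <= e * (Rabs (fst q - fst p) + Rabs (snd q - snd p)).
Proof.
apply pd_lipschitz; [|intros; apply ddN_small].
intros b z; exact (CW_ex_pd b z (CW_pd_flat i (N_smooth j)) I).
Qed.

Lemma dN_le i j p : Rabs (pd i (N j) p) <= e * (Rabs (fst p) + Rabs (snd p)).
Proof. pose proof (dN_lip i j (0, 0) p) as H; simpl in H; rewrite dN_0, !Rminus_0_r in H; exact H. Qed.

Lemma f_pd j i p : is_pd i (f j) p (df j i p).
Proof.
exact (is_pd_plus (is_pd_scal _ _ _ _ _ (coord_is_pd i j p)) (CW_is_pd i p (N_smooth j) I)).
Qed.

Lemma df_smooth j i : CW (S r) plane None (df j i).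
Proof.
apply CW_plus; [auto|exact (CW_const _ _ None _)|].
exact (CW_None (CW_pd_flat i (N_smooth j))).
Qed.

Lemma f_dif j p : dif (f j) p (df j false p) (df j true p).
Proof.
apply (dif_of_C1 plane (f j) (df j false) (df j true)); try exact I;
  [auto|intros; apply f_pd|apply f_pd|].
exact (CW_cont p (df_smooth j false) I).
Qed.

Lemma df_le j i p : Rabs (df j i p) <= s * delta i j + e.
Proof.
unfold df; eapply Rle_trans; [apply Rabs_triang|]; apply Rplus_le_compat; [|apply dN_small].
rewrite Rabs_mult; unfold delta; destruct (Bool.eqb i j).
- rewrite Rabs_R1; pose proof (mu_le j); lra.
- rewrite Rabs_R0; lra.
Qed.

Lemma df_row j p : Rabs (df j false p) + Rabs (df j true p) <= s + 2 * e.
Proof.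
pose proof (df_le j false p); pose proof (df_le j true p).
unfold delta in *; destruct j; simpl in *; lra.
Qed.

(** The first Boolean separates the curve [K] ([false]) from its derivative [V] ([true]), the second
    selects a component. The equations are [K(t) = f(K(t / sig))] and its derivative
    [V(t) = Df(K(t / sig)) V(t / sig) / sig], iterated together so that the limit is
    differentiable. *)
Let X := ((bool * bool) * (R * R))%type.
Let Kc (u : X -> R) (p : R * R) : R * R := (u ((false, false), p), u ((false, true), p)).
Let T (u : X -> R) (x : X) : R :=
  let j := snd (fst x) in let q := c (snd x) in
  if fst (fst x) then
    / sig * (df j false (Kc u q) * u ((true, false), q) + df j true (Kc u q) * u ((true, true), q))
  else f j (Kc u q).
(** The last condition makes the curve tangent to the unstable direction at unit speed, which also
    removes the freedom of rescaling the parameter. It puts any two candidates at distance [O(t)] in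
    [V] and [O(t^2)] in [K]. *)
Let P (u : X -> R) : Prop :=
  (forall o j p, strip p -> continuous (fun p => u ((o, j), p)) p) /\
  (forall j p, strip p -> is_pd false (fun p => u ((false, j), p)) p (u ((true, j), p))) /\
  (forall j y, u ((false, j), (0, y)) = 0) /\
  (forall j p, strip p -> Rabs (u ((true, j), p) - delta true j) <= Rabs (fst p)).
(** In the unstable direction [f] multiplies differences of [K] by about [|sig|]. The quadratic
    weight gains [|sig|^(-2)] from the substitution [t / sig] and leaves a net contraction; for [V],
    the factor [1 / sig] in its equation and the linear weight do the same. *)
Let om (x : X) : R :=
  if fst (fst x) then Rabs (fst (snd x)) else Rabs (fst (snd x)) * Rabs (fst (snd x)).

Lemma P_V u j p : P u -> strip p -> Rabs (u ((true, j), p)) <= 2.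
Proof.
intros [_ [_ [_ Hu]]] Hp; specialize (Hu j p Hp); unfold strip in Hp.
pose proof (Rabs_triang_inv (u ((true, j), p)) (delta true j)) as H.
assert (Rabs (delta true j) <= 1) by (destruct j; unfold delta; simpl; rewrite ?Rabs_R0, ?Rabs_R1; lra).
lra.
Qed.

Lemma P_K u j p : P u -> strip p -> Rabs (u ((false, j), p)) <= 2 * Rabs (fst p).
Proof.
intros Hu Hp; pose proof Hu as [_ [H1 [H2 _]]].
apply (vanish_bound (fun p => u ((false, j), p))); try assumption.
- intros q Hq; exact (is_pd_ex _ _ _ _ (H1 j q Hq)).
- intros q Hq; rewrite (is_pd_unique (H1 j q Hq)); apply P_V; assumption.
- apply H2.
Qed.

Lemma continuous_c p : continuous c p.
Proof.
apply continuous_pair; [|apply continuous_const].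
apply continuous_Rmult; [apply continuous_fst|apply continuous_const].
Qed.

(** For the last clause, put [z = |t| / s]. The linear part of [f] fixes the vector [delta true]
    after division by [sig] and does not increase deviations from it, which gives [z]; the
    derivatives of [N] at [K], of size at most [4 e z], applied to vectors with entries at most 2,
    add [16 e z]. [e_small1] makes the sum at most [|t|]. *)
Lemma T_P u : P u -> P (T u).
Proof.
intros Hu; pose proof Hu as [Hc [Hd [H0 HV]]].
assert (Hcc : forall o j p, strip p -> continuous (fun p => u ((o, j), c p)) p).
{ intros o j p Hp; apply (continuous_comp c (fun p => u ((o, j), p)));
    [apply continuous_c|apply Hc, c_strip, Hp]. }
assert (HK : forall (g : R * R -> R) p, (forall q, continuous g q) -> strip p ->
  continuous (fun p => g (Kc u (c p))) p).
{ intros g p Hg Hp; apply (continuous_comp_pair g (fun p => u ((false, false), c p))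
    (fun p => u ((false, true), c p))); [apply Hg| |]; apply Hcc, Hp. }
split; [|split; [|split]].
- intros o j p Hp; destruct o; unfold T; simpl.
  + apply continuous_Rmult; [apply continuous_const|].
    assert (Hdf : forall i, continuous (fun p => df j i (Kc u (c p))) p)
      by (intros i; apply HK; [intros q; exact (CW_cont q (df_smooth j i) I)|exact Hp]).
    apply (continuous_Rplus (fun p => df j false (Kc u (c p)) * u ((true, false), c p))
      (fun p => df j true (Kc u (c p)) * u ((true, true), c p)));
      (apply continuous_Rmult; [apply Hdf|apply Hcc, Hp]).
  + apply HK; [|exact Hp]; intros q; unfold f.
    apply continuous_Rplus; [|exact (CW_cont q (N_smooth j) I)].
    apply continuous_Rmult; [apply continuous_const|exact (CW_cont q (CW_coord 0 plane j) I)].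
- intros j p Hp; unfold T; simpl.
  assert (Hi : forall i, is_pd false (fun p => u ((false, i), c p)) p (/ sig * u ((true, i), c p))).
  { intros i; pose proof (Hd i (c p) (c_strip p Hp)) as K; unfold is_pd in K |- *.
    pose proof (is_derive_comp (fun t => u ((false, i), (t, 0))) (fun t => t / sig) (fst p) _
      (/ sig) K) as K'.
    apply K'.
    apply is_derive_div. }
  pose proof (is_pd_comp false (f j) (fun p => u ((false, false), c p))
    (fun p => u ((false, true), c p)) p _ _ _ _ (f_dif j _) (Hi false) (Hi true)) as K.
  apply (is_pd_eq _ K); unfold Kc; ring.
- intros j y; unfold T, Kc, c; simpl.
  unfold Rdiv; rewrite Rmult_0_l, !H0; unfold f; rewrite N_0; destruct j; simpl; ring.
- intros j p Hp; unfold T; simpl.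
  pose proof (c_strip p Hp) as Hq.
  pose proof (P_V u false (c p) Hu Hq) as V1; pose proof (P_V u true (c p) Hu Hq) as V2.
  pose proof (P_K u false (c p) Hu Hq) as K1; pose proof (P_K u true (c p) Hu Hq) as K2.
  set (z := Rabs (fst (c p))) in *; assert (Hz : 0 <= z) by apply Rabs_pos.
  pose proof (HV j (c p) Hq) as HVj; fold z in HVj.
  set (n1 := pd false (N j) (Kc u (c p))) in *; set (n2 := pd true (N j) (Kc u (c p))) in *.
  assert (HKc : Rabs (fst (Kc u (c p))) + Rabs (snd (Kc u (c p))) <= 4 * z)
    by (unfold Kc; simpl; lra).
  assert (B1 : Rabs n1 <= 4 * e * z)
    by (apply Rle_trans with (1 := dN_le false j (Kc u (c p))); nra).
  assert (B2 : Rabs n2 <= 4 * e * z)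
    by (apply Rle_trans with (1 := dN_le true j (Kc u (c p))); nra).
  assert (E : / sig * (df j false (Kc u (c p)) * u ((true, false), c p)
      + df j true (Kc u (c p)) * u ((true, true), c p)) - delta true j
    = (mu j / sig) * (u ((true, j), c p) - delta true j)
      + / sig * (n1 * u ((true, false), c p) + n2 * u ((true, true), c p))).
  { unfold df; fold n1 n2; unfold delta, mu; destruct j; simpl; field; apply sig_neq0. }
  rewrite E; eapply Rle_trans; [apply Rabs_triang|].
  assert (Hs1 : 0 < / s) by (apply Rinv_0_lt_compat; unfold s; lra).
  assert (Hs2 : / s * s = 1) by (apply Rinv_l; unfold s; lra).
  assert (A1 : Rabs (mu j / sig * (u ((true, j), c p) - delta true j)) <= z).
  { rewrite Rabs_mult; unfold Rdiv; rewrite Rabs_mult, Rabs_inv; fold s.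
    pose proof (mu_le j); pose proof (Rabs_pos (mu j)).
    assert (Rabs (mu j) * / s <= 1) by nra.
    assert (0 <= Rabs (mu j) * / s) by (apply Rmult_le_pos; lra).
    pose proof (Rabs_pos (u ((true, j), c p) - delta true j)); nra. }
  assert (A2 : Rabs (/ sig * (n1 * u ((true, false), c p) + n2 * u ((true, true), c p)))
    <= 16 * e * z).
  { rewrite Rabs_mult, Rabs_inv; fold s.
    assert (Hpr : forall n v, Rabs n <= 4 * e * z -> Rabs v <= 2 -> Rabs (n * v) <= 8 * e * z).
    { intros n v Hn Hv; rewrite Rabs_mult.
      replace (8 * e * z) with (4 * e * z * 2) by ring.
      apply Rmult_le_compat; try apply Rabs_pos; assumption. }
    pose proof (Hpr _ _ B1 V1); pose proof (Hpr _ _ B2 V2).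
    pose proof (Rabs_triang (n1 * u ((true, false), c p)) (n2 * u ((true, true), c p))) as Ht.
    pose proof (Rabs_pos (n1 * u ((true, false), c p) + n2 * u ((true, true), c p))).
    assert (/ s <= 1) by (rewrite <- Rinv_1; apply Rinv_le_contravar; unfold s; lra).
    nra. }
  assert (Ez : z * s = Rabs (fst p)) by (unfold z; rewrite c_fst; field; unfold s; lra).
  assert (z * (1 + 16 * e) <= z * s) by (apply Rmult_le_compat_l; [exact Hz|exact e_small1]).
  lra.
Qed.

(** For [V], the row sum of [Df] gives [s + 2 e], and the variation of [Df], through second
    derivatives of [N], gives [8 e]; one factor [1 / s] stands in the equation and another comes
    from the weight. For [K], the bound [(s + 2 e) / s^2] is smaller. *)
Let rho := (s + 10 * e) / (s * s).

Lemma rho_bound : 0 <= rho < 1.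
Proof.
assert (Hs : 1 < s) by exact sig_big.
assert (Hss : 0 < s * s) by nra.
split; unfold rho; [apply Rdiv_le_0_compat; lra|].
apply Rmult_lt_reg_r with (s * s); [exact Hss|].
unfold Rdiv; rewrite Rmult_assoc, Rinv_l, Rmult_1_r, Rmult_1_l by lra; exact e_small2.
Qed.

Lemma T_contraction u v K : 0 <= K -> P u -> P v ->
  (forall x, strip (snd x) -> Rabs (u x - v x) <= K * om x) ->
  forall x, strip (snd x) -> Rabs (T u x - T v x) <= rho * K * om x.
Proof.
intros HK Hu Hv Huv [[o j] p] Hp; simpl in Hp.
assert (Hs : 1 < s) by exact sig_big.
assert (Hrho : rho * (s * s) = s + 10 * e) by (unfold rho; field; lra).
pose proof (c_strip p Hp) as Hq.
set (z := Rabs (fst (c p))) in *; assert (Hz : 0 <= z) by apply Rabs_pos.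
assert (Ez : Rabs (fst p) = s * z) by (unfold z; rewrite c_fst; field; lra).
assert (Hz1 : z <= 1) by (unfold strip in Hq; fold z in Hq; lra).
assert (D : forall i, Rabs (u ((false, i), c p) - v ((false, i), c p)) <= K * (z * z))
  by (intros i; exact (Huv ((false, i), c p) Hq)).
assert (D' : forall i, Rabs (u ((true, i), c p) - v ((true, i), c p)) <= K * z)
  by (intros i; exact (Huv ((true, i), c p) Hq)).
pose proof (D false) as D1; pose proof (D true) as D2.
unfold T, om; simpl fst; simpl snd.
destruct o; simpl.
- pose proof (D' false) as D3; pose proof (D' true) as D4.
  pose proof (P_V v false (c p) Hv Hq) as V1; pose proof (P_V v true (c p) Hv Hq) as V2.
  pose proof (df_row j (Kc u (c p))) as Hrow.
  assert (HL : forall i, Rabs (df j i (Kc u (c p)) - df j i (Kc v (c p))) <= 2 * e * (K * (z * z))).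
  { intros i; unfold df.
    replace (mu j * delta i j + pd i (N j) (Kc u (c p)) - (mu j * delta i j + pd i (N j) (Kc v (c p))))
      with (pd i (N j) (Kc u (c p)) - pd i (N j) (Kc v (c p))) by ring.
    eapply Rle_trans; [apply dN_lip|]; unfold Kc, fst, snd.
    replace (2 * e * (K * (z * z))) with (e * (2 * (K * (z * z)))) by ring.
    apply Rmult_le_compat_l; lra. }
  set (a1 := df j false (Kc u (c p))) in *; set (a2 := df j true (Kc u (c p))) in *.
  set (b1 := df j false (Kc v (c p))) in *; set (b2 := df j true (Kc v (c p))) in *.
  set (u1 := u ((true, false), c p)) in *; set (u2 := u ((true, true), c p)) in *.
  set (v1 := v ((true, false), c p)) in *; set (v2 := v ((true, true), c p)) in *.
  replace (/ sig * (a1 * u1 + a2 * u2) - / sig * (b1 * v1 + b2 * v2))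
    with (/ sig * ((a1 * (u1 - v1) + a2 * (u2 - v2)) + ((a1 - b1) * v1 + (a2 - b2) * v2))) by ring.
  rewrite Rabs_mult, Rabs_inv; fold s.
  apply Rmult_le_reg_l with s; [lra|]; rewrite <- Rmult_assoc, Rinv_r, Rmult_1_l, Ez by lra.
  replace (s * (rho * K * (s * z))) with (rho * (s * s) * (K * z)) by ring; rewrite Hrho.
  assert (HKz : 0 <= K * z) by (apply Rmult_le_pos; assumption).
  assert (G1 : Rabs (a1 * (u1 - v1) + a2 * (u2 - v2)) <= (s + 2 * e) * (K * z)).
  { eapply Rle_trans; [apply Rabs_triang|]; rewrite !Rabs_mult.
    apply Rle_trans with (Rabs a1 * (K * z) + Rabs a2 * (K * z)).
    - apply Rplus_le_compat; apply Rmult_le_compat_l; try apply Rabs_pos; assumption.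
    - rewrite <- Rmult_plus_distr_r; apply Rmult_le_compat_r; assumption. }
  assert (G2 : Rabs ((a1 - b1) * v1 + (a2 - b2) * v2) <= 8 * e * (K * z)).
  { eapply Rle_trans; [apply Rabs_triang|]; rewrite !Rabs_mult.
    assert (H : forall d v, Rabs d <= 2 * e * (K * (z * z)) -> Rabs v <= 2 ->
      Rabs d * Rabs v <= 4 * e * (K * z)).
    { intros d w Hd Hw; apply Rle_trans with (2 * e * (K * (z * z)) * 2).
      - apply Rmult_le_compat; try apply Rabs_pos; assumption.
      - replace (2 * e * (K * (z * z)) * 2) with (4 * e * (K * z) * z) by ring.
        rewrite <- (Rmult_1_r (4 * e * (K * z))) at 2; apply Rmult_le_compat_l; [|exact Hz1].
        apply Rmult_le_pos; lra. }
    pose proof (H (a1 - b1) v1 (HL false) V1); pose proof (H (a2 - b2) v2 (HL true) V2); lra. }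
  eapply Rle_trans; [apply Rabs_triang|]; lra.
- unfold f.
  replace (mu j * coord j (Kc u (c p)) + N j (Kc u (c p))
    - (mu j * coord j (Kc v (c p)) + N j (Kc v (c p))))
    with (mu j * (coord j (Kc u (c p)) - coord j (Kc v (c p)))
      + (N j (Kc u (c p)) - N j (Kc v (c p)))) by ring.
  eapply Rle_trans; [apply Rabs_triang|].
  pose proof (N_lip j (Kc v (c p)) (Kc u (c p))) as HN; simpl in HN.
  assert (H1 : Rabs (coord j (Kc u (c p)) - coord j (Kc v (c p))) <= K * (z * z))
    by (destruct j; assumption).
  rewrite Rabs_mult; pose proof (mu_le j).
  assert (Rabs (mu j) * Rabs (coord j (Kc u (c p)) - coord j (Kc v (c p))) <= s * (K * (z * z)))
    by (apply Rmult_le_compat; try apply Rabs_pos; assumption).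
  rewrite Ez; replace (rho * K * (s * z * (s * z))) with (rho * (s * s) * (K * (z * z))) by ring.
  rewrite Hrho; assert (0 <= K * (z * z)) by (apply Rmult_le_pos; [exact HK|nra]); nra.
Qed.

Let Q (j i : bool) (KK : bool -> R * R -> R) (p : R * R) : R :=
  / sig * df j i (KK false (c p), KK true (c p)).

(** Each iteration of the equation gains [rho]: the coefficients have row sums at most [rho * s] and
    [|x|] shrinks by [s]. This identifies the derivative of the curve with the smooth solution
    produced by [contracting_system]. *)
Lemma linear_uniqueness (q : bool -> bool -> R * R -> R) (D : bool -> R * R -> R) A :
  (forall j p, strip p -> Rabs (q j false p) + Rabs (q j true p) <= rho * s) ->
  (forall j p, strip p -> D j p = q j false p * D false (c p) + q j true p * D true (c p)) ->
  (forall j p, strip p -> Rabs (D j p) <= A * Rabs (fst p)) ->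
  forall j p, strip p -> D j p = 0.
Proof.
intros Hq HD HA j p Hp.
assert (Hs : 1 < s) by exact sig_big.
pose proof rho_bound as Hrho.
assert (H : forall n j p, strip p -> Rabs (D j p) <= A * rho ^ n * Rabs (fst p)).
{ induction n as [|n IH]; intros j' p' Hp'.
  - rewrite pow_O, Rmult_1_r; apply HA, Hp'.
  - rewrite (HD j' p' Hp'); eapply Rle_trans; [apply Rabs_triang|]; rewrite !Rabs_mult.
    pose proof (IH false _ (c_strip p' Hp')) as K1; pose proof (IH true _ (c_strip p' Hp')) as K2.
    set (B := A * rho ^ n * Rabs (fst (c p'))) in *.
    assert (HB : 0 <= B) by (pose proof (Rabs_pos (D false (c p'))); lra).
    apply Rle_trans with ((Rabs (q j' false p') + Rabs (q j' true p')) * B).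
    + rewrite Rmult_plus_distr_r; apply Rplus_le_compat; apply Rmult_le_compat_l;
        try apply Rabs_pos; assumption.
    + apply Rle_trans with (rho * s * B); [apply Rmult_le_compat_r; [exact HB|apply Hq, Hp']|].
      unfold B; rewrite c_fst; apply Req_le; simpl; field; lra. }
assert (HA0 : 0 <= A * Rabs (fst p))
  by (specialize (HA j p Hp); pose proof (Rabs_pos (D j p)); lra).
destruct (Req_dec (D j p) 0) as [E|E]; [exact E|exfalso].
apply Rabs_pos_lt in E.
destruct (pow_small rho (Rabs (D j p) / (2 * (A * Rabs (fst p) + 1)))) as [n Hn];
  [exact Hrho|apply Rdiv_lt_0_compat; lra|].
specialize (Hn n (le_n _)); specialize (H n j p Hp).
assert (A * Rabs (fst p) * rho ^ n <= (A * Rabs (fst p) + 1) *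
  (Rabs (D j p) / (2 * (A * Rabs (fst p) + 1)))).
{ apply Rmult_le_compat; try lra; apply pow_le; lra. }
replace ((A * Rabs (fst p) + 1) * (Rabs (D j p) / (2 * (A * Rabs (fst p) + 1))))
  with (Rabs (D j p) / 2) in H0 by (field; lra).
lra.
Qed.

(* Smoothness is a bootstrap: the derivative of the curve [K] solves a linear equation
   whose coefficients are as smooth as [K], up to the smoothness of [df]. *)
Theorem unstable_curve : exists K : bool -> R * R -> R,
  (forall j, CW (S (S r)) strip (Some false) (K j)) /\
  (forall j, K j (0, 0) = 0) /\ (forall j, pd false (K j) (0, 0) = delta true j) /\
  (forall j p, strip p -> K j p = K j (fst p, 0)) /\
  (forall j p, strip p -> K j p = mu j * K j (c p) + N j (K false (c p), K true (c p))).
Proof.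
assert (Hs : 1 < s) by exact sig_big.
(* The starting curve is the unstable eigenline [t |-> (0, t)] with its constant velocity. *)
set (u0 := fun x : X => if fst (fst x) then delta true (snd (fst x))
  else if snd (fst x) then fst (snd x) else 0).
destruct (fixed_point X (fun x => strip (snd x)) om P T rho 1 u0) as [u [HPu [Hfix _]]].
- exact rho_bound.
- lra.
- intros [[o j] p] _; unfold om; simpl; pose proof (Rabs_pos (fst p)); destruct o; nra.
- split; [|split; [|split]].
  + intros [|] j p _; unfold u0; simpl; [apply continuous_const|].
    destruct j; [apply continuous_fst|apply continuous_const].
  + intros [|] p _; unfold u0; simpl; [exact (is_pd_fst false p)|exact (is_pd_const false 0 p)].
  + intros [|] y; reflexivity.
  + intros j p _; unfold u0; simpl; rewrite Rminus_diag, Rabs_R0; apply Rabs_pos.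
- exact T_P.
- intros; apply T_contraction; assumption.
- intros [[o j] p] Hp; simpl in Hp.
  set (z := Rabs (fst (c p))); assert (Hz : 0 <= z) by apply Rabs_pos.
  assert (Ez : Rabs (fst p) = s * z) by (unfold z; rewrite c_fst; field; lra).
  assert (EK : Kc u0 (c p) = (0, fst (c p))) by reflexivity.
  assert (Hd : forall i t, Rabs (pd i (N j) (0, t)) <= e * Rabs t).
  { intros i t; pose proof (dN_le i j (0, t)) as H; simpl in H; rewrite Rabs_R0, Rplus_0_l in H; exact H. }
  unfold T, om; simpl fst; simpl snd; rewrite EK; destruct o; rewrite Ez.
  + replace (/ sig * _ - _) with (/ sig * pd true (N j) (0, fst (c p))).
    * rewrite Rabs_mult, Rabs_inv; fold s; pose proof (Hd true (fst (c p))) as H; fold z in H.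
      assert (Hs1 : / s <= 1) by (rewrite <- Rinv_1; apply Rinv_le_contravar; lra).
      assert (0 < / s) by (apply Rinv_0_lt_compat; lra).
      pose proof (Rabs_pos (pd true (N j) (0, fst (c p)))); nra.
    * unfold u0, df, delta, mu; destruct j; simpl; field; exact sig_neq0.
  + replace (f j (0, fst (c p)) - _) with (N j (0, fst (c p))).
    * pose proof (pd_mean_value true (N j) (0, 0) 0 (fst (c p)) (e * z)) as H.
      simpl in H; rewrite N_0, !Rminus_0_r in H; fold z in H.
      assert (H' : Rabs (N j (0, fst p / sig)) <= e * z * z).
      { apply H; intros t Ht; exists (pd true (N j) (0, t)); split.
        - exact (CW_is_pd true (0, t) (N_smooth j) I).
        - apply Rle_trans with (1 := Hd true t); apply Rmult_le_compat_l; [lra|].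
          unfold z; simpl; unfold Rmin, Rmax in Ht; destruct (Rle_dec 0 (fst p / sig)).
          + rewrite !Rabs_pos_eq; lra.
          + rewrite !Rabs_left1; lra. }
      apply Rle_trans with (1 := H').
      assert (e * (z * z) <= s * s * (z * z)) by (apply Rmult_le_compat_r; nra); simpl; nra.
    * unfold u0, f, mu; destruct j; simpl; field; exact sig_neq0.
- intros un u Hun Hlim.
  assert (Hunif : forall o j, unif _ strip (fun _ => 1) (fun k p => un k ((o, j), p))
    (fun p => u ((o, j), p))).
  { intros o j eps He; destruct (Hlim eps He) as [n Hn]; exists n; intros k p Hk Hp.
    eapply Rle_trans; [apply (Hn k ((o, j), p) Hk Hp)|].
    apply Rmult_le_compat_l; [lra|]; unfold om; simpl; unfold strip in Hp.
    pose proof (Rabs_pos (fst p)); destruct o; nra. }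
  split; [|split; [|split]].
  + intros o j p Hp; apply (continuous_unif strip (fun k p => un k ((o, j), p))).
    * auto.
    * apply Hunif.
    * intros k q Hq; apply (proj1 (Hun k)), Hq.
    * exact Hp.
  + intros j p Hp; apply (is_pd_unif strip false (fun k p => un k ((false, j), p))
      (fun k p => un k ((true, j), p)) (fun p => u ((false, j), p)) (fun p => u ((true, j), p))).
    * auto.
    * apply Hunif.
    * apply Hunif.
    * intros k q Hq; apply (proj1 (proj2 (Hun k))), Hq.
    * intros k q Hq; apply (proj1 (Hun k)), Hq.
    * exact Hp.
  + intros j y; destruct (Hlim 1 ltac:(lra)) as [n Hn].
    assert (Hy : strip (0, y)) by (unfold strip; simpl; rewrite Rabs_R0; lra).
    specialize (Hn n ((false, j), (0, y)) (le_n _) Hy).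
    rewrite (proj1 (proj2 (proj2 (Hun n)))) in Hn; unfold om in Hn; simpl in Hn.
    rewrite Rabs_R0, Rmult_0_l, Rmult_0_r in Hn.
    pose proof (Rabs_pos (0 - u ((false, j), (0, y)))).
    assert (E : 0 - u ((false, j), (0, y)) = 0) by (apply Rabs_eq_0; lra); lra.
  + intros j p Hp; apply Rnot_lt_le; intros Hlt.
    set (A := Rabs (u ((true, j), p) - delta true j)) in *.
    pose proof (Rabs_pos (fst p)) as Hx; unfold strip in Hp.
    destruct (Hlim ((A - Rabs (fst p)) / 2) ltac:(lra)) as [n Hn].
    specialize (Hn n ((true, j), p) (le_n _) Hp); unfold om in Hn; simpl in Hn.
    pose proof (proj2 (proj2 (proj2 (Hun n))) j p Hp) as H1.
    pose proof (Rabs_triang (- (un n ((true, j), p) - u ((true, j), p)))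
      (un n ((true, j), p) - delta true j)) as H2.
    rewrite Rabs_Ropp in H2.
    replace (- (un n ((true, j), p) - u ((true, j), p)) + (un n ((true, j), p) - delta true j))
      with (u ((true, j), p) - delta true j) in H2 by ring.
    fold A in H2; nra.
- set (K := fun j p => u ((false, j), p)); set (V := fun j p => u ((true, j), p)).
  pose proof HPu as [Hcont [Hder [HK0 HV]]].
  assert (EK : forall j p, strip p -> K j p = f j (K false (c p), K true (c p)))
    by (intros j p Hp; symmetry; exact (Hfix ((false, j), p) Hp)).
  assert (EV : forall j p, strip p ->
    V j p = Q j false K p * V false (c p) + Q j true K p * V true (c p)).
  { intros j p Hp; unfold V at 1; rewrite <- (Hfix ((true, j), p) Hp).
    unfold T, Q, Kc, K, V; simpl; ring. }
  assert (Hdep : forall j p, strip p -> K j p = K j (fst p, 0)).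
  { intros j p Hp; rewrite (EK j p Hp), (EK j (fst p, 0)) by exact Hp; reflexivity. }
  assert (Hc0 : forall y, c (0, y) = (0, 0))
    by (intros y; unfold c; simpl; f_equal; field; exact sig_neq0).
  assert (HK2 : forall j p, strip p -> is_pd true (K j) p 0).
  { intros j p Hp; apply is_pd_ext_loc with (fun q => K j (fst q, 0)).
    - apply (open_locally strip); [auto| |exact Hp].
      intros q Hq; symmetry; apply Hdep, Hq.
    - exact (is_derive_cst (K j (fst p, 0)) (snd p)). }
  assert (Hsm : forall k, (k <= S (S r))%nat -> forall j, CW k strip (Some false) (K j)).
  { induction k as [|k IH]; intros Hk j.
    all: assert (Hb : wbound (Some false) strip (K j))
      by (exists 2; intros p Hp; simpl; pose proof (P_K u j p HPu Hp); unfold strip in Hp;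
          unfold K; lra).
    - split; [intros p Hp; apply Hcont, Hp|]; split; [exact Hb|exact I].
    - assert (HKc : forall j, CW k strip (Some false) (fun p => K j (c p))).
      { intros i; apply (CW_comp k strip strip (Some false) (K i) (fun p => fst p / sig) (fun _ => 0)).
        - auto.
        - auto.
        - exact c_strip.
        - apply IH; lia.
        - apply CW_ext with (fun p => / sig * fst p);
            [auto|intros p _; apply Rmult_comm|].
          apply CW_scal; [auto|].
          apply CW_fst_strip.
        - apply CW_0. }
      assert (HQ : forall j i, CW k strip (Some false) (Q j i K)).
      { intros j' i; apply CW_scal; [auto|].
        apply (CW_comp k strip plane (Some false) (df j' i)
          (fun p => K false (c p)) (fun p => K true (c p))).
        - auto.
        - auto.
        - intros; exact I.
        - apply CW_plus; [auto|exact (CW_const _ _ (Some false) _)|].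
          apply CW_le with (S r); [lia|exact (CW_pd_flat i (N_smooth j'))].
        - apply HKc.
        - apply HKc. }
      assert (HQb : forall j p, strip p -> Rabs (Q j false K p) + Rabs (Q j true K p) <= rho * s).
      { intros j' p _; unfold Q; rewrite !Rabs_mult, <- Rmult_plus_distr_l, Rabs_inv; fold s.
        pose proof (df_row j' (K false (c p), K true (c p))) as Hrow.
        unfold rho; apply Rmult_le_reg_l with s; [lra|]; rewrite <- Rmult_assoc, Rinv_r by lra.
        replace (s * ((s + 10 * e) / (s * s) * s)) with (s + 10 * e) by (field; lra); lra. }
      (* [V] itself does not vanish at [t = 0], but [V - delta true] is [O(t)]; subtracting this
         constant vector from the equation of [V] leaves the inhomogeneity [m], which is [O(t)] as
         well. *)
      set (m := fun j p => Q j true K p - delta true j).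
      assert (Hm : forall j, CW k strip (Some true) (m j)).
      { intros j'; apply CW_slice_dep.
        - exists (4 * e); intros p Hp; rewrite (wt_strip p Hp); unfold m, Q, df.
          pose proof (c_strip p Hp) as Hq.
          assert (HKi : forall i, Rabs (K i (c p)) <= 2 * Rabs (fst p))
            by (intros i; pose proof (P_K u i (c p) HPu Hq); pose proof (c_le p); unfold K; lra).
          assert (D : Rabs (pd true (N j') (K false (c p), K true (c p))) <= 4 * e * Rabs (fst p)).
          { eapply Rle_trans; [apply dN_le|]; unfold fst at 1, snd.
            replace (4 * e * Rabs (fst p)) with (e * (4 * Rabs (fst p))) by ring.
            pose proof (HKi false); pose proof (HKi true).
            apply Rmult_le_compat_l; lra. }
          replace (/ sig * (mu j' * delta true j' + pd true (N j') (K false (c p), K true (c p)))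
            - delta true j') with (/ sig * pd true (N j') (K false (c p), K true (c p)))
            by (unfold delta, mu; destruct j'; simpl; field; exact sig_neq0).
          rewrite Rabs_mult, Rabs_inv; fold s.
          assert (Hs1 : / s <= 1) by (rewrite <- Rinv_1; apply Rinv_le_contravar; lra).
          assert (0 < / s) by (apply Rinv_0_lt_compat; lra).
          pose proof (Rabs_pos (pd true (N j') (K false (c p), K true (c p)))).
          nra.
        - apply CW_minus; [auto|apply HQ|exact (CW_const _ _ (Some false) _)].
        - reflexivity. }
      destruct (contracting_system sig (rho * s) k (fun j i => Q j i K) m) as [w [Hw Ew]];
        try assumption.
      { pose proof rho_bound; split; [apply Rmult_le_pos; lra|fold s; nra]. }
      assert (HD : forall j p, strip p -> V j p - delta true j - w j p = 0).
      { destruct (CW_bound (Hw false)) as [C1 [HC1 B1]].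
        destruct (CW_bound (Hw true)) as [C2 [HC2 B2]].
        apply (linear_uniqueness (fun j i => Q j i K)
          (fun j p => V j p - delta true j - w j p) (1 + C1 + C2)).
        - exact HQb.
        - intros j' p Hp; rewrite (EV j' p Hp), (Ew j' p Hp); unfold m, delta; simpl.
          change (fst p / sig, 0) with (c p); ring.
        - intros j' p Hp; specialize (HV j' p Hp); specialize (B1 p Hp); specialize (B2 p Hp).
          rewrite (wt_strip p Hp) in B1, B2; fold (V j' p) in HV.
          pose proof (Rabs_triang (V j' p - delta true j') (- w j' p)) as Ht.
          rewrite Rabs_Ropp in Ht; unfold Rminus at 1.
          pose proof (Rabs_pos (fst p)).
          assert (Rabs (w j' p) <= (C1 + C2) * Rabs (fst p)) by (destruct j'; nra); lra. }
      assert (HVs : CW k strip (Some false) (V j)).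
      { apply CW_ext with (fun p => w j p + delta true j).
        - auto.
        - intros p Hp; specialize (HD j p Hp); lra.
        - apply CW_plus; [auto|exact (CW_flat (Hw j))|].
          exact (CW_const _ _ (Some false) _). }
      apply CW_intro with (d := fun (b : bool) p => if b then 0 else V j p).
      * auto.
      * intros p Hp; apply Hcont, Hp.
      * exact Hb.
      * intros [|] p Hp; [apply HK2, Hp|apply Hder, Hp].
      * exact HVs.
      * apply CW_0. }
  assert (H00 : strip (0, 0)) by (unfold strip; simpl; rewrite Rabs_R0; lra).
  exists K; split; [apply Hsm; lia|]; split; [|split; [|split]].
  + intros j; apply HK0.
  + intros j; apply is_pd_unique; apply (is_pd_eq _ (Hder j (0, 0) H00)).
    pose proof (HV j (0, 0) H00) as H; simpl in H; rewrite Rabs_R0 in H.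
    pose proof (Rabs_pos (u ((true, j), (0, 0)) - delta true j)).
    assert (E : u ((true, j), (0, 0)) - delta true j = 0) by (apply Rabs_eq_0; lra); lra.
  + exact Hdep.
  + intros j p Hp; rewrite (EK j p Hp); unfold f; destruct j; reflexivity.
Qed.

End UnstableCurve.

(** * The linearizing functions *)

Lemma CW_wt_zero {k w} y : CW k strip (Some true) w -> w (0, y) = 0.
Proof.
intros Hw; destruct (CW_bound Hw) as [C [_ H]].
assert (Hs : strip (0, y)) by (unfold strip; simpl; rewrite Rabs_R0; lra).
specialize (H _ Hs); rewrite (wt_strip _ Hs) in H; simpl in H; rewrite Rabs_R0, Rmult_0_r in H.
apply Rabs_eq_0; pose proof (Rabs_pos (w (0, y))); lra.
Qed.

(* The inner map contracts every direction, so that no derivative is lost. *)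
Lemma contracting_equation k sig g : 1 < Rabs sig -> CW (S k) plane None g ->
  (forall p, g p = g (fst p, 0)) -> g (0, 0) = 0 ->
  exists w, CW (S k) strip (Some true) w /\
    forall p, strip p -> w p = w (fst p / sig, 0) + g p.
Proof.
intros Hsig Hg Hdep H0.
(* [g] comes without bounds. Contracting its argument by 3 places the strip where the bump is 1, so
   that the bounds of the cut-off function carry over to [g]. *)
set (H := fun p => bump (S k) p * g (3 * fst p, 0)).
assert (HH : CW (S k) plane (Some false) H).
{ apply CW_cut.
  apply (CW_comp_None (S k) (box 1) plane g (fun p => 3 * fst p) (fun _ => 0));
    [auto|auto|intros; exact I|exact Hg| |apply CW_0].
  apply CW_scal; [auto|apply CW_fst]. }
assert (Hm : CW (S k) strip (Some false) g).
{ apply CW_ext with (fun p => H (/ 3 * fst p, 0)); [auto| |].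
  - intros p Hp; unfold H; rewrite bump_near.
    + rewrite (Hdep p); simpl; replace (3 * (/ 3 * fst p)) with (fst p) by field; ring.
    + simpl; rewrite Rabs_mult, Rabs_pos_eq by lra; unfold strip in Hp; lra.
    + simpl; rewrite Rabs_R0; lra.
  - apply (CW_comp (S k) strip plane (Some false) H (fun p => / 3 * fst p) (fun _ => 0));
      [auto|auto|intros; exact I|exact HH| |apply CW_0].
    apply (CW_scal (S k) strip (Some false)); [auto|apply CW_fst_strip]. }
assert (Hm' : CW (S k) strip (Some true) g).
{ apply CW_slice_dep; [|exact Hm|intros; apply Hdep].
  destruct (CW_bound (CW_pd false Hm)) as [C [HC B]].
  exists C; intros p Hp; rewrite (wt_strip p Hp); apply vanish_bound; try exact Hp.
  - intros q Hq; exact (CW_ex_pd false q Hm Hq).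
  - intros q Hq; specialize (B q Hq); simpl in B; simpl; lra.
  - intros y; rewrite Hdep; exact H0. }
(* Two uncoupled copies of the scalar equation. *)
destruct (contracting_system sig 1 (S k) (fun j i _ => delta j i) (fun _ => g))
  as [w [Hw Ew]]; try lra.
- intros; exact (CW_const _ _ (Some false) _).
- intros j p _; destruct j; unfold delta; simpl; rewrite Rabs_R0, Rabs_R1; lra.
- intros; exact Hm'.
- exists (w false); split; [apply Hw|]; intros p Hp; rewrite (Ew false p Hp).
  unfold delta; simpl; ring.
Qed.

Section Linearization.

Variables (N : bool -> R * R -> R) (lam sig e : R) (n : nat).
Let mu (j : bool) : R := if j then sig else lam.

Hypothesis lam_neq0 : lam <> 0.
Hypothesis lam_small : Rabs lam + 2 * e <= 1.
Hypothesis sig_big : 1 < Rabs sig.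
Hypothesis e_pos : 0 < e <= 1.
Hypothesis e_lam : 2 * e <= Rabs lam.
Hypothesis rate : ((Rabs lam + 2 * e) + INR (S n) * e) * (Rabs sig + 2 * e) ^ (S n) < 1.
Hypothesis N_smooth : forall j, CW (S (S (S n))) plane (Some false) (N j).
Hypothesis N_axis : forall j y, N j (0, y) = 0.
Hypothesis dN_0 : forall i j, pd i (N j) (0, 0) = 0.
Hypothesis dN_small : forall i j p, Rabs (pd i (N j) p) <= e.
Hypothesis ddN_small : forall a i j p, Rabs (pd a (pd i (N j)) p) <= e.

Let f1 (p : R * R) : R := lam * fst p + N false p.
Let f2 (p : R * R) : R := sig * snd p + N true p.

Lemma N_le j p : strip p -> Rabs (N j p) <= e * Rabs (fst p).
Proof.
apply vanish_bound; [|intros; apply dN_small|apply N_axis].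
intros q _; exact (CW_ex_pd false q (N_smooth j) I).
Qed.

Lemma f1_is_pd b p : is_pd b f1 p ((if b then 0 else lam) + pd b (N false) p).
Proof.
apply is_pd_plus; [|exact (CW_is_pd b p (N_smooth false) I)].
pose proof (is_pd_scal b lam _ _ _ (is_pd_fst b p)) as H.
apply (is_pd_eq _ H); destruct b; ring.
Qed.

Lemma f2_is_pd b p : is_pd b f2 p ((if b then sig else 0) + pd b (N true) p).
Proof.
apply is_pd_plus; [|exact (CW_is_pd b p (N_smooth true) I)].
pose proof (is_pd_scal b sig _ _ _ (is_pd_snd b p)) as H.
apply (is_pd_eq _ H); destruct b; ring.
Qed.

Lemma dN_strip i j k : (k <= S (S n))%nat -> CW k strip (Some false) (pd i (N j)).
Proof.
intros Hk; apply CW_le with (S (S n)); [exact Hk|].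
apply CW_sub with plane; [intros; exact I|].
exact (CW_pd_flat i (N_smooth j)).
Qed.

Lemma f1_CW k : (k <= S (S (S n)))%nat -> CW k plane None f1.
Proof.
intros Hk; apply CW_plus; [auto| |].
- apply CW_scal; [auto|apply CW_fst].
- apply CW_le with (S (S (S n))); [exact Hk|exact (CW_None (N_smooth false))].
Qed.

Lemma f2_CW k : (k <= S (S (S n)))%nat -> CW k plane None f2.
Proof.
intros Hk; apply CW_plus; [auto| |].
- apply CW_scal; [auto|apply CW_snd].
- apply CW_le with (S (S (S n))); [exact Hk|exact (CW_None (N_smooth true))].
Qed.

Lemma pd_axis i y : pd true (N i) (0, y) = 0.
Proof.
apply is_pd_unique; unfold is_pd; simpl.
apply is_derive_ext with (fun _ => 0); [intros; symmetry; apply N_axis|apply is_derive_cst].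
Qed.

(** [theta] is [1 / sig] for [w] and [1] for [E]. In each rate, [2 * e] accounts for the two entries
    of a row. The [eps] of [functional_equation] is [e], since [pd true (N false)] vanishes on the
    axis and its [x]-derivative is a second derivative of [N]. [CW_vanish] applied to it costs a
    derivative. *)
Lemma saddle_equation theta m : Rabs theta <= 1 -> CW (S n) strip (Some true) m ->
  exists w, CW (S n) strip (Some true) w /\
    forall p, strip p -> w p = theta * w (f1 p, f2 p) + m p.
Proof.
intros Hth Hm.
pose proof (Rabs_pos lam) as Hl.
assert (HdN : forall b i p, Rabs (pd b (N i) p) <= e) by (intros; apply dN_small).
destruct (functional_equation f1 f2 (fun j i _ => theta * delta j i) (fun _ => m) (S n)
  (Rabs lam + 2 * e) (Rabs sig + 2 * e) e 1) as [w [Hw Ew]]; try lra.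
- intros; exact (CW_const _ _ (Some false) _).
- intros j p _; destruct j; unfold delta; simpl;
    rewrite Rmult_0_r, Rmult_1_r, Rabs_R0; lra.
- intros; exact Hm.
- intros b p _; eexists; apply f1_is_pd.
- intros b p _; eexists; apply f2_is_pd.
- intros p _; exact (CW_cont p (f1_CW 0 ltac:(lia)) I).
- intros p _; exact (CW_cont p (f2_CW 0 ltac:(lia)) I).
- intros b; apply CW_ext with (fun p => (if b then 0 else lam) + pd b (N false) p);
    [auto|intros p _; symmetry; apply is_pd_unique, f1_is_pd|].
  apply CW_plus; [auto| |].
  + destruct b; [apply CW_0|exact (CW_const _ _ (Some false) _)].
  + destruct b; [|apply dN_strip; lia].
    apply CW_vanish; [apply dN_strip; lia|apply pd_axis].
- intros b; apply CW_ext with (fun p => (if b then sig else 0) + pd b (N true) p);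
    [auto|intros p _; symmetry; apply is_pd_unique, f2_is_pd|].
  apply CW_plus; [auto|exact (CW_const _ _ (Some false) _)|apply dN_strip; lia].
- intros p Hp; unfold f1; eapply Rle_trans; [apply Rabs_triang|].
  rewrite Rabs_mult; pose proof (N_le false p Hp); pose proof (Rabs_pos (fst p)); nra.
- intros p _; rewrite (is_pd_unique (f1_is_pd false p)).
  rewrite (is_pd_unique (f2_is_pd false p)), Rplus_0_l.
  pose proof (Rabs_triang lam (pd false (N false) p)).
  pose proof (HdN false false p); pose proof (HdN false true p); lra.
- intros p _; rewrite (is_pd_unique (f1_is_pd true p)), Rplus_0_l.
  rewrite (is_pd_unique (f2_is_pd true p)).
  pose proof (Rabs_triang sig (pd true (N true) p)).
  pose proof (HdN true false p); pose proof (HdN true true p); lra.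
- intros p Hp; rewrite (is_pd_unique (f1_is_pd true p)), Rplus_0_l.
  apply (vanish_bound (pd true (N false)) e); try exact Hp.
  + intros q Hq; exact (CW_ex_pd false q (dN_strip true false 1 ltac:(lia)) Hq).
  + intros; apply ddN_small.
  + apply pd_axis.
- exists (w false); split; [apply Hw|]; intros p Hp; rewrite (Ew false p Hp).
  unfold delta; simpl; ring.
Qed.

Lemma strip_0 : strip (0, 0).
Proof. unfold strip; simpl; rewrite Rabs_R0; lra. Qed.

Lemma box_strip c p : c <= 1 -> box c p -> strip p.
Proof. intros Hc [Hp _]; unfold strip; lra. Qed.

(* [v = y + w], where [w - w o f / sig = N true / sig]. *)
Lemma unstable_coordinate : exists v, CW (S n) strip None v /\ v (0, 0) = 0 /\
  (forall b, pd b v (0, 0) = delta b true) /\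
  forall p, strip p -> v (f1 p, f2 p) = sig * v p.
Proof.
assert (Hs0 : sig <> 0) by (intros E; rewrite E, Rabs_R0 in sig_big; lra).
destruct (saddle_equation (/ sig) (fun p => / sig * N true p)) as [w [Hw Ew]].
- rewrite Rabs_inv, <- Rinv_1; apply Rinv_le_contravar; lra.
- apply CW_scal; [auto|].
  apply CW_vanish; [|apply N_axis].
  apply CW_le with (S (S (S n))); [lia|].
  apply CW_sub with plane; [intros; exact I|apply N_smooth].
- assert (Hw0 : forall y, w (0, y) = 0) by (intros y; exact (CW_wt_zero _ Hw)).
  assert (Hwy : pd true w (0, 0) = 0).
  { apply is_pd_unique; unfold is_pd; simpl.
    apply is_derive_ext with (fun _ => 0); [intros; symmetry; apply Hw0|apply is_derive_cst]. }
  assert (Hf0 : (f1 (0, 0), f2 (0, 0)) = (0, 0))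
    by (unfold f1, f2; rewrite !N_axis; simpl; f_equal; ring).
  (* Differentiating the equation at the fixed point gives [d = d * lam / sig], and [lam <> sig]. *)
  assert (Hwx : pd false w (0, 0) = 0).
  { assert (K : is_pd false w (0, 0) (/ sig * (pd false w (0, 0) * lam + pd true w (0, 0) * 0)
      + / sig * 0)).
    { apply is_pd_ext_loc with (fun p => / sig * w (f1 p, f2 p) + / sig * N true p).
      - apply (open_locally strip); [auto| |apply strip_0].
        intros q Hq; symmetry; apply Ew, Hq.
      - apply is_pd_plus; apply is_pd_scal.
        + apply (is_pd_comp false w f1 f2).
          * rewrite Hf0; exact (CW_dif _ _ _ _ _ open_strip Hw strip_0).
          * apply (is_pd_eq _ (f1_is_pd false (0, 0))); rewrite dN_0; ring.
          * apply (is_pd_eq _ (f2_is_pd false (0, 0))); rewrite dN_0; ring.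
        + apply (is_pd_eq _ (CW_is_pd false (0, 0) (N_smooth true) I)), dN_0. }
    apply is_pd_unique in K; rewrite Hwy in K.
    set (d := pd false w (0, 0)) in *.
    assert (E : d * (sig - lam) = 0).
    { replace (d * (sig - lam)) with (sig * (d - (/ sig * (d * lam + 0 * 0) + / sig * 0)))
        by (field; exact Hs0).
      rewrite <- K; ring. }
    apply Rmult_integral in E; destruct E as [E|E]; [exact E|exfalso].
    assert (sig = lam) by lra; subst sig; lra. }
  exists (fun p => snd p + w p); split; [|split; [|split]].
  + apply CW_plus; [auto|apply CW_snd|exact (CW_None Hw)].
  + rewrite Hw0; simpl; ring.
  + intros b; apply is_pd_unique.
    apply (is_pd_eq _ (is_pd_plus (is_pd_snd b (0, 0))
      (CW_is_pd b (0, 0) Hw strip_0))).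
    destruct b; [rewrite Hwy|rewrite Hwx]; unfold delta; simpl; ring.
  + intros p Hp; simpl; pose proof (Ew p Hp) as E.
    assert (E' : w (f1 p, f2 p) = sig * w p - N true p) by (rewrite E; field; exact Hs0).
    rewrite E'; unfold f2; ring.
Qed.

Let F (p : R * R) : R := lam + avg 0 (pd false (N false)) p.
(** The quotient by [lam] is close to 1, so the logarithm also makes sense for negative [lam]. *)
Let l (p : R * R) : R := ln (F p / lam).

Lemma f1_factor p : f1 p = fst p * F p.
Proof.
unfold f1, F; rewrite (hadamard (S (S n)) (N false) p);
  [ring|exact (CW_None (N_smooth false))|apply N_axis].
Qed.

Lemma F_pos p : 0 < F p / lam.
Proof.
assert (H : Rabs (avg 0 (pd false (N false)) p) <= e).
{ apply avg_bound; [|intros; apply dN_small].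
  intros q; exact (CW_cont q (CW_pd false (N_smooth false)) I). }
unfold F; set (a := avg 0 (pd false (N false)) p) in *.
replace ((lam + a) / lam) with (1 + a / lam) by (field; exact lam_neq0).
assert (Ha : Rabs (a / lam) <= 1 / 2).
{ unfold Rdiv; rewrite Rabs_mult, Rabs_inv.
  assert (Hl : 0 < Rabs lam) by (apply Rabs_pos_lt, lam_neq0).
  apply Rmult_le_reg_r with (Rabs lam); [exact Hl|].
  rewrite Rmult_assoc, Rinv_l by lra; lra. }
apply Rabs_le_between in Ha; lra.
Qed.

Lemma l_CW : CW (S (S n)) plane None l.
Proof.
apply CW_ln; [auto|intros; apply F_pos|].
apply CW_ext with (fun p => / lam * F p);
  [auto|intros; unfold Rdiv; apply Rmult_comm|].
apply CW_scal; [auto|].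
apply CW_plus; [auto|exact (CW_const _ _ None _)|].
apply CW_avg; exact (CW_None (CW_pd false (N_smooth false))).
Qed.

Lemma l_0 : l (0, 0) = 0.
Proof.
unfold l, F.
assert (E : avg 0 (pd false (N false)) (0, 0) = 0).
{ unfold avg; rewrite (RInt_ext _ (fun _ => 0)).
  - rewrite RInt_const; apply Rmult_0_r.
  - intros t _; simpl; rewrite Rmult_0_r.
    change (1 * pd false (N false) (0, 0) = 0); rewrite dN_0; ring. }
rewrite E, Rplus_0_r; replace (lam / lam) with 1 by (field; exact lam_neq0); apply ln_1.
Qed.

Lemma f2_box p : box 1 p -> Rabs (f2 p) < Rabs sig + 2.
Proof.
intros Hp; pose proof (N_le true p (box_strip 1 p (Rle_refl 1) Hp)) as HN; destruct Hp as [Hx Hy].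
unfold f2; eapply Rle_lt_trans; [apply Rabs_triang|]; rewrite Rabs_mult.
pose proof (Rabs_pos (fst p)); pose proof (Rabs_pos (snd p)); nra.
Qed.

(* [u = x exp E], where [E - E o f = l] is split into its restriction [e0] to the axis
   and a part [e1] for which the right-hand side vanishes on the axis. *)
Lemma stable_coordinate : exists u, CW (S n) (box 1) None u /\ u (0, 0) = 0 /\
  (forall b, pd b u (0, 0) = delta b false) /\
  forall p, box (1 / 3) p -> box 1 (f1 p, f2 p) -> u (f1 p, f2 p) = lam * u p.
Proof.
(* [e0] is evaluated at [snd p] and at [f2 p] for [p] in [box 1], hence on [|t| < R0]; the equation
   along the axis is therefore solved in the variable [t / R0]. *)
set (R0 := Rabs sig + 2).
assert (HR : 3 < R0) by (unfold R0; lra).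
assert (Hs0 : sig <> 0) by (intros E; rewrite E, Rabs_R0 in sig_big; lra).
(* On the axis [f] is [y |-> sig y], so [E - E o f = l] at [y = t / sig] reads
   [e0 t = e0 (t / sig) - l (0, t / sig)], which runs along backward orbits. *)
destruct (contracting_equation (S n) sig (fun p => - l (0, R0 / sig * fst p))) as [w [Hw Ew]].
{ exact sig_big. }
{ apply CW_opp; [auto|].
  apply (CW_comp_None (S (S n)) plane plane l (fun _ => 0) (fun p => R0 / sig * fst p));
    auto; [exact l_CW|apply CW_0|].
  apply CW_scal; [auto|apply CW_fst]. }
{ reflexivity. }
{ simpl; rewrite Rmult_0_r, l_0; ring. }
set (e0 := fun t => w (/ R0 * t, 0)).
set (V := fun p : R * R => Rabs (snd p) < R0).
assert (HV : open V) by apply (open_coord_lt true).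
assert (He0 : forall t, Rabs t < R0 -> e0 t = e0 (t / sig) - l (0, t / sig)).
{ intros t Ht; unfold e0; rewrite Ew.
  - simpl; replace (/ R0 * t / sig) with (/ R0 * (t / sig)) by (field; split; lra).
    replace (R0 / sig * (/ R0 * t)) with (t / sig) by (field; split; lra); ring.
  - unfold strip; simpl; rewrite Rabs_mult, Rabs_pos_eq by (left; apply Rinv_0_lt_compat; lra).
    apply Rmult_lt_reg_l with R0; [lra|]; rewrite <- Rmult_assoc, Rinv_r by lra; lra. }
assert (HE0 : CW (S (S n)) V None (fun p => e0 (snd p))).
{ apply (CW_comp_None (S (S n)) V strip w (fun p => / R0 * snd p) (fun _ => 0)).
  - exact HV.
  - auto.
  - intros p Hp; unfold strip; simpl.
    rewrite Rabs_mult, Rabs_pos_eq by (left; apply Rinv_0_lt_compat; lra).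
    apply Rmult_lt_reg_l with R0; [lra|]; rewrite <- Rmult_assoc, Rinv_r by lra.
    unfold V in Hp; lra.
  - exact (CW_None Hw).
  - apply CW_scal; [exact HV|apply CW_snd].
  - apply CW_0. }
set (m := fun p => l p - e0 (snd p) + e0 (f2 p)).
assert (Hm : CW (S (S n)) (box 1) None m).
{ apply CW_plus; [auto|apply CW_minus; [auto| |]|].
  - apply CW_sub with plane; [intros; exact I|exact l_CW].
  - apply CW_sub with V; [intros p [_ Hp]; unfold V; lra|exact HE0].
  - apply (CW_comp_None (S (S n)) (box 1) V (fun p => e0 (snd p)) f1 f2);
      [auto|exact HV|exact f2_box|exact HE0| |];
      (apply CW_sub with plane; [intros; exact I|]); [apply f1_CW|apply f2_CW]; lia. }
assert (Hm0 : forall y, Rabs y < 1 -> m (0, y) = 0).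
{ intros y Hy; unfold m; simpl snd.
  assert (Ef : f2 (0, y) = sig * y) by (unfold f2; rewrite N_axis; simpl; ring).
  rewrite Ef, (He0 (sig * y)).
  - replace (sig * y / sig) with y by (field; exact Hs0); ring.
  - rewrite Rabs_mult; pose proof (Rabs_pos y); unfold R0; nra. }
(* [m] is controlled on [box 1] only. After the cut-off, the equation for [e1] is the intended one
   where the bump is 1, hence the [box (1 / 3)] in the conclusion. *)
set (m' := fun p => bump (S (S n)) p * m p).
destruct (saddle_equation 1 m') as [e1 [He1 Ee1]].
{ rewrite Rabs_R1; lra. }
{ apply CW_vanish.
  - apply CW_sub with plane; [intros; exact I|exact (CW_cut _ _ Hm)].
  - intros y; unfold m'; destruct (Rlt_dec (Rabs y) 1) as [Hy|Hy].
    + rewrite (Hm0 y Hy); ring.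
    + rewrite bump_far by (right; simpl; lra); ring. }
set (E := fun p => e0 (snd p) + e1 p).
assert (HE : CW (S n) (box 1) None E).
{ apply CW_plus; [auto| |].
  - apply CW_sub with V; [intros p [_ Hp]; unfold V; lra|exact (CW_S HE0)].
  - apply CW_sub with strip; [intros; apply (box_strip 1); [lra|assumption]|].
    exact (CW_None He1). }
assert (HE00 : E (0, 0) = 0).
{ unfold E; rewrite (CW_wt_zero _ He1); unfold e0; simpl; rewrite Rmult_0_r.
  rewrite (CW_wt_zero _ Hw); ring. }
assert (Hb0 : box 1 (0, 0)) by (split; simpl; rewrite Rabs_R0; lra).
exists (fun p => fst p * exp (E p)); split; [|split; [|split]].
- apply CW_mult; [auto|apply CW_fst|apply CW_exp; [auto|exact HE]].
- simpl; ring.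
- intros b; apply is_pd_unique.
  pose proof (CW_exp _ _ _ (open_box 1) HE) as Hexp.
  apply (is_pd_eq _ (is_pd_mult (is_pd_fst b (0, 0))
    (CW_is_pd b (0, 0) Hexp Hb0))).
  rewrite HE00, exp_0; simpl; destruct b; unfold delta; simpl; ring.
- intros p Hp Hfp.
  assert (Hs : strip p) by (apply (box_strip (1 / 3)); [lra|exact Hp]).
  assert (Em' : m' p = m p)
    by (unfold m'; rewrite bump_near; [ring| |]; apply Rlt_le, Hp).
  pose proof (Ee1 p Hs) as K; rewrite Em', Rmult_1_l in K; unfold m in K.
  assert (EE : E (f1 p, f2 p) = E p - l p) by (unfold E; rewrite K; simpl; ring).
  rewrite EE; simpl; rewrite f1_factor; unfold Rminus; rewrite exp_plus, exp_Ropp; unfold l.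
  rewrite exp_ln by apply F_pos.
  pose proof (F_pos p) as HF; field; split; [exact lam_neq0|].
  intros HF0; rewrite HF0 in HF; unfold Rdiv in HF; rewrite Rmult_0_l in HF; lra.
Qed.

End Linearization.

(** * Assembling the linearization *)

Definition CWmap (k : nat) (F : R * R -> R * R) : Prop :=
  forall j, CW k plane None (fun p => coord j (F p)).

Lemma diffeo_CWmap {k F G} : diffeo k F G -> CWmap k F.
Proof. intros [_ [_ H]] j; apply H. Qed.

Lemma CWmap_comp k F G : CWmap k F -> CWmap k G -> CWmap k (fun p => F (G p)).
Proof.
intros HF HG j; apply (CW_comp_map k plane plane (fun p => coord j (F p))); auto.
Qed.

(* [A b j] is the derivative in the direction [b] of the component [j]. *)
Definition dmat (F : R * R -> R * R) (p : R * R) (A : bool -> bool -> R) : Prop :=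
  forall b j, is_pd b (fun q => coord j (F q)) p (A b j).

Lemma dmat_eq F p A B : (forall b j, A b j = B b j) -> dmat F p A -> dmat F p B.
Proof. intros E H b j; apply (is_pd_eq _ (H b j)), E. Qed.

Lemma dmat_CW k F p : CWmap (S k) F -> dmat F p (fun b j => pd b (fun q => coord j (F q)) p).
Proof. intros H b j; exact (CW_is_pd b p (H j) I). Qed.

Lemma dmat_comp k F G p A B : CWmap (S k) G -> dmat G (F p) B -> dmat F p A ->
  dmat (fun q => G (F q)) p (fun b j => B false j * A b false + B true j * A b true).
Proof.
intros HG HB HA b j.
apply is_pd_ext_loc with (fun q => coord j (G (coord false (F q), coord true (F q)))).
- apply filter_forall; intros q; simpl; destruct (F q); reflexivity.
- apply (is_pd_comp b (fun q => coord j (G q)) (fun q => coord false (F q)) (fun q => coord true (F q)));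
    [|apply HA|apply HA].
  replace (coord false (F p), coord true (F p)) with (F p) by (simpl; destruct (F p); reflexivity).
  pose proof (CW_dif _ _ _ _ (F p) open_plane (HG j) I) as H.
  rewrite (is_pd_unique (HB false j)), (is_pd_unique (HB true j)) in H.
  exact H.
Qed.

Lemma dmat_inverse k F G p A : diffeo (S k) F G -> dmat F p A ->
  forall b j, pd false (fun q => coord j (G q)) (F p) * A b false
    + pd true (fun q => coord j (G q)) (F p) * A b true = delta b j.
Proof.
intros HFG HA b j.
pose proof (dmat_comp k F G p A _ (diffeo_CWmap (diffeo_sym HFG))
  (dmat_CW k G (F p) (diffeo_CWmap (diffeo_sym HFG))) HA) as H.
specialize (H b j); apply is_pd_unique in H; rewrite <- H; apply is_pd_unique.
apply is_pd_ext_loc with (coord j); [|apply coord_is_pd].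
apply filter_forall; intros q; rewrite (proj1 HFG); reflexivity.
Qed.

Lemma dmat_diffeo_inv k F G p d : d <> 0 -> diffeo (S k) F G ->
  dmat F p (fun b j => d * delta b j) -> dmat G (F p) (fun b j => / d * delta b j).
Proof.
intros Hd HFG HA.
apply dmat_eq with (2 := dmat_CW k G (F p) (diffeo_CWmap (diffeo_sym HFG))).
intros b j; apply Rmult_eq_reg_l with d; [|exact Hd].
rewrite <- Rmult_assoc, Rinv_r, Rmult_1_l by exact Hd.
rewrite <- (dmat_inverse k F G p _ HFG HA b j).
destruct b; unfold delta; simpl; ring.
Qed.

Lemma small_image k F c : CWmap k F -> F (0, 0) = (0, 0) -> 0 < c ->
  exists c', 0 < c' /\ forall p, box c' p -> box c (F p).
Proof.
intros HF H0 Hc.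
assert (H : exists c', 0 < c' /\ forall j p, box c' p -> Rabs (coord j (F p)) < c).
{ apply (uniform_bool (fun j c' => forall p, box c' p -> Rabs (coord j (F p)) < c)).
  - intros j c1 c2 H12 H p [H1 H2]; apply H; split; lra.
  - intros j; destruct (continuous_near (fun p => coord j (F p)) (0, 0) c) as [d [Hd H]].
    + exact (CW_cont (0, 0) (HF j) I).
    + exact Hc.
    + exists d; split; [exact Hd|]; intros p [H1 H2].
      specialize (H p); simpl in H; rewrite !Rminus_0_r in H; specialize (H H1 H2).
      rewrite H0 in H; destruct j; simpl in H; rewrite Rminus_0_r in H; exact H. }
destruct H as [c' [Hc' H]]; exists c'; split; [exact Hc'|]; intros p Hp.
split; [apply (H false)|apply (H true)]; exact Hp.
Qed.

Definition dil (d : R) (p : R * R) : R * R := (d * fst p, d * snd p).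

Lemma dil_diffeo k d : d <> 0 -> diffeo k (dil d) (dil (/ d)).
Proof.
intros Hd.
assert (H : forall c, CWmap k (dil c)).
{ intros c b; apply CW_ext with (fun p => c * coord b p);
    [auto|intros p _; destruct b; reflexivity|].
  apply CW_scal; [auto|apply CW_coord]. }
split; [|split; [|intros b; split; apply H]]; intros [x y]; unfold dil; simpl; f_equal; field; exact Hd.
Qed.

Lemma dil_dmat d p : dmat (dil d) p (fun b j => d * delta b j).
Proof.
intros b j; apply is_pd_ext_loc with (fun q => d * coord j q).
- apply filter_forall; intros q; destruct j; reflexivity.
- apply is_pd_scal, coord_is_pd.
Qed.

Definition lin (lam sig : R) (p : R * R) : R * R := (lam * fst p, sig * snd p).
Definition multiplier (lam sig : R) (j : bool) : R := if j then sig else lam.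

(** Every small [d] is allowed, because the straightened case must also keep [d] below [eta]. By the
    last clause, an invariant axis near 0 makes [N] vanish on the whole axis: through invariance
    where [|y| < 1], through the cut-off beyond. *)
Lemma nonlinear_part k f lam sig e : CWmap (S (S k)) f -> f (0, 0) = (0, 0) ->
  dmat f (0, 0) (fun b j => multiplier lam sig j * delta b j) -> 0 < e ->
  exists d0, 0 < d0 /\ forall d, 0 < d <= d0 ->
    exists N : bool -> R * R -> R,
    (forall j, CW (S (S k)) plane (Some false) (N j)) /\
    (forall j, N j (0, 0) = 0) /\ (forall i j, pd i (N j) (0, 0) = 0) /\
    (forall i j p, Rabs (pd i (N j) p) <= e) /\
    (forall a i j p, Rabs (pd a (pd i (N j)) p) <= e) /\
    (forall p, box (1 / 3) p -> f (dil d p) = dil d (lam * fst p + N false p, sig * snd p + N true p)) /\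
    (forall j y, (Rabs y < 1 -> f (0, d * y) = (0, sig * (d * y))) -> N j (0, y) = 0).
Proof.
intros Hf Hf0 Hdf He.
set (g := fun j p => coord j (f p) - multiplier lam sig j * coord j p).
assert (Hg : forall j, CW (S (S k)) (box 1) None (g j)).
{ intros j; apply CW_minus; [auto| |].
  - apply CW_sub with plane; [intros; exact I|apply Hf].
  - apply CW_scal; [auto|apply CW_coord]. }
assert (Hg0 : forall j, g j (0, 0) = 0) by (intros j; unfold g; rewrite Hf0; destruct j; simpl; ring).
assert (Hgd : forall b j, is_pd b (g j) (0, 0) 0).
{ intros b j.
  pose proof (is_pd_plus (Hdf b j)
    (is_pd_scal _ (- multiplier lam sig j) _ _ _ (coord_is_pd b j (0, 0)))) as H.
  apply is_pd_ext_loc with (fun q => coord j (f q) + - multiplier lam sig j * coord j q).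
  - apply filter_forall; intros q; unfold g; ring.
  - apply (is_pd_eq _ H); ring. }
destruct (rescale_small k 1 (g false) e Rlt_0_1 He (Hg false) (Hg0 false)
  (fun b => is_pd_unique (Hgd b false))) as [d1 [Hd1 K1]].
destruct (rescale_small k 1 (g true) e Rlt_0_1 He (Hg true) (Hg0 true)
  (fun b => is_pd_unique (Hgd b true))) as [d2 [Hd2 K2]].
exists (Rmin d1 d2); split; [apply Rmin_glb_lt; assumption|]; intros d [Hd Hdd].
pose proof (Rmin_l d1 d2); pose proof (Rmin_r d1 d2).
assert (K : forall j, let h := rescale (S (S k)) (g j) d in
    CW (S (S k)) plane (Some false) h /\
    (forall p, Rabs (h p) <= e) /\ (forall b p, Rabs (pd b h p) <= e) /\
    (forall a b p, Rabs (pd a (pd b h) p) <= e) /\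
    (forall p, Rabs (fst p) <= 1 / 3 -> Rabs (snd p) <= 1 / 3 ->
      h p = g j (d * fst p, d * snd p) / d)).
{ intros [|]; [apply K2|apply K1]; lra. }
assert (Hnear : forall j p, box (1 / 3) p ->
  rescale (S (S k)) (g j) d p = g j (d * fst p, d * snd p) / d)
  by (intros j p [Hx Hy]; apply K; lra).
assert (H00 : box (1 / 3) (0, 0)) by (split; simpl; rewrite Rabs_R0; lra).
exists (fun j => rescale (S (S k)) (g j) d).
split; [intros j; apply K|]; split; [|split; [|split; [|split; [|split]]]].
- intros j; rewrite (Hnear j _ H00); simpl; rewrite Rmult_0_r, Hg0; unfold Rdiv; ring.
- intros i j; apply is_pd_unique.
  apply is_pd_ext_loc with (fun q => g j (d * fst q, d * snd q) / d).
  + apply (open_locally (box (1 / 3))); [auto| |exact H00].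
    intros q Hq; symmetry; apply Hnear, Hq.
  + apply is_pd_dilate; [lra|]; simpl; rewrite Rmult_0_r; apply Hgd.
- intros i j p; apply K.
- intros a i j p; apply K.
- intros p Hp; rewrite !Hnear by exact Hp; unfold g, dil, multiplier; simpl.
  rewrite (surjective_pairing (f (d * fst p, d * snd p))) at 1; f_equal; field; lra.
- intros j y Hy; unfold rescale.
  destruct (Rlt_dec (Rabs y) 1) as [H1|H1].
  + simpl; rewrite Rmult_0_r; unfold g; rewrite (Hy H1); unfold multiplier; destruct j; simpl;
      unfold Rdiv; ring.
  + rewrite bump_far by (right; simpl; lra); ring.
Qed.

(** The strict inequality at [e = 0] persists for small [e] by continuity. *)
Lemma rate_exists lam sig n : 0 < Rabs lam < 1 -> Rabs lam * Rabs sig ^ n < 1 ->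
  exists e, 0 < e <= 1 /\ Rabs lam + 2 * e <= 1 /\ 2 * e <= Rabs lam /\
    ((Rabs lam + 2 * e) + INR n * e) * (Rabs sig + 2 * e) ^ n < 1.
Proof.
intros Hl Hr.
set (g := fun e => ((Rabs lam + 2 * e) + INR n * e) * (Rabs sig + 2 * e) ^ n).
assert (Hg0 : g 0 = Rabs lam * Rabs sig ^ n)
  by (unfold g; rewrite !Rmult_0_r, !Rplus_0_r; reflexivity).
assert (Hc : continuous g 0).
{ apply (ex_derive_continuous (V := R_NormedModule)); unfold g; auto_derive; exact I. }
assert (Hpos : 0 < 1 - g 0) by lra.
destruct (Hc _ (locally_ball (g 0) (mkposreal _ Hpos))) as [d Hd].
pose proof (cond_pos d) as Hdp.
set (e := Rmin (d / 2) (Rmin (Rabs lam / 2) ((1 - Rabs lam) / 2))).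
assert (He : 0 < e) by (repeat apply Rmin_glb_lt; lra).
pose proof (Rmin_l (d / 2) (Rmin (Rabs lam / 2) ((1 - Rabs lam) / 2))) as H1.
pose proof (Rmin_r (d / 2) (Rmin (Rabs lam / 2) ((1 - Rabs lam) / 2))) as H2.
pose proof (Rmin_l (Rabs lam / 2) ((1 - Rabs lam) / 2)).
pose proof (Rmin_r (Rabs lam / 2) ((1 - Rabs lam) / 2)).
fold e in H1, H2; exists e; split; [lra|]; split; [lra|]; split; [lra|].
assert (Hb : Rabs (g e - g 0) < 1 - g 0).
{ apply (Hd e); change (Rabs (e - 0) < d); rewrite Rminus_0_r, Rabs_pos_eq; lra. }
apply Rabs_def2 in Hb; unfold g in Hb at 1; lra.
Qed.

(** Near 0, [Phi] is the inverse of [(u, v)] followed by the dilation. The derivative of [(u, v)] at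
    0 is the identity, so [local_diffeo] provides a global diffeomorphism that agrees with it near
    0. *)
Lemma linearize_straight k f lam sig eta : lam <> 0 -> Rabs lam < 1 -> 1 < Rabs sig ->
  Rabs lam * Rabs sig ^ S (S k) < 1 ->
  CWmap (S (S (S (S k)))) f -> dmat f (0, 0) (fun b j => multiplier lam sig j * delta b j) ->
  0 < eta -> (forall y, Rabs y < eta -> f (0, y) = (0, sig * y)) ->
  exists Phi Psi c, diffeo (S (S k)) Phi Psi /\ Phi (0, 0) = (0, 0) /\ 0 < c /\
    forall p, box c p -> f (Phi p) = Phi (lin lam sig p).
Proof.
intros Hl0 Hl Hs Hr Hf Hdf Heta Haxis.
assert (Hlp : 0 < Rabs lam) by (apply Rabs_pos_lt, Hl0).
destruct (rate_exists lam sig (S (S k))) as [e [He1 [He2 [He3 He4]]]]; [lra|exact Hr|].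
assert (Hf0 : f (0, 0) = (0, 0)) by (rewrite Haxis by (rewrite Rabs_R0; exact Heta); f_equal; ring).
destruct (nonlinear_part (S (S k)) f lam sig e Hf Hf0 Hdf (proj1 He1)) as [d0 [Hd0 H]].
set (d := Rmin d0 eta).
assert (Hd : 0 < d) by (apply Rmin_glb_lt; assumption).
pose proof (Rmin_r d0 eta) as Hde; fold d in Hde.
destruct (H d (conj Hd (Rmin_l _ _))) as [N [HN [HN0 [HdN0 [HdN [HddN [Hnear HNa]]]]]]]; clear H.
assert (HNaxis : forall j y, N j (0, y) = 0).
{ intros j y; apply HNa; intros Hy; apply Haxis.
  rewrite Rabs_mult, Rabs_pos_eq by lra; pose proof (Rabs_pos y); nra. }
destruct (stable_coordinate N lam sig e (S k)) as [u [Hu [Hu0 [Hdu Hueq]]]]; try assumption.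
destruct (unstable_coordinate N lam sig e (S k)) as [v [Hv [Hv0 [Hdv Hveq]]]]; try assumption.
set (W := fun j : bool => if j then v else u).
destruct (local_diffeo k 1 W) as [F [G [dw [HFG [Hdw HW]]]]].
{ lra. }
{ intros [|]; [|exact Hu].
  apply CW_sub with strip; [|exact Hv].
  intros p Hp; apply (box_strip 1); [lra|exact Hp]. }
{ intros [|]; assumption. }
{ intros b [|]; [rewrite Hdv|rewrite Hdu]; reflexivity. }
assert (HG0 : G (0, 0) = (0, 0)).
{ transitivity (G (F (0, 0))); [|apply (proj1 HFG)].
  rewrite HW by (split; simpl; rewrite Rabs_R0; lra); simpl; rewrite Hu0, Hv0; reflexivity. }
set (f' := fun p => (lam * fst p + N false p, sig * snd p + N true p)).
assert (Hf' : CWmap (S (S (S (S k)))) f').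
{ intros [|].
  - apply (f2_CW N sig (S k) HN); lia.
  - apply (f1_CW N lam (S k) HN); lia. }
assert (Hf'0 : f' (0, 0) = (0, 0)) by (unfold f'; rewrite !HN0; simpl; f_equal; ring).
set (c1 := Rmin (1 / 3) dw).
assert (Hc1 : 0 < c1) by (apply Rmin_glb_lt; lra).
pose proof (Rmin_l (1 / 3) dw) as Hc1a; pose proof (Rmin_r (1 / 3) dw) as Hc1b; fold c1 in Hc1a, Hc1b.
destruct (small_image _ f' c1 Hf' Hf'0 Hc1) as [c2 [Hc2 Himf]].
(* A point of [box c3] and its image under [f'] both lie in [box c1], where [F] is [(u, v)] and [f']
   is the rescaled [f]. *)
set (c3 := Rmin c1 c2).
assert (Hc3 : 0 < c3) by (apply Rmin_glb_lt; assumption).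
pose proof (Rmin_l c1 c2) as Hc3a; pose proof (Rmin_r c1 c2) as Hc3b; fold c3 in Hc3a, Hc3b.
destruct (small_image _ G c3 (diffeo_CWmap (diffeo_sym HFG)) HG0 Hc3) as [c [Hc HimG]].
assert (Hmono : forall a b p, a <= b -> box a p -> box b p)
  by (intros a b p Hab [Hx Hy]; split; lra).
exists (fun p => dil d (G p)), (fun p => F (dil (/ d) p)), c; split; [|split; [|split]].
- apply (diffeo_comp _ (dil d) (dil (/ d)) G F); [apply dil_diffeo; lra|apply diffeo_sym, HFG].
- rewrite HG0; unfold dil; simpl; f_equal; ring.
- exact Hc.
- intros p Hp; set (q := G p).
  assert (Hq : box c3 q) by (apply HimG, Hp).
  assert (Hq1 : box (1 / 3) q) by (apply (Hmono c3); [lra|exact Hq]).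
  assert (Hfq : box c1 (f' q)) by (apply Himf, (Hmono c3); [lra|exact Hq]).
  rewrite (Hnear q Hq1); f_equal.
  change (f' q = G (lin lam sig p)).
  transitivity (G (F (f' q))); [symmetry; apply (proj1 HFG)|f_equal].
  rewrite HW by (apply (Hmono c1); [lra|exact Hfq]); simpl.
  assert (Hp' : p = (u q, v q)).
  { transitivity (F q); [symmetry; apply (proj1 (proj2 HFG))|].
    rewrite HW by (apply (Hmono c3); [lra|exact Hq]); reflexivity. }
  rewrite Hp'; unfold lin; simpl; f_equal.
  + apply Hueq; [exact Hq1|apply (Hmono c1); [lra|exact Hfq]].
  + apply Hveq, (box_strip (1 / 3)); [lra|exact Hq1].
Qed.

(** The change of variables [(x, y) |-> (x, 0) + K(y)] carries the vertical axis to the unstable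
    curve. It is as smooth as [f], and so is the conjugate, to which the straightened case
    applies. *)
Lemma linearize_diagonal k f lam sig : lam <> 0 -> Rabs lam < 1 -> 1 < Rabs sig ->
  Rabs lam * Rabs sig ^ S (S k) < 1 -> f (0, 0) = (0, 0) ->
  CWmap (S (S (S (S k)))) f -> dmat f (0, 0) (fun b j => multiplier lam sig j * delta b j) ->
  exists Phi Psi c, diffeo (S (S k)) Phi Psi /\ Phi (0, 0) = (0, 0) /\ 0 < c /\
    forall p, box c p -> f (Phi p) = Phi (lin lam sig p).
Proof.
intros Hl0 Hl Hs Hr Hf0 Hf Hdf.
assert (Hs0 : sig <> 0) by (intros E; rewrite E, Rabs_R0 in Hs; lra).
(* This gives [1 + 16 e <= |sig|]; moreover [10 e < |sig| (|sig| - 1)], the other smallness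
   condition of [unstable_curve]. *)
set (e := Rmin 1 ((Rabs sig - 1) / 16)).
assert (He : 0 < e) by (apply Rmin_glb_lt; lra).
pose proof (Rmin_l 1 ((Rabs sig - 1) / 16)) as He1; fold e in He1.
pose proof (Rmin_r 1 ((Rabs sig - 1) / 16)) as He2; fold e in He2.
destruct (nonlinear_part (S (S k)) f lam sig e Hf Hf0 Hdf He) as [d [Hd H]].
destruct (H d (conj Hd (Rle_refl d))) as [N [HN [HN0 [HdN0 [HdN [HddN [Hnear _]]]]]]]; clear H.
destruct (unstable_curve N lam sig e (S (S k))) as [K [HK [HK0 [HdK [HKdep HKeq]]]]];
  try assumption; try lra; [nra|].
set (P := fun (j : bool) p => (if j then 0 else fst p) + K j (snd p, 0)).
set (hs := fun p : R * R => Rabs (snd p) < 1).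
assert (Hhs : open hs) by apply (open_coord_lt true).
assert (HKs : forall j, CW (S (S (S (S k)))) hs None (fun p => K j (snd p, 0))).
{ intros j; apply (CW_comp_None _ hs strip (K j) snd (fun _ => 0)).
  - exact Hhs.
  - auto.
  - intros p Hp; exact Hp.
  - exact (CW_None (HK j)).
  - apply CW_snd.
  - apply CW_0. }
assert (HPd : forall b j, is_pd b (P j) (0, 0) (delta b j)).
{ intros b j.
  assert (HKd : is_pd b (fun p => K j (snd p, 0)) (0, 0) (if b then delta true j else 0)).
  { destruct b; [|exact (is_derive_cst (K j (0, 0)) 0)].
    pose proof (CW_is_pd false (0, 0) (HK j) strip_0) as H; rewrite HdK in H; exact H. }
  assert (Hfd : is_pd b (fun p => if j then 0 else fst p) (0, 0) (if j then 0 else if b then 0 else 1))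
    by (destruct j; [apply is_pd_const|apply is_pd_fst]).
  apply (is_pd_eq _ (is_pd_plus Hfd HKd)).
  destruct b, j; unfold delta; simpl; ring. }
destruct (local_diffeo (S (S k)) 1 P) as [F [G [dw [HFG [Hdw HP]]]]].
{ lra. }
{ intros j; apply CW_plus; [auto| |].
  - destruct j; [apply CW_0|apply CW_fst].
  - apply CW_sub with hs; [intros p Hp; apply Hp|apply HKs]. }
{ intros j; unfold P; simpl; rewrite HK0; destruct j; ring. }
{ intros b j; exact (is_pd_unique (HPd b j)). }
assert (H00 : forall c, 0 < c -> box c (0, 0))
  by (intros c Hc; split; simpl; rewrite Rabs_R0; exact Hc).
assert (HF0 : F (0, 0) = (0, 0)).
{ rewrite HP by (apply H00, Hdw); unfold P; simpl; rewrite !HK0; f_equal; ring. }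
assert (HG0 : G (0, 0) = (0, 0)) by (rewrite <- HF0 at 1; apply (proj1 HFG)).
assert (HdF : dmat F (0, 0) (fun b j => 1 * delta b j)).
{ intros b j; apply is_pd_ext_loc with (fun p => coord j (P false p, P true p)).
  - apply (open_locally (box dw)); [auto| |apply H00, Hdw].
    intros q Hq; rewrite (HP q Hq); reflexivity.
  - apply (is_pd_eq (delta b j)); [|ring].
    destruct j; [exact (HPd b true)|exact (HPd b false)]. }
set (Fd := fun p => dil d (F p)); set (Gd := fun p => G (dil (/ d) p)).
assert (HFGd : diffeo (S (S (S (S k)))) Fd Gd)
  by (apply (diffeo_comp _ (dil d) (dil (/ d)) F G); [apply dil_diffeo; lra|exact HFG]).
assert (HFd0 : Fd (0, 0) = (0, 0)) by (unfold Fd; rewrite HF0; unfold dil; simpl; f_equal; ring).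
assert (HdFd : dmat Fd (0, 0) (fun b j => d * delta b j)).
{ apply dmat_eq with (2 := dmat_comp (S (S (S k))) F (dil d) (0, 0) _ _
    (diffeo_CWmap (dil_diffeo _ d ltac:(lra))) (dil_dmat d _) HdF).
  intros b j; destruct b, j; unfold delta; simpl; ring. }
assert (HdGd : dmat Gd (0, 0) (fun b j => / d * delta b j)).
{ rewrite <- HFd0; apply (dmat_diffeo_inv (S (S (S k))) Fd); [lra|exact HFGd|exact HdFd]. }
set (f' := fun p => Gd (f (Fd p))).
assert (Hf' : CWmap (S (S (S (S k)))) f').
{ apply (CWmap_comp _ Gd (fun p => f (Fd p))).
  - exact (diffeo_CWmap (diffeo_sym HFGd)).
  - apply CWmap_comp; [exact Hf|exact (diffeo_CWmap HFGd)]. }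
assert (Hdf' : dmat f' (0, 0) (fun b j => multiplier lam sig j * delta b j)).
{ assert (H1 : dmat (fun p => f (Fd p)) (0, 0) (fun b j => d * (multiplier lam sig j * delta b j))).
  { rewrite <- HFd0 in Hdf.
    apply dmat_eq with (2 := dmat_comp (S (S (S k))) Fd f (0, 0) _ _ Hf Hdf HdFd).
    intros b j; destruct b, j; unfold delta; simpl; ring. }
  assert (HdGd' : dmat Gd (f (Fd (0, 0))) (fun b j => / d * delta b j))
    by (rewrite HFd0, Hf0; exact HdGd).
  apply dmat_eq with (2 := dmat_comp (S (S (S k))) (fun p => f (Fd p)) Gd (0, 0) _ _
    (diffeo_CWmap (diffeo_sym HFGd)) HdGd' H1).
  intros b j; destruct b, j; unfold delta; simpl; field; lra. }
(* The curve equation at the parameter [sig * y] says that the rescaled [f] sends [K(y)] to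
   [K(sig y)]. The bound on [y] keeps both parameters where [F] is given by [P]. *)
assert (Hax : exists eta, 0 < eta /\ forall y, Rabs y < eta -> f' (0, y) = (0, sig * y)).
{ destruct (small_image _ F (1 / 3) (diffeo_CWmap HFG) HF0) as [c1 [Hc1 HimF]]; [lra|].
  assert (Hsp : 0 < Rabs sig) by lra.
  assert (Hinv : 0 < / Rabs sig) by (apply Rinv_0_lt_compat, Hsp).
  set (b := Rmin 1 dw); assert (Hb : 0 < b) by (apply Rmin_glb_lt; lra).
  pose proof (Rmin_l 1 dw) as Hb1; pose proof (Rmin_r 1 dw) as Hb2; fold b in Hb1, Hb2.
  exists (Rmin c1 (b / Rabs sig)).
  split; [apply Rmin_glb_lt; [exact Hc1|apply Rdiv_lt_0_compat; assumption]|].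
  intros y Hy; pose proof (Rmin_l c1 (b / Rabs sig)); pose proof (Rmin_r c1 (b / Rabs sig)).
  assert (Hsy : Rabs (sig * y) < b).
  { rewrite Rabs_mult; apply Rmult_lt_reg_l with (/ Rabs sig); [exact Hinv|].
    rewrite <- Rmult_assoc, Rinv_l, Rmult_1_l by lra; unfold Rdiv in *; lra. }
  assert (Hyb : Rabs y < b) by (rewrite Rabs_mult in Hsy; pose proof (Rabs_pos y); nra).
  assert (HPa : forall t, Rabs t < b -> F (0, t) = (K false (t, 0), K true (t, 0))).
  { intros t Ht; rewrite HP by (split; simpl; [rewrite Rabs_R0|]; lra).
    unfold P; simpl; f_equal; ring. }
  assert (HFy : box (1 / 3) (F (0, y)))
    by (apply HimF; split; simpl; [rewrite Rabs_R0; exact Hc1|lra]).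
  unfold f', Gd, Fd; rewrite (Hnear _ HFy).
  assert (Hdd : forall p, dil (/ d) (dil d p) = p)
    by (intros p; apply (proj1 (dil_diffeo 0 d ltac:(lra)))).
  rewrite Hdd, (HPa y Hyb); simpl.
  transitivity (G (F (0, sig * y))); [|apply (proj1 HFG)].
  rewrite (HPa (sig * y) Hsy); f_equal.
  assert (Hst : strip (sig * y, 0)) by (unfold strip; simpl; lra).
  assert (Ey : sig * y / sig = y) by (field; exact Hs0).
  pose proof (HKeq false _ Hst) as E1; pose proof (HKeq true _ Hst) as E2.
  simpl in E1, E2; rewrite Ey in E1, E2; rewrite E1, E2; reflexivity. }
destruct Hax as [eta [Heta Hax]].
destruct (linearize_straight k f' lam sig eta) as [Phi [Psi [c [HPhi [HPhi0 [Hc Heq]]]]]];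
  try assumption.
exists (fun p => Fd (Phi p)), (fun p => Psi (Gd p)), c; split; [|split; [|split]].
- apply diffeo_comp; [|exact HPhi].
  apply diffeo_le with (2 := HFGd); lia.
- rewrite HPhi0; exact HFd0.
- exact Hc.
- intros p Hp; rewrite <- (Heq p Hp); unfold f'.
  symmetry; apply (proj1 (proj2 HFGd)).
Qed.

(** * Reduction to a diagonal linear part *)

Definition linmap (a b : R * R) (p : R * R) : R * R :=
  (fst a * fst p + fst b * snd p, snd a * fst p + snd b * snd p).

Lemma linmap_CWmap k a b : CWmap k (linmap a b).
Proof.
intros [|]; simpl; (apply CW_plus; [auto| |]);
  (apply CW_scal; [auto|]); try apply CW_fst; apply CW_snd.
Qed.

Lemma linmap_dmat a b p : dmat (linmap a b) p (fun d j => coord j (if d then b else a)).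
Proof.
intros d j.
assert (H : forall s t, is_pd d (fun q => s * fst q + t * snd q) p (if d then t else s)).
{ intros s t.
  apply (is_pd_eq _ (is_pd_plus (is_pd_scal _ s _ _ _ (is_pd_fst d p))
    (is_pd_scal _ t _ _ _ (is_pd_snd d p)))).
  destruct d; ring. }
destruct j; simpl; [apply (is_pd_eq _ (H (snd a) (snd b)))
  |apply (is_pd_eq _ (H (fst a) (fst b)))]; destruct d; reflexivity.
Qed.

Lemma linmap_diffeo k (a b : R * R) : fst a * snd b - snd a * fst b <> 0 ->
  let D := fst a * snd b - snd a * fst b in
  diffeo k (linmap a b) (linmap (snd b / D, - snd a / D) (- fst b / D, fst a / D)).
Proof.
intros HD D; split; [|split].
- intros [x y]; unfold linmap, D; simpl; f_equal; field; exact HD.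
- intros [x y]; unfold linmap, D; simpl; f_equal; field; exact HD.
- intros j; split; apply linmap_CWmap.
Qed.

Lemma CWmap_continuous k F p : CWmap k F -> continuous F p.
Proof.
intros HF; apply continuous_ext with (fun q => (coord false (F q), coord true (F q))).
- intros q; simpl; destruct (F q); reflexivity.
- apply continuous_pair; exact (CW_cont p (HF _) I).
Qed.

Lemma CWmap_CkMap k U F : CWmap k F -> CkMap k U F.
Proof.
intros HF; split; apply CW_Ck; apply CW_sub with plane; try (intros; exact I);
  [apply (HF false)|apply (HF true)].
Qed.

(** If the determinant vanishes, then [v1 w = w1 v] and [v2 w = w2 v]. Applying [L] multiplies the
    two sides by [sig] and by [lam], so all products of a coordinate of [v] with one of [w] are
    zero. *)
Lemma eigenvectors_independent (L : R * R -> R * R) lam sig v w :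
  (forall p q t, L (t * fst p + fst q, t * snd p + snd q)
     = (t * fst (L p) + fst (L q), t * snd (L p) + snd (L q))) ->
  L v = (lam * fst v, lam * snd v) -> L w = (sig * fst w, sig * snd w) ->
  v <> origin -> w <> origin -> lam <> sig -> fst v * snd w - snd v * fst w <> 0.
Proof.
intros HL Hv Hw Hv0 Hw0 Hne HD.
(* With [t = -1] and both points at 0, the right-hand side of linearity cancels. *)
assert (HL0 : L (0, 0) = (0, 0)).
{ pose proof (HL (0, 0) (0, 0) (-1)) as H; simpl in H.
  replace (-1 * 0 + 0) with 0 in H by ring.
  rewrite (surjective_pairing (L (0, 0))) at 1; rewrite H; simpl.
  destruct (L (0, 0)) as [a b]; simpl in *; injection H as Ha Hb; f_equal; lra. }
destruct v as [v1 v2], w as [w1 w2]; simpl in *; unfold origin in *.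
assert (Hs : forall s p, L (s * fst p, s * snd p) = (s * fst (L p), s * snd (L p))).
{ intros s p; pose proof (HL p (0, 0) s) as H; rewrite HL0 in H; simpl in H.
  rewrite !Rplus_0_r in H; exact H. }
assert (E1 : L (v1 * w1, v1 * w2) = L (w1 * v1, w1 * v2)) by (do 2 f_equal; lra).
assert (E2 : L (v2 * w1, v2 * w2) = L (w2 * v1, w2 * v2)) by (do 2 f_equal; lra).
pose proof (Hs v1 (w1, w2)) as S1; pose proof (Hs w1 (v1, v2)) as S2.
pose proof (Hs v2 (w1, w2)) as S3; pose proof (Hs w2 (v1, v2)) as S4.
rewrite Hw in S1, S3; rewrite Hv in S2, S4; simpl in S1, S2, S3, S4.
rewrite S1, S2 in E1; rewrite S3, S4 in E2.
injection E1 as E11 E12; injection E2 as E21 E22.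
assert (Hz : forall x, (sig - lam) * x = 0 -> x = 0).
{ intros x Hx; apply Rmult_integral in Hx; destruct Hx as [Hx|Hx]; [|exact Hx].
  exfalso; apply Hne; lra. }
assert (Z1 : v1 * w1 = 0) by (apply Hz; lra).
assert (Z2 : v1 * w2 = 0) by (apply Hz; nra).
assert (Z3 : v2 * w1 = 0) by lra.
assert (Z4 : v2 * w2 = 0) by (apply Hz; lra).
apply Hw0; destruct (Req_dec v1 0) as [H1|H1].
- assert (H2 : v2 <> 0) by (intros H2; apply Hv0; rewrite H1, H2; reflexivity).
  f_equal; apply Rmult_eq_reg_l with v2; lra.
- f_equal; apply Rmult_eq_reg_l with v1; lra.
Qed.

Theorem theorem0p7 (r : nat) (f : R * R -> R * R) (lam sig : R) :
  (4 <= r)%nat ->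
  Ck_diffeo_R2 r f ->
  f origin = origin ->
  eigenvalue (Dmap f origin) lam ->
  eigenvalue (Dmap f origin) sig ->
  Rabs lam < 1 -> 1 < Rabs sig ->
  Rabs lam * Rabs sig ^ (r - 2) < 1 ->
  Ck_linearizable_at0 (r - 2) f.
Proof.
intros Hr [g [Hgf [Hfg [[Hf1 Hf2] [Hg1 Hg2]]]]] Hf0 [v [Hv0 Hv]] [w [Hw0 Hw]] Hl Hs Hrate.
destruct r as [|[|[|[|k]]]]; try lia.
replace (S (S (S (S k))) - 2)%nat with (S (S k)) in * by lia.
assert (Hdf : diffeo (S (S (S (S k)))) f g).
{ split; [exact Hgf|]; split; [exact Hfg|].
  intros [|]; split; apply CW_Ck; assumption. }
assert (Hf : CWmap (S (S (S (S k)))) f) by exact (diffeo_CWmap Hdf).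
pose proof (dmat_CW _ f (0, 0) Hf) as HA.
set (A := fun b j => pd b (fun q => coord j (f q)) (0, 0)) in HA.
assert (HD : forall p, Dmap f origin p
  = (A false false * fst p + A true false * snd p, A false true * fst p + A true true * snd p))
  by reflexivity.
assert (Hne : lam <> sig) by (intros E; subst sig; lra).
pose proof (eigenvectors_independent (Dmap f origin) lam sig v w) as Hind.
specialize (Hind ltac:(intros p q t; rewrite !HD; simpl; f_equal; ring) Hv Hw Hv0 Hw0 Hne).
set (D := fst v * snd w - snd v * fst w) in Hind.
assert (Hv1 : A false false * fst v + A true false * snd v = lam * fst v) by exact (f_equal fst Hv).
assert (Hv2 : A false true * fst v + A true true * snd v = lam * snd v) by exact (f_equal snd Hv).
assert (Hw1 : A false false * fst w + A true false * snd w = sig * fst w) by exact (f_equal fst Hw).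
assert (Hw2 : A false true * fst w + A true true * snd w = sig * snd w) by exact (f_equal snd Hw).
clearbody A.
(* If [lam = 0], the derivative of [f] kills [v]; the derivative of [g] is a left inverse of it, so
   [v] would be zero. *)
assert (Hl0 : lam <> 0).
{ intros E; apply Hv0; rewrite E, Rmult_0_l in Hv1, Hv2.
  pose proof (dmat_inverse _ f g (0, 0) A Hdf HA) as HB.
  set (B := fun i j => pd i (fun q => coord j (g q)) (f (0, 0))).
  assert (H : forall j, delta false j * fst v + delta true j * snd v = 0).
  { intros j; rewrite <- (HB false j), <- (HB true j).
    transitivity (B false j * (A false false * fst v + A true false * snd v)
      + B true j * (A false true * fst v + A true true * snd v)); [unfold B; ring|].
    rewrite Hv1, Hv2; ring. }
  pose proof (H false) as H1; pose proof (H true) as H2; unfold delta in H1, H2; simpl in H1, H2.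
  rewrite (surjective_pairing v); unfold origin; f_equal; lra. }
set (P := linmap v w).
set (Q := linmap (snd w / D, - snd v / D) (- fst w / D, fst v / D)).
assert (HPQ : forall n, diffeo n P Q) by (intros n; exact (linmap_diffeo n v w Hind)).
assert (HP0 : P (0, 0) = (0, 0)) by (unfold P, linmap; simpl; f_equal; ring).
assert (HQ0 : Q (0, 0) = (0, 0)) by (unfold Q, linmap; simpl; f_equal; ring).
destruct (linearize_diagonal k (fun p => Q (f (P p))) lam sig) as [Phi [Psi [c [HPhi [HPhi0 [Hc Heq]]]]]];
  try assumption.
{ rewrite HP0; unfold origin in Hf0; rewrite Hf0; exact HQ0. }
{ apply (CWmap_comp _ Q (fun p => f (P p))); [apply linmap_CWmap|].
  apply CWmap_comp; [exact Hf|apply linmap_CWmap]. }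
{ assert (HfP : dmat f (P (0, 0)) A) by (rewrite HP0; exact HA).
  pose proof (dmat_comp _ P f (0, 0) _ _ Hf HfP (linmap_dmat v w _)) as H1.
  pose proof (dmat_comp _ (fun p => f (P p)) Q (0, 0) _ _
    (linmap_CWmap 1 _ _) (linmap_dmat _ _ _) H1) as H2.
  apply dmat_eq with (2 := H2).
  intros [|] j; simpl.
  - replace (A false false * fst w + A true false * snd w) with (sig * fst w) by lra.
    replace (A false true * fst w + A true true * snd w) with (sig * snd w) by lra.
    destruct j; unfold delta, D; simpl; field; exact Hind.
  - replace (A false false * fst v + A true false * snd v) with (lam * fst v) by lra.
    replace (A false true * fst v + A true true * snd v) with (lam * snd v) by lra.
    destruct j; unfold delta, D; simpl; field; exact Hind. }
set (phi := fun p => P (Phi (Q p))); set (psi := fun p => P (Psi (Q p))).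
assert (Hphi : diffeo (S (S k)) phi psi).
{ apply (diffeo_comp _ P Q (fun p => Phi (Q p)) (fun p => P (Psi p))); [apply HPQ|].
  apply (diffeo_comp _ Phi Psi Q P); [exact HPhi|apply diffeo_sym, HPQ]. }
set (U := fun x => box c (Q x)).
assert (HU : open U).
{ apply (open_comp Q (box c)); [|auto].
  intros p _; exact (CWmap_continuous 0 Q p (linmap_CWmap 0 _ _)). }
assert (Hb0 : box c (0, 0)) by (split; simpl; rewrite Rabs_R0; exact Hc).
assert (Hphi0 : phi origin = origin).
{ unfold phi, origin; rewrite HQ0, HPhi0; exact HP0. }
(* The second set is the image [phi(U)], open as the preimage of [U] under [psi]. *)
exists U, (fun y => U (psi y)), phi, psi.
split; [exact HU|]; split; [unfold U, origin; rewrite HQ0; exact Hb0|].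
split; [apply (open_comp psi U); [|exact HU];
  intros p _; exact (CWmap_continuous _ psi p (diffeo_CWmap (diffeo_sym Hphi)))|].
split; [rewrite <- Hphi0, (proj1 Hphi); unfold U, origin; rewrite HQ0; exact Hb0|].
split; [intros x Hx; rewrite (proj1 Hphi); split; [exact Hx|reflexivity]|].
split; [intros y Hy; split; [exact Hy|apply (proj1 (proj2 Hphi))]|].
split; [apply CWmap_CkMap; exact (diffeo_CWmap Hphi)|].
split; [apply CWmap_CkMap; exact (diffeo_CWmap (diffeo_sym Hphi))|].
split; [exact Hphi0|].
intros x Hx _; unfold phi.
(* In the eigenbasis the derivative of [f] is [lin lam sig], so the conjugacy obtained there
   transports back through [P]. *)
assert (EQ : Q (Dmap f origin x) = lin lam sig (Q x)).
{ rewrite <- (proj1 (proj2 (HPQ 0%nat)) x) at 1; rewrite HD.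
  set (q := Q x); clearbody q.
  transitivity (Q (P (lin lam sig q))); [|apply (proj1 (HPQ 0%nat))].
  f_equal; unfold P, linmap, lin; simpl; f_equal.
  - transitivity (fst q * (A false false * fst v + A true false * snd v)
      + snd q * (A false false * fst w + A true false * snd w)); [ring|rewrite Hv1, Hw1; ring].
  - transitivity (fst q * (A false true * fst v + A true true * snd v)
      + snd q * (A false true * fst w + A true true * snd w)); [ring|rewrite Hv2, Hw2; ring]. }
rewrite EQ, <- (Heq _ Hx).
symmetry; apply (proj1 (proj2 (HPQ 0%nat))).
Qed.
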